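(* Let $a>-1$ and $b>0$ be given. For each $\delta>0$ there exists $\varepsilon_{*}>0$ such that for all $\varepsilon\in(0,\varepsilon_*]$ and each self-similar profile $u^{(\varepsilon)}$ for the kernel $K_\varepsilon$ with total mass one, $$\|u^{(\varepsilon)}-e^{-\cdot}\|_{X^{a,b}}\leq \delta .$$ In particular, if $u^{(\varepsilon)}_1$ and $u^{(\varepsilon)}_2$ are two self-similar profiles for $K_\varepsilon$ with total mass one, then $\|u^{(\varepsilon)}_1-u^{(\varepsilon)}_2\|_{X^{a,b}}\leq 2\delta$ if $\varepsilon\leq\varepsilon_*$.
   Context: Kernel: fix $\alpha\in(0,1)$ and a function $W:(0,\infty)^2\to[0,\infty)$ that is continuous, symmetric ($W(x,y)=W(y,x)$), homogeneous of degree zero ($W(\lambda x,\lambda y)=W(x,y)$ for all $\lambda,x,y>0$) and satisfies $W(x,y)\le (x/y)^\alpha+(y/x)^\alpha$ for all $x,y>0$. For $\varepsilon\ge 0$ put $K_\varepsilon(x,y)=2+\varepsilon W(x,y)$. Self-similar profile: for $\varepsilon\ge0$, a self-similar profile for $K_\varepsilon$ is a function $u\in L^1_{\mathrm{loc}}(0,\infty)$ that is almost everywhere non-negative, satisfies $\int_0^\infty x u(x)\,dx<\infty$, and satisfies $x^2u(x)=\int_0^x\int_{x-y}^\infty yK_\varepsilon(y,z)u(y)u(z)\,dz\,dy$ for almost every $x\in(0,\infty)$. It has total mass one if $\int_0^\infty x u(x)\,dx=1$. Spaces: for $a,b\in\mathbb{R}$ let $\omega_{a,b}(x)=x^a$ if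 $0<x\le1$ and $\omega_{a,b}(x)=x^b$ if $x\ge 1$. Then $X^{a,b}=\{g\in L^1(0,\infty): \int_0^\infty|g(x)|\omega_{a,b}(x)\,dx<\infty\}$ with norm $\|g\|_{X^{a,b}}=\int_0^\infty|g(x)|\omega_{a,b}(x)\,dx$. The symbol $e^{-\cdot}$ denotes the function $x\mapsto e^{-x}$. *)

(* Defs.v *)
From HB Require Import structures.
From mathcomp Require Import all_boot all_order all_algebra.
From mathcomp Require Import all_classical all_reals all_analysis.

Set Implicit Arguments.
Unset Strict Implicit.
Unset Printing Implicit Defensive.

Import Order.TTheory GRing.Theory Num.Theory.
Import numFieldNormedType.Exports.

Local Open Scope classical_set_scope.
Local Open Scope ring_scope.

(* Functions on (0,oo) are represented by total functions on R; their values
   outside (0,oo) are never used. Measurability is Borel measurability: every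
   Lebesgue-measurable function has a Borel version, equal to it almost
   everywhere. *)

Record admissible_perturbation (R : realType) (alpha : R) (W : R -> R -> R)
    : Prop := AdmissiblePerturbation {
  perturbation_ge0 : forall x y : R, 0 < x -> 0 < y -> 0 <= W x y;
  perturbation_continuous :
    {within [set p : R * R | 0 < p.1 /\ 0 < p.2],
      continuous (fun p : R * R => W p.1 p.2)};
  perturbation_sym : forall x y : R, 0 < x -> 0 < y -> W x y = W y x;
  perturbation_homogeneous : forall l x y : R, 0 < l -> 0 < x -> 0 < y ->
    W (l * x) (l * y) = W x y;
  perturbation_bound : forall x y : R, 0 < x -> 0 < y ->
    W x y <= (x / y) `^ alpha + (y / x) `^ alpha
}.

Definition perturbed_kernel (R : realType) (W : R -> R -> R) (eps : R)
  (x y : R) : R := 2 + eps * W x y.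

Record self_similar_profile (R : realType) (K : R -> R -> R) (u : R -> R)
    : Prop := SelfSimilarProfile {
  profile_locally_integrable : locally_integrable `]0, +oo[ u;
  profile_ae_ge0 : {ae lebesgue_measure, forall x : R, 0 < x -> 0 <= u x};
  profile_finite_mass :
    (\int[lebesgue_measure]_(x in `]0%R, +oo[) (x * u x)%:E < +oo)%E;
  profile_equation : {ae lebesgue_measure, forall x : R, 0 < x ->
    ((x ^+ 2 * u x)%:E =
      \int[lebesgue_measure]_(y in `]0%R, x[)
        \int[lebesgue_measure]_(z in `](x - y)%R, +oo[)
          (y * K y z * u y * u z)%:E)%E}
}.

Definition total_mass_one (R : realType) (u : R -> R) : Prop :=
  (\int[lebesgue_measure]_(x in `]0%R, +oo[) (x * u x)%:E = 1)%E.

Definition weight (R : realType) (a b x : R) : R :=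
  if x <= 1 then x `^ a else x `^ b.

Definition Xnorm (R : realType) (a b : R) (g : R -> R) : \bar R :=
  (\int[lebesgue_measure]_(x in `]0%R, +oo[) (`|g x| * weight a b x)%:E)%E.

(* For a > 0 membership in L^1(0,oo) does not follow from Xnorm a b g < +oo. *)
Definition Xspace (R : realType) (a b : R) : set (R -> R) :=
  [set g | (@lebesgue_measure R).-integrable `]0, +oo[ (EFin \o g) /\
           (Xnorm a b g < +oo)%E].

(* Main.v *)
Require Import Defs.
From HB Require Import structures.
From mathcomp Require Import all_boot all_order all_algebra.
From mathcomp Require Import all_classical all_reals all_analysis.
From mathcomp Require Import measurable_realfun lra.

(** Let [K = 2 + eps * W]. Every profile [u] of mass one is compared with
[e^{-x}], which is the profile of the kernel [2].

The Laplace transform. Put [g_p(x) = 1 - e^{-px}] and let [U(p)] be the integral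
of [g_p u]. Integrating the equation against [- (g_p(x) / x)'] and symmetrising
in the two variables turns the contribution of the kernel [2] into [U(p)^2],
while the left-hand side becomes [U - p U']. As
[0 <= W(x,y) <= (x/y)^alpha + (y/x)^alpha], this gives
[U^2 <= U - p U' <= U^2 + 2 eps p^{2-alpha}] ([np_riccati_lower],
[np_riccati_upper]). Mass one means [U(p)/p -> 1] as [p -> 0], and comparison
with the solution [p/(1+p)] of the unperturbed equation yields
[p/(1+p) - C eps p^{2-alpha} <= U(p) <= p/(1+p)] ([np_U_le], [np_U_ge]).
In particular the integral of [u] is at most 1, and tends to 1 with [eps].

Inversion. In the variable [s = e^{-x}] the values of [U] at the integers
determine the integrals of the powers of [s], once the integral of [u] is known,
and thereby the integrals of Bernstein polynomials. Those of a step function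
approximate it away from its jump, by Chebyshev's inequality. Since the tail
[t |-> e^{-t}] of the limit is continuous, the tails of [u] are close to it
uniformly in [t] ([np_tail_close]).

From weak to strong. The equation expresses [x^2 u(x)] through integrals of [u].
For the kernel [2] such an integral is a continuous function of the tails of
[u] ([flux2_upper], [flux2_lower]); the contribution of [eps W] has integral
[O(eps)]. Therefore [u] is close to [e^{-x}] in [L^1(kappa, L)] for all
[0 < kappa < L] ([interior_bound]).

The ends. Moments of order above [-1] and moments of high order are bounded
uniformly in [eps] ([small_moment_bound], [high_moment]), so that little weighted
mass lies outside [(kappa, L)] ([weighted_distance_small]).

The function [e^{-x}] satisfies the hypotheses of all these lemmas with
[eps = 0] ([near_profile_exp]), so the moment bounds hold for both terms of the
difference [u - e^{-x}]. *)

Set Implicit Arguments.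
Unset Strict Implicit.
Unset Printing Implicit Defensive.
Import Order.TTheory GRing.Theory Num.Theory.
Import numFieldNormedType.Exports.
Local Open Scope classical_set_scope.
Local Open Scope ring_scope.

(** * Measurability and iterated integrals *)

Lemma measurable_inv (R : realType) :
  measurable_fun [set: R] (fun x : R => x^-1).
Proof.
(* The square makes the base of the real power nonnegative, for both signs of x. *)
have -> : (fun x : R => x^-1) = (fun x : R => x * (x ^+ 2) `^ (-1)).
  apply/funext => x; rewrite powR_inv1 ?sqr_ge0//.
  have [->|x0] := eqVneq x 0; first by rewrite mul0r invr0.
  by rewrite expr2 invfM mulrA divff// mul1r.
apply: measurable_funM => //.
apply: (measurableT_comp (@measurable_powR R (-1))).
exact: exprn_measurable.
Qed.

Ltac meas := repeat match goal with
  | |- measurable_fun _ (fun x => (_)%:E) => apply/measurable_EFinP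
  | H : measurable_fun ?D ?f |- measurable_fun ?D ?f => exact: H
  | |- measurable_fun _ (fun x => x) => exact: measurable_id
  | |- measurable_fun _ (fun x => ?c) => exact: measurable_cst
  | |- measurable_fun _ (fun x => fst x) => exact: measurable_fst
  | |- measurable_fun _ (fun x => snd x) => exact: measurable_snd
  | |- measurable_fun _ (fun x => fst (@?f x)) =>
      apply: (measurableT_comp measurable_fst)
  | |- measurable_fun _ (fun x => snd (@?f x)) =>
      apply: (measurableT_comp measurable_snd)
  | |- measurable_fun _ (fun x => (@?f x) + (@?g x)) => apply: measurable_funD
  | |- measurable_fun _ (fun x => - (@?f x)) => apply: measurable_funN
  | |- measurable_fun _ (fun x => (@?f x) * (@?g x)) => apply: measurable_funM
  | |- measurable_fun _ (fun x => (@?f x) ^+ _) => apply: measurable_funX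
  | |- measurable_fun _ (fun x => Num.max (@?f x) (@?g x)) =>
      apply: measurable_maxr
  | |- measurable_fun _ (fun x => (@?f x) < (@?g x)) =>
      apply: measurable_fun_ltr
  | |- measurable_fun _ (fun x => (@?f x) <= (@?g x)) =>
      apply: measurable_fun_ler
  | |- measurable_fun _ (fun x => (@?f x)^-1) =>
      apply: (measurableT_comp (@measurable_inv _))
  | |- measurable_fun _ (fun x => expR (@?f x)) =>
      apply: (measurableT_comp (@measurable_expR _))
  | |- measurable_fun _ (fun x => (@?f x) `^ ?p) =>
      apply: (measurableT_comp (@measurable_powR _ p))
  | |- measurable_fun _ (fun x => `|@?f x|) =>
      apply: (measurableT_comp (@normr_measurable _ _))
  | H : measurable_fun setT ?f |- measurable_fun _ (fun x => ?f (@?g x)) =>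
      apply: (measurableT_comp H)
  | |- measurable_fun _ ( *%R ?k) => exact: mulrl_measurable
  | |- measurable_fun _ GRing.inv => exact: measurable_inv
  | |- measurable_fun _ (fun x => (@?f x) && (@?g x)) =>
      apply: measurable_and
  | |- measurable_fun _ (<%O ?y) => apply: measurable_fun_ltr
  | |- measurable_fun _ (<=%O ?y) => apply: measurable_fun_ler
  | |- measurable_fun _ ( +%R ?y) => apply: measurable_funD
  | |- measurable_fun _ -%R => exact: oppr_measurable
  | |- measurable_fun _ (@expR _) => exact: measurable_expR
  | |- measurable_fun _ fst => exact: measurable_fst
  | |- measurable_fun _ snd => exact: measurable_snd
  | |- measurable_fun _ _ => apply: measurable_fun_ifT
  end.

Section fubini3.
Variable R : realType.
Notation mu := (@lebesgue_measure R).
(** Moves the outermost integration inside: in [integral_flux] the variable of the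
test function has to be integrated first. *)
Lemma fubini_tonelli3 (f : R * R * R -> \bar R) : measurable_fun setT f ->
  (forall x, 0 <= f x)%E ->
  (\int[mu]_x \int[mu]_y \int[mu]_z f (x, y, z) =
   \int[mu]_y \int[mu]_z \int[mu]_x f (x, y, z))%E.
Proof.
move=> mf f0.
rewrite (@fubini_tonelli _ _ _ _ _ mu mu (fun w => \int[mu]_z f (w, z))%E)/=.
- apply: eq_integral => y _.
  rewrite (@fubini_tonelli _ _ _ _ _ mu mu (fun w => f (w.1, y, w.2)))//=.
  apply: (measurableT_comp mf); apply: measurable_fun_pair => //.
  exact: measurable_fun_pair.
- exact: measurable_fun_fubini_tonelli_F.
- by move=> x; apply: integral_ge0.
Qed.
End fubini3.

(** * The flux and its weak form *)

Section flux.
Context {R : realType}.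
Notation mu := (@lebesgue_measure R).
Implicit Types (v psi : R -> R) (k : R -> R -> R).

Lemma integral_itv_if (i : interval R) (f : R -> \bar R) :
  (\int[mu]_(x in [set` i]) f x = \int[mu]_x (if x \in i then f x else 0))%E.
Proof.
rewrite integral_mkcond; apply: eq_integral => x _.
by rewrite patchE mem_setE.
Qed.

Lemma measurable_fun2 d (T : measurableType d)
    (k : R -> R -> R) (f g : T -> R) :
  measurable_fun [set: R * R] (fun p => k p.1 p.2) ->
  measurable_fun setT f -> measurable_fun setT g ->
  measurable_fun setT (fun t => k (f t) (g t)).
Proof.
move=> mk mf mg.
exact: (measurableT_comp (g := fun t => (f t, g t)) mk
  (measurable_fun_pair mf mg)).
Qed.

Lemma measurable_fun_integral (k : R -> R -> R) :
  measurable_fun [set: R * R] (fun p => k p.1 p.2) ->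
  (forall y z, 0 <= k y z) ->
  measurable_fun setT (fun y => \int[mu]_z (k y z)%:E)%E.
Proof.
move=> mk k0.
apply: (@measurable_fun_fubini_tonelli_F _ _ _ _ _ mu
  (fun p => (k p.1 p.2)%:E)).
  exact/measurable_EFinP.
by move=> p; rewrite lee_fin.
Qed.

(** The right-hand side of the equation: on [y < x], the condition [x < y + z] is
[x - y < z]. Using indicators instead of domains of integration makes the
exchanges of integrals below exchanges over the whole line. *)
Definition flux k v (x : R) : \bar R :=
  (\int[mu]_y \int[mu]_z
    ((if (y < x) && (x < y + z) then k y z * (y * v y * v z) else 0)%R)%:E)%E.

(** A density on the half-line, extended by 0 so that all integrals against it run
over the whole line. *)
Definition nonneg_density v : Prop :=
  [/\ measurable_fun setT v, (forall x, 0 <= v x) &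
      (forall x, x <= 0 -> v x = 0)].

Lemma density_ge0 v (g : R -> R) : nonneg_density v ->
  (forall x, 0 < x -> 0 <= g x) -> forall x, 0 <= g x * v x.
Proof.
move=> [_ v0 vn] g0 x; have [x0|x0] := leP x 0; first by rewrite vn// mulr0.
by rewrite mulr_ge0// g0.
Qed.

Lemma density_pair_ge0 v k y z : nonneg_density v ->
  (forall y z, 0 < y -> 0 < z -> 0 <= k y z) ->
  0 <= k y z * (v y * v z).
Proof.
move=> [_ v0 vn] k0.
have [y0|y0] := leP y 0; first by rewrite vn// mul0r mulr0.
have [z0|z0] := leP z 0; first by rewrite (vn z)// !mulr0.
by rewrite mulr_ge0// ?k0// mulr_ge0.
Qed.

Lemma flux_integrand_ge0 k v x y z : nonneg_density v ->
  (forall y z, 0 < y -> 0 < z -> 0 <= k y z) ->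
  0 <= if (y < x) && (x < y + z) then k y z * (y * v y * v z) else 0.
Proof.
move=> vd k0; case: ifP => // _.
have -> : (k y z * (y * v y * v z) = (k y z * y) * (v y * v z)) by lra.
apply: (@density_pair_ge0 v (fun y z => k y z * y)) => // {}y {}z y0 z0.
by rewrite mulr_ge0 ?k0// ltW.
Qed.

(** The weak form of the equation. A pair [(y, z)] contributes to the flux through
[x] exactly when [y < x < y + z], so integrating [psi] against the flux amounts
to integrating [Psi y z], the integral of [psi] over that interval, against
pairs. *)
Lemma integral_flux k v psi (Psi : R -> R -> R) : nonneg_density v ->
  measurable_fun [set: R * R] (fun p => k p.1 p.2) ->
  (forall y z, 0 < y -> 0 < z -> 0 <= k y z) ->
  measurable_fun setT psi -> (forall x, 0 <= psi x) ->
  (forall y z, 0 < y -> 0 < z ->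
    (\int[mu]_(x in `]y, (y + z)%R[) (psi x)%:E = (Psi y z)%:E)%E) ->
  (\int[mu]_x ((psi x)%:E * flux k v x) =
   \int[mu]_y \int[mu]_z ((k y z * Psi y z * y * (v y * v z))%R)%:E)%E.
Proof.
move=> vd mk k0 mpsi psi0 HPsi.
have [mv v0 vn] := vd.
have mk' : measurable_fun [set: R * R * R] (fun p => k p.1.2 p.2).
  by apply: measurable_fun2 => //; meas.
pose G (p : R * R * R) :=
  if (p.1.2 < p.1.1) && (p.1.1 < p.1.2 + p.2) then
    k p.1.2 p.2 * (p.1.2 * v p.1.2 * v p.2) else 0.
have mG : measurable_fun setT (EFin \o G).
  apply/measurable_EFinP; apply: measurable_fun_ifT; last by meas.
    by apply: measurable_and; meas.
  by apply: measurable_funM => //; meas.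
have G0 p : 0 <= G p by rewrite flux_integrand_ge0.
pose F (p : R * R * R) := psi p.1.1 * G p.
have mF : measurable_fun setT (EFin \o F).
  apply/measurable_EFinP; apply: measurable_funM; first by meas.
  exact/measurable_EFinP.
have F0 p : 0 <= F p by rewrite mulr_ge0.
transitivity (\int[mu]_x \int[mu]_y \int[mu]_z (EFin \o F) (x, y, z))%E.
  apply: eq_integral => x _; rewrite /flux -ge0_integralZl//.
  - apply: eq_integral => y _; rewrite -ge0_integralZl//.
    + exact: (measurableT_comp mG (pair1_measurable (x, y))).
    + by move=> z _; rewrite lee_fin; exact: (G0 (x, y, z)).
    + by rewrite lee_fin.
  - have mGx : measurable_fun setT (fun p : R * R => G (x, p.1, p.2)).
      have /measurable_EFinP mG' := mG.
      refine (measurableT_comp (g := fun p => (x, p.1, p.2)) mG' _).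
      apply: measurable_fun_pair; last by meas.
      by apply: measurable_fun_pair; meas.
    exact (measurable_fun_integral mGx (fun y z => G0 (x, y, z))).
  - move=> y _; apply: integral_ge0 => z _; rewrite lee_fin.
    exact: (G0 (x, y, z)).
  - by rewrite lee_fin.
have -> := fubini_tonelli3 mF (fun p => (F0 p : (0 <= (EFin \o F) p)%E)).
apply: eq_integral => y _.
apply: eq_integral => z _; rewrite /F/G/=.
have [y0|y0] := leP y 0.
  rewrite integral0_eq => [|x _]; first by rewrite (vn _ y0) mul0r !mulr0.
  by rewrite (vn _ y0) !(mulr0, mul0r) if_same mulr0.
have [z0|z0] := leP z 0.
  rewrite integral0_eq => [|x _]; first by rewrite (vn _ z0) !mulr0.
  by rewrite (vn _ z0) !mulr0 if_same mulr0.
have -> : ((k y z * Psi y z * y * (v y * v z)) =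
  (k y z * (y * v y * v z)) * Psi y z) by lra.
rewrite EFinM -HPsi// integral_itv_if -ge0_integralZl//.
- apply: eq_integral => x _; rewrite in_itv/=; case: ifP => _; last by rewrite mulr0 mule0.
  by rewrite -EFinM mulrC.
- apply: measurable_fun_ifT; last by meas.
    rewrite (_ : (fun x => _) = (fun x => (y < x) && (x < y + z))).
      by apply: measurable_and; meas.
    by apply/funext => x; rewrite in_itv.
  by meas.
- by move=> x _; case: ifP => //; rewrite lee_fin.
- by rewrite lee_fin mulr_ge0 ?k0 ?mulr_ge0// ltW.
Qed.
End flux.

(** * Moments of a density and of pairs *)

Section moments.
Context {R : realType}.
Notation mu := (@lebesgue_measure R).
Implicit Types (v psi phi : R -> R) (k F G : R -> R -> R).

Definition moment v phi : \bar R := (\int[mu]_x (phi x * v x)%:E)%E.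

Definition moment2 v F : \bar R :=
  (\int[mu]_y \int[mu]_z (F y z * (v y * v z))%:E)%E.

Definition nonneg_on phi := forall x, 0 < x -> 0 <= phi x.
Definition nonneg_on2 F := forall y z, 0 < y -> 0 < z -> 0 <= F y z.
Definition measurable2 F := measurable_fun [set: R * R] (fun p => F p.1 p.2).

Section single.
Variable v : R -> R.
Hypothesis vd : nonneg_density v.
Let mv : measurable_fun setT v. Proof. by case: vd. Qed.

Lemma measurable_moment phi : measurable_fun setT phi ->
  measurable_fun setT (fun x => (phi x * v x)%:E).
Proof. by move=> mphi; meas. Qed.

Lemma moment_ge0 phi : nonneg_on phi -> (0 <= moment v phi)%E.
Proof.
by move=> phi0; apply: integral_ge0 => x _; rewrite lee_fin density_ge0.
Qed.

Lemma eq_moment phi psi : (forall x, 0 < x -> phi x = psi x) ->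
  moment v phi = moment v psi.
Proof.
move=> h; apply: eq_integral => x _.
have [x0|x0] := leP x 0; last by rewrite h.
by case: vd => _ _ ->//; rewrite !mulr0.
Qed.

Lemma le_moment phi psi : measurable_fun setT phi -> measurable_fun setT psi ->
  nonneg_on phi -> (forall x, 0 < x -> phi x <= psi x) ->
  (moment v phi <= moment v psi)%E.
Proof.
move=> m1 m2 p1 h; apply: ge0_le_integral => //.
- by move=> x _; rewrite lee_fin density_ge0.
- exact: measurable_moment.
- exact: measurable_moment.
- move=> x _; rewrite lee_fin -subr_ge0 -mulrBl.
  by apply: (@density_ge0 _ _ (fun x => psi x - phi x)) => // y /h; rewrite subr_ge0.
Qed.

Lemma momentD phi psi : measurable_fun setT phi -> measurable_fun setT psi ->
  nonneg_on phi -> nonneg_on psi ->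
  moment v (fun x => phi x + psi x) = (moment v phi + moment v psi)%E.
Proof.
move=> m1 m2 p1 p2; rewrite /moment -ge0_integralD//.
- by apply: eq_integral => x _; rewrite mulrDl EFinD.
- by move=> x _; rewrite lee_fin density_ge0.
- exact: measurable_moment.
- by move=> x _; rewrite lee_fin density_ge0.
- exact: measurable_moment.
Qed.

Lemma momentZ c phi : measurable_fun setT phi -> 0 <= c -> nonneg_on phi ->
  moment v (fun x => c * phi x) = (c%:E * moment v phi)%E.
Proof.
move=> m1 c0 p1; rewrite /moment -ge0_integralZl//.
- by apply: eq_integral => x _; rewrite -mulrA EFinM.
- exact: measurable_moment.
- by move=> x _; rewrite lee_fin density_ge0.
Qed.

Lemma density_pairE F y z : nonneg_on2 F -> 0 <= F y z * (v y * v z).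
Proof. exact: density_pair_ge0. Qed.

Lemma moment2_measurable F : measurable2 F ->
  measurable_fun [set: R * R] (fun p => F p.1 p.2 * (v p.1 * v p.2)).
Proof. by move=> mF; apply: measurable_funM => //; meas. Qed.

Lemma moment2_inner_measurable F : measurable2 F -> nonneg_on2 F ->
  measurable_fun setT (fun y => \int[mu]_z (F y z * (v y * v z))%:E)%E.
Proof.
move=> mF F0; apply: (measurable_fun_integral (k := fun y z => F y z * (v y * v z))).
  exact: moment2_measurable.
by move=> y z; exact: density_pairE.
Qed.

Lemma moment2_section_measurable F y : measurable2 F ->
  measurable_fun setT (fun z => (F y z * (v y * v z))%:E).
Proof.
move=> /moment2_measurable mF; apply/measurable_EFinP.
exact: (measurableT_comp mF (pair1_measurable y)).
Qed.

Lemma eq_moment2 F G : (forall y z, 0 < y -> 0 < z -> F y z = G y z) ->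
  moment2 v F = moment2 v G.
Proof.
have [_ _ vn] := vd.
move=> h; apply: eq_integral => y _; apply: eq_integral => z _.
have [y0|y0] := leP y 0; first by rewrite (vn _ y0) mul0r !mulr0.
have [z0|z0] := leP z 0; first by rewrite (vn _ z0) !mulr0.
by rewrite h.
Qed.

Lemma le_moment2 F G : measurable2 F -> measurable2 G -> nonneg_on2 F ->
  (forall y z, 0 < y -> 0 < z -> F y z <= G y z) ->
  (moment2 v F <= moment2 v G)%E.
Proof.
move=> m1 m2 p1 h.
have p2 : nonneg_on2 G.
  by move=> y z y0 z0; exact: le_trans (p1 _ _ y0 z0) (h _ _ y0 z0).
apply: ge0_le_integral => //.
- by move=> y _; apply: integral_ge0 => z _; rewrite lee_fin density_pairE.
- exact: moment2_inner_measurable.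
- exact: moment2_inner_measurable.
- move=> y _; apply: ge0_le_integral => //.
  + by move=> z _; rewrite lee_fin density_pairE.
  + exact: moment2_section_measurable.
  + exact: moment2_section_measurable.
  + move=> z _; rewrite lee_fin -subr_ge0 -mulrBl.
    apply: (@density_pairE (fun y z => G y z - F y z)) => {}y {}z y0 z0.
    by rewrite subr_ge0 h.
Qed.

Lemma moment2D F G : measurable2 F -> measurable2 G -> nonneg_on2 F ->
  nonneg_on2 G ->
  moment2 v (fun y z => F y z + G y z) = (moment2 v F + moment2 v G)%E.
Proof.
move=> m1 m2 p1 p2; rewrite /moment2 -ge0_integralD//.
- apply: eq_integral => y _; rewrite -ge0_integralD//.
  + by apply: eq_integral => z _; rewrite mulrDl EFinD.
  + by move=> z _; rewrite lee_fin density_pairE.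
  + exact: moment2_section_measurable.
  + by move=> z _; rewrite lee_fin density_pairE.
  + exact: moment2_section_measurable.
- by move=> y _; apply: integral_ge0 => z _; rewrite lee_fin density_pairE.
- exact: moment2_inner_measurable.
- by move=> y _; apply: integral_ge0 => z _; rewrite lee_fin density_pairE.
- exact: moment2_inner_measurable.
Qed.

Lemma moment2_swap F : measurable2 F -> nonneg_on2 F ->
  moment2 v F = moment2 v (fun y z => F z y).
Proof.
move=> m1 p1; rewrite /moment2.
rewrite (@fubini_tonelli _ _ _ _ _ mu mu
  (fun p => (F p.1 p.2 * (v p.1 * v p.2))%:E))/=.
- by apply: eq_integral => y _; apply: eq_integral => z _; rewrite [v z * _]mulrC.
- by apply/measurable_EFinP; exact: moment2_measurable.
- by move=> p; rewrite lee_fin density_pairE.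
Qed.

Lemma moment2_prod phi psi : measurable_fun setT phi -> measurable_fun setT psi ->
  nonneg_on phi -> nonneg_on psi ->
  moment2 v (fun y z => phi y * psi z) = (moment v phi * moment v psi)%E.
Proof.
move=> m1 m2 p1 p2; rewrite /moment2 /moment -ge0_integralZr//.
- apply: eq_integral => y _; rewrite -ge0_integralZl//.
  + by apply: eq_integral => z _; rewrite -EFinM; congr (_%:E); lra.
  + exact: measurable_moment.
  + by move=> z _; rewrite lee_fin density_ge0.
  + by rewrite lee_fin density_ge0.
- exact: measurable_moment.
- by move=> z _; rewrite lee_fin density_ge0.
- by apply: integral_ge0 => z _; rewrite lee_fin density_ge0.
Qed.

Lemma measurable2_swap F : measurable2 F -> measurable2 (fun y z => F z y).
Proof.
move=> mF; rewrite /measurable2.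
apply: (measurable_fun2 (f := snd) (g := fst)) => //.
Qed.

(** The measure [v y * v z] is invariant under exchange of [y] and [z]; this is how
the test functions built from [gexp] produce products of transforms. *)
Lemma moment2_symmetrize k F G : measurable2 k -> measurable2 F ->
  nonneg_on2 k -> nonneg_on2 F ->
  (forall y z, 0 < y -> 0 < z -> k y z = k z y) ->
  (forall y z, 0 < y -> 0 < z -> F y z + F z y = G y z) ->
  moment2 v (fun y z => 2 * k y z * F y z) = moment2 v (fun y z => k y z * G y z).
Proof.
move=> mk mF k0 F0 ks FG.
have mkF : measurable2 (fun y z => k y z * F y z) by apply: measurable_funM.
have kF0 : nonneg_on2 (fun y z => k y z * F y z).
  by move=> y z y0 z0; rewrite mulr_ge0 ?k0 ?F0.
transitivity (moment2 v (fun y z => k y z * F y z + k y z * F y z)).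
  by apply: eq_moment2 => y z _ _; lra.
rewrite moment2D// [X in (_ + X)%E]moment2_swap// -moment2D//.
- by apply: eq_moment2 => y z y0 z0; rewrite -FG// (ks z y)// mulrDr.
- exact: (measurable2_swap mkF).
- by move=> y z y0 z0; exact: kF0.
Qed.

Lemma measurable_flux k : measurable2 k -> nonneg_on2 k ->
  measurable_fun setT (flux k v).
Proof.
move=> mk k0.
have mk' : measurable_fun [set: R * R * R] (fun p => k p.1.2 p.2).
  by apply: measurable_fun2 => //; meas.
pose G (p : R * R * R) :=
  if (p.1.2 < p.1.1) && (p.1.1 < p.1.2 + p.2) then
    k p.1.2 p.2 * (p.1.2 * v p.1.2 * v p.2) else 0.
have mG : measurable_fun setT (EFin \o G).
  apply/measurable_EFinP; apply: measurable_fun_ifT; last by meas.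
    by apply: measurable_and; meas.
  by apply: measurable_funM => //; meas.
have G0 p : (0 <= (EFin \o G) p)%E by rewrite lee_fin flux_integrand_ge0.
have mH := @measurable_fun_fubini_tonelli_F _ _ _ _ _ mu _ mG G0.
apply: (@measurable_fun_fubini_tonelli_F _ _ _ _ _ mu _ mH).
by move=> p; apply: integral_ge0.
Qed.

End single.
End moments.

(** * Calculus on intervals *)

Section calculus.
Context {R : realType}.
Notation mu := (@lebesgue_measure R).
Implicit Types (f F df : R -> R).

Lemma is_derive_continuous f (x d : R) : is_derive x 1 f d ->
  {for x, continuous f}.
Proof.
by move=> [h _]; apply: differentiable_continuous; exact/derivable1_diffP.
Qed.

Lemma is_derive1V f (x d : R) : is_derive x 1 f d -> f x != 0 ->
  is_derive x 1 (fun y => (f y)^-1) (- d / (f x) ^+ 2).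
Proof.
move=> h fx0; have [h1 h2] := h.
apply: DeriveDef; first exact: derivableV.
by rewrite deriveV// h2 /GRing.scale/= -exprVn mulrC mulrN mulNr mulrC.
Qed.

Lemma derive_ge0_le f df (a b : R) : a <= b ->
  (forall x, a <= x <= b -> is_derive x 1 f (df x)) ->
  (forall x, a <= x <= b -> 0 <= df x) -> f a <= f b.
Proof.
move=> ab fd df0.
have [||c] := @MVT_segment R f df a b ab.
- by move=> x /[!in_itv]/= /andP[/ltW ax /ltW xb]; apply: fd; rewrite ax.
- apply: continuous_in_subspaceT => x; rewrite inE/= in_itv/= => /fd.
  exact: is_derive_continuous.
- rewrite in_itv/= => cab e; rewrite -subr_ge0 e mulr_ge0 ?df0// subr_ge0//.
Qed.

Lemma integral_itvoo_primitive f F (a b : R) : a < b ->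
  (forall x, a <= x <= b -> is_derive x 1 F (f x)) ->
  (forall x, a <= x <= b -> {for x, continuous f}) ->
  (\int[mu]_(x in `]a, b[) (f x)%:E = (F b - F a)%:E)%E.
Proof.
move=> ab Fd cf.
have cf' : {within `[a, b], continuous f}.
  by apply: continuous_in_subspaceT => x; rewrite inE/= in_itv/= => /cf.
have cF x : a <= x <= b -> {for x, continuous F}.
  by move=> /Fd; exact: is_derive_continuous.
rewrite -(@integral_itv_bndoo _ _ _ _ true false).
  rewrite (@continuous_FTC2 _ _ F)//.
  - split.
    + by move=> x /[!in_itv]/= /andP[/ltW ax /ltW xb]; have [|//] := Fd x; rewrite ax.
    + by apply: cvg_at_right_filter; apply: cF; rewrite lexx ltW.
    + by apply: cvg_at_left_filter; apply: cF; rewrite lexx ltW.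
  - move=> x /[!in_itv]/= /andP[/ltW ax /ltW xb].
    by rewrite derive1E; have [|_ //] := Fd x; rewrite ax.
apply/measurable_EFinP.
apply: (@measurable_funS _ _ _ _ `[a, b]) => //.
  by apply: subset_itv; rewrite bnd_simp.
exact: subspace_continuous_measurable_fun.
Qed.

End calculus.

(** * Densities solving the equation up to a singular error *)

Section riccati.
Context {R : realType}.
Notation mu := (@lebesgue_measure R).

Lemma ae_imply (P Q : R -> Prop) : {ae mu, forall x, P x} ->
  (forall x, P x -> Q x) -> {ae mu, forall x, Q x}.
Proof.
move=> h PQ; apply: filterS h; first exact: (ae_filter_ringOfSetsType mu).
exact: PQ.
Qed.

Definition sing_kernel (alpha y z : R) : R :=
  (y / z) `^ alpha + (z / y) `^ alpha.

(** The two one-sided consequences of the equation for a kernel between [2] and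
[2 + eps * sing_kernel alpha]. All estimates are drawn from them, and [e^{-x}]
satisfies them with [eps = 0]. *)
Record near_profile (alpha eps : R) (v : R -> R) : Prop := NearProfile {
  np_density : nonneg_density v;
  np_mass : (moment v id = 1)%E;
  np_lower : {ae mu, forall x,
    (flux (fun _ _ => 2%R) v x <= (x ^+ 2 * v x)%:E)%E};
  np_upper : {ae mu, forall x,
    ((x ^+ 2 * v x)%:E <=
      flux (fun y z => (2 + eps * sing_kernel alpha y z)%R) v x)%E} }.

Section profile.
Variables (alpha eps : R) (v : R -> R).
Hypothesis alpha01 : 0 < alpha < 1.
Hypothesis eps0 : 0 <= eps.
Hypothesis np : near_profile alpha eps v.
Let vd := np_density np.

Lemma sing_kernel_ge0 (y z : R) : 0 <= sing_kernel alpha y z.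
Proof. by rewrite addr_ge0// powR_ge0. Qed.

Lemma measurable_sing_kernel : measurable2 (sing_kernel alpha).
Proof. by rewrite /measurable2 /sing_kernel; meas. Qed.

Lemma powR_div (y z : R) : 0 < y -> 0 < z -> (y / z) `^ alpha = y `^ alpha * z `^ (- alpha).
Proof.
move=> y0 z0; rewrite powRM ?invr_ge0 ?ltW//.
by rewrite -[z^-1]powR_inv1 ?ltW// -powRrM mulN1r.
Qed.

Lemma np_test_lower (psi : R -> R) (Psi : R -> R -> R) :
  measurable_fun setT psi -> (forall x, 0 <= psi x) ->
  (forall y z, 0 < y -> 0 < z ->
    (\int[mu]_(x in `]y, (y + z)%R[) (psi x)%:E = (Psi y z)%:E)%E) ->
  (moment2 v (fun y z => 2 * Psi y z * y)%R <= moment v (fun x => psi x * x ^+ 2)%R)%E.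
Proof.
move=> mpsi psi0 HPsi; have [mv v0 _] := vd.
have mk : measurable2 (fun _ _ : R => 2 : R) by exact: measurable_cst.
have k0 : nonneg_on2 (fun _ _ : R => 2 : R) by [].
have mf := measurable_flux vd mk k0.
have f0 x : (0 <= flux (fun _ _ => 2%R) v x)%E.
  apply: integral_ge0 => y _; apply: integral_ge0 => z _.
  by rewrite lee_fin; exact: (flux_integrand_ge0 _ _ _ vd k0).
rewrite /moment2 -(integral_flux vd mk k0 mpsi psi0 HPsi).
apply: ae_ge0_le_integral => //.
- by move=> x _; rewrite mule_ge0// lee_fin.
- by apply: emeasurable_funM => //; exact/measurable_EFinP.
- by move=> x _; rewrite lee_fin mulr_ge0// mulr_ge0// sqr_ge0.
- by meas.
- apply: (ae_imply (np_lower np)) => x h _.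
  by rewrite -mulrA EFinM lee_wpmul2l// lee_fin.
Qed.

Lemma np_test_upper (psi : R -> R) (Psi : R -> R -> R) :
  measurable_fun setT psi -> (forall x, 0 <= psi x) ->
  (forall y z, 0 < y -> 0 < z ->
    (\int[mu]_(x in `]y, (y + z)%R[) (psi x)%:E = (Psi y z)%:E)%E) ->
  (moment v (fun x => psi x * x ^+ 2)%R <=
   moment2 v (fun y z => (2 + eps * sing_kernel alpha y z) * Psi y z * y)%R)%E.
Proof.
move=> mpsi psi0 HPsi; have [mv v0 _] := vd.
have mk : measurable2 (fun y z : R => 2 + eps * sing_kernel alpha y z).
  by rewrite /measurable2 /sing_kernel; meas.
have k0 : nonneg_on2 (fun y z : R => 2 + eps * sing_kernel alpha y z).
  by move=> y z _ _; rewrite addr_ge0// mulr_ge0// sing_kernel_ge0.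
have mf := measurable_flux vd mk k0.
have f0 x : (0 <= flux (fun y z => 2 + eps * sing_kernel alpha y z)%R v x)%E.
  apply: integral_ge0 => y _; apply: integral_ge0 => z _.
  by rewrite lee_fin; exact: (flux_integrand_ge0 _ _ _ vd k0).
rewrite /moment2 -(integral_flux vd mk k0 mpsi psi0 HPsi).
apply: ae_ge0_le_integral => //.
- by move=> x _; rewrite lee_fin mulr_ge0// mulr_ge0// sqr_ge0.
- by meas.
- by move=> x _; rewrite mule_ge0// lee_fin.
- by apply: emeasurable_funM => //; exact/measurable_EFinP.
- apply: (ae_imply (np_upper np)) => x h _.
  by rewrite -mulrA EFinM lee_wpmul2l// lee_fin.
Qed.

(** Its moment, the desingularised Laplace transform, is finite as soon as the
mass is, because [gexp p x <= p * x]. *)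
Definition gexp (p x : R) := 1 - expR (- (p * x)).

Lemma gexp_ge0 (p x : R) : 0 <= p -> 0 <= x -> 0 <= gexp p x.
Proof. by move=> p0 x0; rewrite subr_ge0 expR_le1 oppr_le0 mulr_ge0. Qed.

(** This identity is the reason why the coagulation equation becomes a Riccati
equation for the transform. *)
Lemma gexp_add (p y z : R) : gexp p y + gexp p z - gexp p (y + z) = gexp p y * gexp p z.
Proof.
rewrite /gexp (_ : - (p * (y + z)) = - (p * y) + - (p * z)); last by lra.
by rewrite expRD; lra.
Qed.

(** The function [gexp p x - p * (d/dp) (gexp p x)]; its moment is [U - p U'].
Divided by [x ^+ 2] it is also the [x]-derivative of [- gexp p x / x], which
makes it a test function with explicit integrals. *)
Definition ric (p x : R) : R := gexp p x - p * x * expR (- (p * x)).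

Lemma ric_ge0 (p x : R) : 0 <= ric p x.
Proof.
have := expR_ge1Dx (p * x); have := expR_gt0 (- (p * x)).
have : expR (p * x) * expR (- (p * x)) = 1 by rewrite -expRD subrr expR0.
rewrite /ric/gexp; set e := expR _; set f := expR _ => h f0 h1.
have : 0 <= (e - (1 + p * x)) * f by rewrite mulr_ge0 ?subr_ge0// ltW.
by rewrite mulrBl h; lra.
Qed.

Lemma is_derive_gexp_div (p x : R) : x != 0 ->
  is_derive x 1 (fun x => - (gexp p x / x)) (ric p x / x ^+ 2).
Proof.
move=> x0.
have h := @is_derive1V R id x 1 _ x0.
apply: is_derive_eq; rewrite /ric /gexp /GRing.scale/= -exprVn.
have xi : x * x^-1 = 1 by rewrite divff.
have -> : (1 - expR (- (p * x)) - p * x * expR (- (p * x))) * x^-1 ^+ 2 =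
  (1 - expR (- (p * x))) * x^-1 ^+ 2 - p * expR (- (p * x)) * (x * x^-1) * x^-1
  by lra.
by rewrite xi; lra.
Qed.

Lemma integral_ric (p y z : R) : 0 < y -> 0 < z ->
  (\int[mu]_(x in `]y, (y + z)%R[) (ric p x / x ^+ 2)%:E =
   (gexp p y / y - gexp p (y + z) / (y + z))%:E)%E.
Proof.
move=> y0 z0.
transitivity (- (gexp p (y + z) / (y + z)) - - (gexp p y / y))%:E.
  apply: (@integral_itvoo_primitive _ (fun x => ric p x / x ^+ 2)
    (fun x => - (gexp p x / x))).
  - by rewrite ltrDl.
  - move=> x /andP[yx _]; apply: is_derive_gexp_div.
    by rewrite gt_eqF// (lt_le_trans y0).
  - move=> x /andP[yx _].
    have x0 : x != 0 by rewrite gt_eqF// (lt_le_trans y0).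
    have h := @is_derive1V R (fun x => x ^+ 2) x _ _ (expf_neq0 2 x0).
    exact: is_derive_continuous.
by rewrite opprK addrC.
Qed.

End profile.
End riccati.

(** * Riccati inequalities for the desingularised Laplace transform *)

Section riccati.
Context {R : realType}.
Notation mu := (@lebesgue_measure R).
Variables (alpha eps : R) (v : R -> R).
Hypothesis alpha01 : 0 < alpha < 1.
Hypothesis eps0 : 0 <= eps.
Hypothesis np : near_profile alpha eps v.
Let vd := np_density np.

Lemma measurable_gexp (p : R) : measurable_fun setT (gexp p).
Proof. by rewrite /gexp; meas. Qed.

Lemma gexp_positive (p : R) : 0 <= p -> nonneg_on (gexp p).
Proof. by move=> p0 x x0; rewrite gexp_ge0// ltW. Qed.

Let Psi p (y z : R) : R := gexp p y / y - gexp p (y + z) / (y + z).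

Let Psi_ge0 p (y z : R) : 0 < y -> 0 < z -> 0 <= Psi p y z.
Proof.
move=> y0 z0; rewrite -lee_fin -integral_ric//; apply: integral_ge0 => x _.
by rewrite lee_fin divr_ge0 ?ric_ge0 ?sqr_ge0.
Qed.

Let PsiS p (y z : R) : 0 < y -> 0 < z ->
  Psi p y z * y + Psi p z y * z = gexp p y * gexp p z.
Proof.
move=> y0 z0; rewrite -gexp_add /Psi [z + y]addrC.
have yz0 : y + z != 0 by rewrite gt_eqF// addr_gt0.
move: (gexp p y) (gexp p z) (gexp p (y + z)) => a b c.
rewrite !mulrBl !divfK ?gt_eqF//.
have e : c = c / (y + z) * (y + z) by rewrite divfK.
by rewrite [X in _ = _ - X]e; lra.
Qed.

Let mPsi p : measurable2 (fun y z => Psi p y z * y).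
Proof. by rewrite /measurable2 /Psi /gexp; meas. Qed.

Let Psi0 p : nonneg_on2 (fun y z => Psi p y z * y).
Proof. by move=> y z y0 z0; rewrite mulr_ge0 ?Psi_ge0// ltW. Qed.

Let mric p : measurable_fun setT (fun x : R => ric p x / x ^+ 2).
Proof. by rewrite /ric /gexp; meas. Qed.

Let ricE p : moment v (ric p) = moment v (fun x => ric p x / x ^+ 2 * x ^+ 2).
Proof.
by apply: (eq_moment vd) => x x0; rewrite divfK// expf_neq0// gt_eqF.
Qed.

(** Symmetrising [2 * y * (gexp p y / y - gexp p (y + z) / (y + z))] gives
[gexp p y + gexp p z - gexp p (y + z)], that is [gexp p y * gexp p z]. *)
Lemma riccati_lower p : 0 < p ->
  (moment v (gexp p) * moment v (gexp p) <= moment v (ric p))%E.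
Proof.
move=> p0; rewrite ricE.
apply: le_trans (np_test_lower np (mric p) _ (@integral_ric R p)); last first.
  by move=> x; rewrite divr_ge0 ?ric_ge0 ?sqr_ge0.
have mg := measurable_gexp p; have g0 := gexp_positive (ltW p0).
rewrite -(moment2_prod vd mg mg g0 g0).
have m1 : measurable2 (fun _ _ : R => 1 : R) by exact: measurable_cst.
have p1 : nonneg_on2 (fun _ _ : R => 1 : R) by move=> ? ? _ _; exact: ler01.
have h := moment2_symmetrize vd m1 (mPsi p) p1 (Psi0 p) (fun _ _ _ _ => erefl)
  (@PsiS p).
have -> : moment2 v (fun y z => gexp p y * gexp p z) =
    moment2 v (fun y z => 1 * (gexp p y * gexp p z)).
  by apply: (eq_moment2 vd) => y z _ _; rewrite mul1r.
have -> : moment2 v (fun y z => 2 * (gexp p y / y - gexp p (y + z) / (y + z)) * y)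
    = moment2 v (fun y z => 2 * 1 * (Psi p y z * y)).
  by apply: (eq_moment2 vd) => y z _ _; rewrite mulr1 mulrA.
by rewrite h lexx.
Qed.

(** The symmetrisation of [riccati_lower] is applied with the symmetric factor
[1 + eps / 2 * sing_kernel alpha y z]; the singular part splits into products
of moments. *)
Lemma riccati_upper p : 0 < p ->
  (moment v (ric p) <= moment v (gexp p) * moment v (gexp p) + eps%:E *
     (moment v (fun y => y `^ alpha * gexp p y)%R *
      moment v (fun y => y `^ (- alpha) * gexp p y)%R))%E.
Proof.
move=> p0; rewrite ricE.
apply: le_trans (np_test_upper eps0 np (mric p) _ (@integral_ric R p)) _.
  by move=> x; rewrite divr_ge0 ?ric_ge0 ?sqr_ge0.
have mg := measurable_gexp p; have g0 := gexp_positive (ltW p0).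
pose gp y := y `^ alpha * gexp p y; pose gm y := y `^ (- alpha) * gexp p y.
have mgp : measurable_fun setT gp by rewrite /gp; meas.
have mgm : measurable_fun setT gm by rewrite /gm; meas.
have gp0 : nonneg_on gp by move=> y y0; rewrite mulr_ge0 ?powR_ge0 ?g0.
have gm0 : nonneg_on gm by move=> y y0; rewrite mulr_ge0 ?powR_ge0 ?g0.
pose k (y z : R) := 1 + eps / 2 * sing_kernel alpha y z.
have mk : measurable2 k by rewrite /measurable2 /k /sing_kernel; meas.
have k0 : nonneg_on2 k.
  by move=> y z _ _; rewrite addr_ge0// mulr_ge0 ?sing_kernel_ge0// divr_ge0.
have ks (y z : R) : 0 < y -> 0 < z -> k y z = k z y.
  by move=> _ _; rewrite /k /sing_kernel [X in _ * X]addrC.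
have h := @moment2_symmetrize R v vd k _ _ mk (mPsi p) k0 (Psi0 p) ks (PsiS p).
rewrite (_ : moment2 v _ = moment2 v (fun y z => 2 * k y z * (Psi p y z * y))); last first.
  by apply: (eq_moment2 vd) => y z _ _; rewrite /k /Psi; lra.
rewrite h.
pose h2 (y z : R) := eps / 2 * gp y * gm z.
have mh : measurable2 h2 by rewrite /measurable2 /h2 /gp /gm /gexp; meas.
have h20 : nonneg_on2 h2.
  move=> y z y0 z0; apply: mulr_ge0 (gm0 _ z0).
  by apply: mulr_ge0 (gp0 _ y0); exact: divr_ge0.
have mgg : measurable2 (fun y z => gexp p y * gexp p z).
  by rewrite /measurable2 /gexp; meas.
have gg0 : nonneg_on2 (fun y z => gexp p y * gexp p z).
  by move=> y z y0 z0; exact: mulr_ge0 (g0 _ y0) (g0 _ z0).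
have -> : moment2 v (fun y z => k y z * (gexp p y * gexp p z)) =
  moment2 v (fun y z => gexp p y * gexp p z + (h2 y z + h2 z y)).
  apply: (eq_moment2 vd) => y z y0 z0; rewrite /k /sing_kernel !powR_div//.
  by rewrite /h2 /gp /gm; lra.
have mh' := measurable2_swap mh.
have h20' : nonneg_on2 (fun y z => h2 z y) by move=> y z y0 z0; exact: h20.
have mhh : measurable2 (fun y z => h2 y z + h2 z y) by exact: measurable_funD.
have hh0 : nonneg_on2 (fun y z => h2 y z + h2 z y).
  by move=> y z y0 z0; exact: addr_ge0 (h20 _ _ y0 z0) (h20 _ _ z0 y0).
rewrite (moment2D vd mgg mhh gg0 hh0) (moment2D vd mh mh' h20 h20').
rewrite -(moment2_swap vd mh h20) (moment2_prod vd mg mg g0 g0).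
have me : measurable_fun setT (fun y => eps / 2 * gp y) by meas.
have c0 : 0 <= eps / 2 by rewrite divr_ge0.
have e0 : nonneg_on (fun y => eps / 2 * gp y).
  by move=> y y0; exact: mulr_ge0 c0 (gp0 _ y0).
rewrite (moment2_prod vd me mgm e0 gm0) (momentZ vd mgp c0 gp0).
have c0' : (0 <= (eps / 2)%:E)%E by rewrite lee_fin.
by rewrite -muleA -(ge0_muleDl _ c0' c0') -EFinD -splitr.
Qed.

End riccati.

(** * Comparison for the Riccati equation *)

Section ode.
Context {R : realType}.
Variables (U Q : R -> R).
Hypothesis UQ : forall p : R, 0 < p -> is_derive p 1 U (Q p).
Hypothesis U0 : forall p : R, 0 < p -> 0 < U p <= p.
Hypothesis Ulow : forall p : R, 0 < p -> U p ^+ 2 <= U p - p * Q p.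

(** The inequality [U ^+ 2 <= U - p * Q] says that [q / U q - q] is nondecreasing.
Its limit at 0 is at least 1 because [U q <= q], so [q / U q - q >= 1]. *)
Lemma riccati_le p : 0 < p -> U p <= p / (1 + p).
Proof.
move=> p0.
pose h (q : R) := q * (U q)^-1 - q.
have hd (q : R) : 0 < q -> is_derive q 1 h ((U q - q * Q q) / (U q) ^+ 2 - 1).
  move=> q0; have /andP[Uq0 _] := U0 q0; have uq := UQ q0.
  have Uq : U q != 0 by rewrite gt_eqF.
  have h1 := @is_derive1V R U q _ uq Uq.
  apply: is_derive_eq; rewrite /GRing.scale/= -exprVn.
  have xi : U q * (U q)^-1 = 1 by rewrite divff.
  have -> : (U q - q * Q q) * (U q)^-1 ^+ 2 =
    U q * (U q)^-1 * (U q)^-1 - q * Q q * (U q)^-1 ^+ 2 by lra.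
  by rewrite xi; lra.
have hh (q : R) : 0 < q -> q <= p -> 1 - q <= h p.
  move=> q0 qp; apply: le_trans (_ : h q <= _).
    have /andP[Uq0 Uq1] := U0 q0.
    by rewrite /h lerD2r ler_pdivlMr// mul1r.
  apply: (@derive_ge0_le R h (fun q => (U q - q * Q q) / (U q) ^+ 2 - 1)) => //.
    by move=> x /andP[qx _]; apply: hd; exact: lt_le_trans qx.
  move=> x /andP[qx _]; have x0 := lt_le_trans q0 qx.
  have /andP[Ux0 _] := U0 x0.
  by rewrite subr_ge0 ler_pdivlMr ?exprn_gt0// mul1r Ulow.
have /andP[Up0 Up1] := U0 p0.
have hp : 1 <= h p.
  rewrite leNgt; apply/negP => hp1.
  (* If h p < 1, the bound 1 - q <= h p fails for q = (1 - h p) / 2. *)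
  pose q := Num.min p ((1 - h p) / 2).
  have q0 : 0 < q by rewrite lt_min p0 divr_gt0// subr_gt0.
  have := hh q q0; rewrite ge_min lexx => /(_ isT).
  have : q <= (1 - h p) / 2 by rewrite ge_min lexx orbT.
  by lra.
have pp : 0 < 1 + p by lra.
rewrite ler_pdivlMr//.
have : (1 + p) * U p <= p / U p * U p by rewrite ler_pM2r//; rewrite /h in hp; lra.
by rewrite divfK ?gt_eqF// mulrC.
Qed.

Variables (alpha c : R).
Hypothesis alpha1 : alpha < 1.
Hypothesis c0 : 0 <= c.
Hypothesis Uup : forall p : R, 0 < p ->
  U p - p * Q p <= U p ^+ 2 + c * p `^ (2 - alpha).
Hypothesis Uslope : forall zeta p : R, 0 < zeta -> 0 < p ->
  exists q, 0 < q <= p /\ 1 - zeta <= U q / q.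

(** With [U <= q / (1 + q)] at hand, the reverse inequality makes
[U q / q - 1 / (1 + q) + c / (1 - alpha) * q `^ (1 - alpha)] nondecreasing. As
[U q / q] is close to 1 for some arbitrarily small [q], it is nonnegative. *)
Lemma riccati_ge p : 0 < p ->
  p / (1 + p) - c / (1 - alpha) * p `^ (2 - alpha) <= U p.
Proof.
move=> p0; have a1 : 0 < 1 - alpha by rewrite subr_gt0.
pose f (q : R) := U q * q^-1 - (1 + q)^-1 + c / (1 - alpha) * q `^ (1 - alpha).
pose df (q : R) := Q q / q - U q / q ^+ 2 + ((1 + q)^-1) ^+ 2 + c * q `^ (- alpha).
have fd (q : R) : 0 < q -> is_derive q 1 f (df q).
  move=> q0; have uq := UQ q0.
  have qn : q != 0 by rewrite gt_eqF.
  have q1n : 1 + q != 0 by rewrite gt_eqF// addr_gt0.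
  have h1 := @is_derive1V R id q _ _ qn.
  have h2 := @is_derive1V R (fun q => 1 + q) q _ _ q1n.
  have h3 := @is_derive1_powR R (1 - alpha) q q0.
  apply: is_derive_eq; rewrite /df /GRing.scale/= -!exprVn.
  have -> : 1 - alpha - 1 = - alpha by lra.
  have xi : (1 - alpha)^-1 * (1 - alpha) = 1 by rewrite mulVf// gt_eqF.
  set t := q `^ (- alpha).
  have -> : c / (1 - alpha) * ((1 - alpha) * t) = c * t by rewrite -mulrA (mulrA _ _ t) xi mul1r.
  by lra.
have df0 (q : R) : 0 < q -> 0 <= df q.
  move=> q0; have hU := Uup q0; have := riccati_le q0; have /andP[Uq0 _] := U0 q0.
  move=> Uq.
  have qn : q != 0 by rewrite gt_eqF.
  have -> : df q = ((1 + q)^-1) ^+ 2 + c * q `^ (- alpha) - (U q - q * Q q) / q ^+ 2.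
    rewrite /df mulrBl -exprVn.
    have -> : q * Q q * q^-1 ^+ 2 = Q q * (q / q) / q by lra.
    by rewrite divff// mulr1; lra.
  have e : q `^ (2 - alpha) = q ^+ 2 * q `^ (- alpha).
    by rewrite powRD; [rewrite powR_mulrn// ltW|rewrite qn implybT].
  have h : (U q - q * Q q) / q ^+ 2 <= (U q ^+ 2 + c * q `^ (2 - alpha)) / q ^+ 2.
    by rewrite ler_pM2r// invr_gt0 exprn_gt0.
  have h2 : (U q ^+ 2 + c * q `^ (2 - alpha)) / q ^+ 2 = (U q / q) ^+ 2 + c * q `^ (- alpha).
    rewrite e mulrDl expr_div_n; congr (_ + _).
    by rewrite [q ^+ 2 * _]mulrC mulrA mulfK// expf_neq0.
  have h3 : (U q / q) ^+ 2 <= (1 + q)^-1 ^+ 2.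
    rewrite lerXn2r// ?nnegrE ?divr_ge0 ?invr_ge0//; try lra.
    by rewrite ler_pdivrMr// mulrC.
  by lra.
have fp0 : 0 <= f p.
  rewrite leNgt; apply/negP => fp.
  have z0 : 0 < - f p / 2 by lra.
  have [q [/andP[q0 qp] hq]] := Uslope z0 p0.
  have : f q <= f p.
    apply: (@derive_ge0_le R f df) => //.
      by move=> x /andP[qx _]; apply: fd; exact: lt_le_trans qx.
    by move=> x /andP[qx _]; apply: df0; exact: lt_le_trans qx.
  have : (1 + q)^-1 <= 1 by rewrite invf_le1; lra.
  have : 0 <= c / (1 - alpha) * q `^ (1 - alpha).
    by rewrite mulr_ge0 ?powR_ge0// divr_ge0// ltW.
  have : f q = U q / q - (1 + q)^-1 + c / (1 - alpha) * q `^ (1 - alpha) by [].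
  move: hq fp; move: (f p) (f q) => a b; lra.
have pn : p != 0 by rewrite gt_eqF.
have e : p `^ (2 - alpha) = p * p `^ (1 - alpha).
  rewrite (_ : 2 - alpha = 1 + (1 - alpha)); last by lra.
  by rewrite powRD; [rewrite powRr1// ltW|rewrite pn implybT].
have : 0 <= p * f p by rewrite mulr_ge0// ltW.
rewrite /f e mulrDr mulrBr mulrCA divff// mulr1.
by lra.
Qed.

End ode.

(** * Derivative and slope at 0 of the transform *)

Section laplace.
Context {R : realType}.
Notation mu := (@lebesgue_measure R).

(** Only meaningful when the moment is finite, which the lemmas below establish
together with the bounds. *)
Definition rmoment (v phi : R -> R) : R := fine (moment v phi).

Section density.
Variable v : R -> R.
Hypothesis vd : nonneg_density v.

Lemma rmoment_le (phi psi : R -> R) (C : R) : measurable_fun setT phi ->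
  measurable_fun setT psi -> nonneg_on phi ->
  (forall x, 0 < x -> phi x <= psi x) -> (moment v psi <= C%:E)%E ->
  moment v phi = (rmoment v phi)%:E /\ 0 <= rmoment v phi <= C.
Proof.
move=> m1 m2 p1 h hC.
have h1 : (moment v phi <= C%:E)%E by exact: le_trans (le_moment vd m1 m2 p1 h) hC.
have h0 := moment_ge0 vd p1.
have e : moment v phi = (rmoment v phi)%:E.
  rewrite /rmoment fineK// ge0_fin_numE//; exact: le_lt_trans h1 (ltry _).
by split => //; rewrite -!lee_fin -e h0 h1.
Qed.

Hypothesis mass : (moment v id = 1)%E.

Lemma rmoment_le_mass (phi : R -> R) (C : R) : measurable_fun setT phi ->
  nonneg_on phi -> 0 <= C -> (forall x, 0 < x -> phi x <= C * x) ->
  moment v phi = (rmoment v phi)%:E /\ 0 <= rmoment v phi <= C.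
Proof.
move=> m1 p1 C0 h; apply: (rmoment_le m1 (psi := fun x => C * x)) => //; first by meas.
have id0 : nonneg_on (id : R -> R) by move=> x /ltW.
have := momentZ vd (measurable_id (D := setT)) C0 id0.
by rewrite mass mule1 /= => ->.
Qed.

Lemma gexp_le (p x : R) : gexp p x <= p * x.
Proof. by have := expR_ge1Dx (- (p * x)); rewrite /gexp; lra. Qed.

Lemma rmoment_gexp (p : R) : 0 <= p ->
  moment v (gexp p) = (rmoment v (gexp p))%:E /\ 0 <= rmoment v (gexp p) <= p.
Proof.
move=> p0; apply: rmoment_le_mass => //; first exact: measurable_gexp.
  exact: gexp_positive.
by move=> x _; exact: gexp_le.
Qed.

Lemma rmoment_xexp (p : R) : 0 <= p ->
  moment v (fun x => x * expR (- (p * x))) =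
    (rmoment v (fun x => x * expR (- (p * x))))%:E /\
  0 <= rmoment v (fun x => x * expR (- (p * x))) <= 1.
Proof.
move=> p0; apply: rmoment_le_mass => //; first by meas.
  by move=> x x0; rewrite mulr_ge0 ?expR_ge0// ltW.
move=> x x0; rewrite mul1r; apply: ler_piMr; first exact: ltW.
by rewrite expR_le1 oppr_le0 mulr_ge0// ltW.
Qed.

Lemma rmoment_ric (p : R) : 0 <= p ->
  moment v (ric p) = (rmoment v (ric p))%:E /\
  rmoment v (ric p) = rmoment v (gexp p) - p * rmoment v (fun x => x * expR (- (p * x))).
Proof.
move=> p0; have [e1 _] := rmoment_gexp p0; have [e2 _] := rmoment_xexp p0.
have m1 : measurable_fun setT (ric p) by rewrite /ric /gexp; meas.
have p1 : nonneg_on (ric p) by move=> x _; exact: ric_ge0.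
have [e3 _] : moment v (ric p) = (rmoment v (ric p))%:E /\ 0 <= rmoment v (ric p) <= p.
  apply: rmoment_le_mass => // x x0; apply: le_trans (gexp_le p x).
  by rewrite /ric lerBlDr lerDl !mulr_ge0 ?expR_ge0// ltW.
split => //.
have m2 : measurable_fun setT (fun x : R => x * expR (- (p * x))) by meas.
have m3 : measurable_fun setT (fun x : R => p * (x * expR (- (p * x)))) by meas.
have p2 : nonneg_on (fun x : R => x * expR (- (p * x))).
  by move=> x x0; exact: mulr_ge0 (ltW x0) (expR_ge0 _).
have p3 : nonneg_on (fun x : R => p * (x * expR (- (p * x)))).
  by move=> x x0; exact: mulr_ge0 p0 (p2 _ x0).
have : moment v (gexp p) = moment v (fun x => ric p x + p * (x * expR (- (p * x)))).
  by apply: (eq_moment vd) => x _; rewrite /ric; lra.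
rewrite (momentD vd m1 m3 p1 p3) (momentZ vd m2 p0 p2) e1 e2 e3 => -[->].
by rewrite addrK.
Qed.

(** Differentiation under the integral: the [p]-derivative of [gexp p x] is
dominated by [x], which is integrable against [v]. *)
Lemma is_derive_rmoment_gexp (p : R) : 0 < p ->
  is_derive p 1 (fun p => rmoment v (gexp p)) (rmoment v (fun x => x * expR (- (p * x)))).
Proof.
move=> p0; have [mv v0 vn] := vd.
pose f (p x : R) := gexp p x * v x.
have fd (q x : R) : is_derive q 1 (f ^~ x) (x * expR (- (q * x)) * v x).
  by apply: is_derive_eq; rewrite /GRing.scale/=; lra.
have int0 : mu.-integrable setT (EFin \o (fun x => x * v x)).
  apply/integrableP; split; first by apply/measurable_EFinP; meas.
  suff -> : (\int[mu]_x `|(EFin \o (fun x => (x * v x)%R)) x| = moment v id)%E.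
    by rewrite mass ltry.
  rewrite /moment; apply: eq_integral => x _; rewrite /= ger0_norm//.
  by apply: (density_ge0 (g := id) vd) => y /ltW.
have intf (q : R) : `]0, (2 * p)[%classic q -> mu.-integrable setT (EFin \o f q).
  rewrite /= in_itv/= => /andP[q0 _].
  have [e _] := rmoment_gexp (ltW q0).
  apply/integrableP; split; first by apply/measurable_EFinP; rewrite /f /gexp; meas.
  suff -> : (\int[mu]_x `|(EFin \o f q) x| = moment v (gexp q))%E.
    by rewrite e ltry.
  rewrite /moment; apply: eq_integral => x _; rewrite /= ger0_norm//.
  by apply: (density_ge0 vd); exact: gexp_positive (ltW q0).
have Ip : `]0, (2 * p)[%classic p by rewrite /= in_itv/= p0 ltr_pMl// ltr1n.
have derf (q x : R) : `]0, (2 * p)[%classic q -> setT x -> derivable (f^~ x) q 1.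
  by move=> _ _; have [] := fd q x.
have G0 (x : R) : 0 <= x * v x.
  by apply: (density_ge0 (g := id) vd) => y /ltW.
have ub (q x : R) : `]0, (2 * p)[%classic q -> setT x ->
    `|partial1of2 f q x| <= x * v x.
  rewrite /= in_itv/= => /andP[q0 _] _.
  have [_] := fd q x; rewrite partial1of2E => ->.
  rewrite mulrAC normrM (ger0_norm (expR_ge0 _)) (ger0_norm (G0 x)).
  have [x0|x0] := leP x 0; first by rewrite vn// !(mulr0, mul0r).
  by rewrite ler_piMr// expR_le1 oppr_le0 mulr_ge0// ltW.
have := @cvg_differentiation_under_integral R _ _ mu f setT measurableT p _ _ Ip intf derf _ G0
  int0 ub.
have -> : (\int[mu]_y partial1of2 f p y)%R = rmoment v (fun x => x * expR (- (p * x))).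
  congr fine; apply: eq_integral => x _; rewrite /= partial1of2E.
  by have [_ ->] := fd p x.
move=> h; have h' : (fun h0 : R => h0^-1 *: ((fun p => rmoment v (gexp p)) (h0 *: 1 +
  p) - rmoment v (gexp p))) @ 0^' --> rmoment v (fun x => x * expR (- (p * x))).
  by under eq_fun do rewrite /GRing.scale/= mulr1; exact: h.
apply: DeriveDef; first by apply/cvg_ex; eexists; exact: h'.
exact: cvg_lim.
Qed.

Lemma moment_truncate (zeta : R) : 0 < zeta ->
  exists n : nat,
    ((1 - zeta)%:E <= moment v (fun x : R => (if x <= n%:R then x else 0)%R))%E.
Proof.
move=> z0; have [mv v0 vn] := vd.
pose g (n : nat) (x : R) : \bar R := ((if x <= n%:R then x else 0) * v x)%:E.
have mg n : measurable_fun setT (g n) by rewrite /g; meas.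
have g0 n x : setT x -> (0 <= g n x)%E.
  move=> _; rewrite lee_fin.
  apply: (density_ge0 (g := fun x : R => if x <= n%:R then x else 0) vd).
  by move=> y y0; case: ifP => // _; exact: ltW.
have ndg (x : R) : setT x -> nondecreasing_seq (g ^~ x).
  move=> _ m n mn; rewrite lee_fin.
  have [x0|x0] := leP x 0; first by rewrite vn// !mulr0.
  rewrite ler_wpM2r//; case: ifP => h; last by case: ifP => // _; exact: ltW.
  by rewrite (le_trans h) ?ler_nat.
have glim (x : R) : limn (g ^~ x) = (x * v x)%:E.
  apply: cvg_lim => //; apply: cvg_near_cst.
  near=> n; rewrite /g; case: ifPn => //; rewrite -ltNge => h.
  exfalso; move: h; apply/negP; rewrite -leNgt; near: n.
  exact: nbhs_infty_ger.
have := @cvg_monotone_convergence _ _ _ mu _ measurableT g mg g0 ndg.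
under [X in _ --> X]eq_integral do rewrite glim.
rewrite -/(moment v id) mass => h.
apply: contrapT => /forallNP hN.
have : (limn (fun n => \int[mu]_x g n x) <= (1 - zeta)%:E)%E.
  apply: lime_le; first by apply/cvg_ex; eexists; exact: h.
  by apply: nearW => n; rewrite leNgt; apply/negP => /ltW; exact: hN.
by rewrite (cvg_lim _ h)// lee_fin; lra.
Unshelve. all: by end_near. Qed.

Lemma gexp_ge (q x : R) : 0 <= q -> 0 <= x -> q * x * (1 - q * x) <= gexp q x.
Proof.
move=> q0 x0; have t0 : 0 <= q * x by rewrite mulr_ge0.
rewrite /gexp; have := expR_ge1Dx (q * x); have := expR_gt0 (- (q * x)).
have : expR (q * x) * expR (- (q * x)) = 1 by rewrite -expRD subrr expR0.
move: (q * x) t0 => t t0; move: (expR t) (expR (- t)) => e f ef f0 he.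
have h1 : (1 + t) * f <= 1 by rewrite -[leRHS]ef ler_pM2r.
have h3 : 0 <= t ^+ 3 by rewrite exprn_ge0.
have t1 : 0 < 1 + t by lra.
suff : (1 + t) * f <= (1 + t) * (1 - t + t ^+ 2) by rewrite ler_pM2l//; lra.
by apply: le_trans h1 _; lra.
Qed.

(** The transform has slope at least the mass at 0: [gexp q x] is about [q * x] for
[q * x] small, and almost all the mass lies in a bounded interval. *)
Lemma rmoment_gexp_slope (zeta p : R) : 0 < zeta -> 0 < p ->
  exists q, 0 < q <= p /\ 1 - zeta <= rmoment v (gexp q) / q.
Proof.
move=> z0 p0.
wlog z1 : zeta z0 / zeta < 1.
  move=> wl; have [z1|z1] := ltP zeta 1; first exact: wl.
  have [|//|q [qp h]] := wl (1/2); [lra|lra|].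
  by exists q; split=> //; apply: le_trans h; lra.
have z20 : 0 < zeta / 2 by lra.
have [n hn] := moment_truncate z20.
(* With this q, q * x <= zeta / 2 whenever x <= n. *)
pose q := Num.min p (zeta / 2 / n.+1%:R).
have q0 : 0 < q by rewrite lt_min p0 divr_gt0// ltr0Sn.
exists q; split; first by rewrite q0 ge_min lexx.
have [e _] := rmoment_gexp (ltW q0).
rewrite ler_pdivlMr// -lee_fin -e.
pose phi (x : R) := if x <= n%:R then x else 0.
have mphi : measurable_fun setT phi by rewrite /phi; meas.
have phi0 : nonneg_on phi by move=> x x0; rewrite /phi; case: ifP => // _; exact: ltW.
pose c := (1 - zeta / 2) * q.
have c0 : 0 <= c by rewrite mulr_ge0// ?ltW//; lra.
apply: (@le_trans _ _ (c%:E * moment v phi)%E).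
  apply: (@le_trans _ _ (c%:E * (1 - zeta / 2)%:E)%E).
    by rewrite -EFinM lee_fin /c; nra.
  by rewrite lee_wpmul2l// lee_fin.
rewrite -(momentZ vd mphi c0 phi0); apply: (le_moment vd).
- by meas.
- exact: measurable_gexp.
- by move=> x x0; exact: mulr_ge0 c0 (phi0 _ x0).
move=> x x0; rewrite /phi; case: ifP => xn; last by rewrite mulr0 (gexp_positive (ltW q0)).
apply: le_trans (gexp_ge (ltW q0) (ltW x0)).
have : q * x <= zeta / 2.
  have qn : q <= zeta / 2 / n.+1%:R by rewrite ge_min lexx orbT.
  apply: (@le_trans _ _ (zeta / 2 / n.+1%:R * n.+1%:R)).
    apply: ler_pM => //; [exact: ltW|exact: ltW|apply: le_trans xn _].
    by rewrite ler_nat.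
  by rewrite divfK.
move=> h; have qx0 : 0 <= q * x by exact: mulr_ge0 (ltW q0) (ltW x0).
have : 0 <= q * x * (zeta / 2 - q * x) by rewrite mulr_ge0// subr_ge0.
by rewrite /c; lra.
Qed.

End density.
End laplace.

(** * Two-sided bounds on the transform *)

Section laplace_bounds.
Context {R : realType}.
Notation mu := (@lebesgue_measure R).
Variables (alpha eps : R) (v : R -> R).
Hypothesis alpha01 : 0 < alpha < 1.
Hypothesis eps0 : 0 <= eps.
Hypothesis np : near_profile alpha eps v.
Let vd := np_density np.
Let mass := np_mass np.
Notation U p := (rmoment v (gexp p)).
Notation Q p := (rmoment v (fun x => x * expR (- (p * x)))).

Lemma np_U_bounds (p : R) : 0 < p -> 0 < U p <= p.
Proof.
move=> p0; have [e /andP[_ up]] := rmoment_gexp vd mass (ltW p0); rewrite up andbT.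
have h2 : 0 < 1 / 2 :> R by lra.
have [q [/andP[q0 qp] hq]] := rmoment_gexp_slope vd mass h2 p0.
have [e' _] := rmoment_gexp vd mass (ltW q0).
have Uq : 0 < U q.
  have : 0 < U q / q by apply: lt_le_trans hq; lra.
  by rewrite pmulr_lgt0// invr_gt0.
apply: lt_le_trans Uq _.
suff : (moment v (gexp q) <= moment v (gexp p))%E by rewrite e e' lee_fin.
apply: (le_moment vd); [exact: measurable_gexp|exact: measurable_gexp| |].
  exact: gexp_positive (ltW q0).
move=> x x0; rewrite lerD2l lerN2 ler_expR lerN2.
by apply: ler_pM => //; exact: ltW.
Qed.

Lemma np_riccati_lower (p : R) : 0 < p -> U p ^+ 2 <= U p - p * Q p.
Proof.
move=> p0; have := riccati_lower np p0.
have [-> _] := rmoment_gexp vd mass (ltW p0).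
by have [-> ->] := rmoment_ric vd mass (ltW p0).
Qed.

Lemma np_U_le (p : R) : 0 < p -> U p <= p / (1 + p).
Proof.
apply: (@riccati_le _ (fun p => U p) (fun p => Q p)).
- by move=> q q0; exact: is_derive_rmoment_gexp.
- exact: np_U_bounds.
- exact: np_riccati_lower.
Qed.

(** Let [p] tend to infinity in [U p <= p / (1 + p)]. *)
Lemma np_M0_le1 : (moment v (fun=> 1%R) <= 1)%E.
Proof.
have [mv v0 vn] := vd.
pose g (n : nat) (x : R) : \bar R := (gexp n%:R x * v x)%:E.
have mg n : measurable_fun setT (g n).
  by apply: measurable_moment => //; exact: measurable_gexp.
have g0 n x : setT x -> (0 <= g n x)%E.
  by move=> _; rewrite lee_fin; apply: (density_ge0 vd); exact: gexp_positive.
have ndg (x : R) : setT x -> nondecreasing_seq (g ^~ x).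
  move=> _ m n mn; rewrite lee_fin.
  have [x0|x0] := leP x 0; first by rewrite vn// !mulr0.
  rewrite ler_wpM2r// lerD2l lerN2 ler_expR lerN2.
  by apply: ler_wpM2r; [exact: ltW|rewrite ler_nat].
have glim (x : R) : limn (g ^~ x) = (1 * v x)%:E.
  have [x0|x0] := leP x 0.
    by apply: cvg_lim => //; apply: cvg_near_cst; apply: nearW => n; rewrite /g vn// !mulr0.
  apply: cvg_lim => //; apply: cvg_EFin; first by apply: nearW.
  apply: cvgMl; rewrite -[X in _ --> X]subr0; apply: cvgB; first exact: cvg_cst.
  under eq_fun do rewrite -mulrN expRM_natl.
  by apply: cvg_expr; rewrite ger0_norm ?expR_ge0// expR_lt1 oppr_lt0.
have := @cvg_monotone_convergence _ _ _ mu _ measurableT g mg g0 ndg.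
under [X in _ --> X]eq_integral do rewrite glim.
rewrite -/(moment v (fun=> 1)) => h.
rewrite -(cvg_lim _ h)//; apply: lime_le; first by apply/cvg_ex; eexists; exact: h.
exists 1%N => // n /= n0.
have n0' : 0 < n%:R :> R by rewrite ltr0n.
rewrite -/(moment v (gexp n%:R)); have [-> _] := rmoment_gexp vd mass (ltW n0').
rewrite lee_fin; apply: le_trans (np_U_le n0') _.
by rewrite ler_pdivrMr; lra.
Qed.

Lemma gexp_le_powR (t b : R) : 0 < t -> 0 <= b <= 1 -> 1 - expR (- t) <= t `^ b.
Proof.
move=> t0 /andP[b0 b1].
have [t1|t1] := leP t 1.
  apply: le_trans (_ : t <= _); first by have := expR_ge1Dx (- t); lra.
  by apply: ger1_powR => //; rewrite t0.
have := expR_gt0 (- t).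
have := @ler_powR _ t (ltW t1) _ _ b0; rewrite powRr0; lra.
Qed.

(** Since [gexp p y <= (p * y) `^ (1 - alpha)], the integrand is bounded by
[p `^ (1 - alpha) * y]. *)
Lemma np_powR_gexp_le (p : R) : 0 < p ->
  (moment v (fun y => y `^ alpha * gexp p y)%R <= (p `^ (1 - alpha))%:E)%E.
Proof.
move=> p0; have /andP[a0 a1] := alpha01.
have m1 : measurable_fun setT (fun y : R => y `^ alpha * gexp p y).
  by rewrite /gexp; meas.
have p1 : nonneg_on (fun y : R => y `^ alpha * gexp p y).
  by move=> y y0; apply: mulr_ge0; [exact: powR_ge0|exact: gexp_positive (ltW p0) _ y0].
have [|->] := rmoment_le_mass vd mass m1 p1 (powR_ge0 p (1 - alpha)); last first.
  by rewrite lee_fin => /andP[].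
move=> y y0; rewrite /gexp.
apply: (@le_trans _ _ (y `^ alpha * (p * y) `^ (1 - alpha))).
  rewrite ler_wpM2l ?powR_ge0//; apply: gexp_le_powR; first exact: mulr_gt0.
  by apply/andP; split; lra.
rewrite (powRM _ (ltW p0) (ltW y0)) mulrCA -powRD; last by rewrite (gt_eqF y0) implybT.
rewrite (_ : alpha + (1 - alpha) = 1); last by lra.
by rewrite (powRr1 (ltW y0)).
Qed.

Lemma powR_le1D (y b : R) : 0 < y -> 0 <= b <= 1 -> y `^ b <= 1 + y.
Proof.
move=> y0 /andP[b0 b1].
have [y1|y1] := leP y 1.
  have : y `^ b <= y `^ 0 by apply: ger_powR => //; rewrite y0.
  by rewrite powRr0; lra.
have := @ler_powR _ y (ltW y1) _ _ b1; rewrite (powRr1 (ltW y0)); lra.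
Qed.

Lemma np_moment_1D : (moment v (fun x => 1 + x)%R <= 2%:E)%E.
Proof.
have m1 : measurable_fun setT (fun _ : R => 1 : R) by exact: measurable_cst.
have p1 : nonneg_on (fun _ : R => 1 : R) by move=> ? _; exact: ler01.
have p2 : nonneg_on (id : R -> R) by move=> ? /ltW.
have := momentD vd m1 (measurable_id (D := setT)) p1 p2.
rewrite mass /= => ->; rewrite (_ : 2%:E = 1 + 1)%E; last by rewrite -EFinD.
by rewrite leeD2r// np_M0_le1.
Qed.

Lemma np_moment_le2 (b : R) : 0 <= b <= 1 ->
  moment v (fun x => x `^ b) = (rmoment v (fun x => x `^ b))%:E /\
  0 <= rmoment v (fun x => x `^ b) <= 2.
Proof.
move=> b01; apply: (rmoment_le vd (psi := fun x => 1 + x)); [by meas|by meas| | |].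
- by move=> x _; exact: powR_ge0.
- by move=> x x0; exact: powR_le1D.
- exact: np_moment_1D.
Qed.

(** Since [gexp p y <= p * y], the integrand is bounded by [p * y `^ (1 - alpha)],
and moments of order between 0 and 1 are at most 2. *)
Lemma np_powRN_gexp_le (p : R) : 0 < p ->
  (moment v (fun y => y `^ (- alpha) * gexp p y)%R <= (2 * p)%:E)%E.
Proof.
move=> p0; have /andP[a0 a1] := alpha01.
have m1 : measurable_fun setT (fun y : R => y `^ (- alpha) * gexp p y).
  by rewrite /gexp; meas.
have p1 : nonneg_on (fun y : R => y `^ (- alpha) * gexp p y).
  by move=> y y0; apply: mulr_ge0; [exact: powR_ge0|exact: gexp_positive (ltW p0) _ y0].
have m2 : measurable_fun setT (fun y : R => y `^ (1 - alpha)) by meas.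
have p2 : nonneg_on (fun y : R => y `^ (1 - alpha)).
  by move=> y y0; exact: powR_ge0.
apply: (@le_trans _ _ (moment v (fun y => p * y `^ (1 - alpha)))).
  apply: (le_moment vd) => //; first by meas.
  move=> y y0; apply: (@le_trans _ _ (y `^ (- alpha) * (p * y))).
    by rewrite ler_wpM2l ?powR_ge0// gexp_le.
  rewrite mulrCA ler_pM2l// mulrC -[X in X * _](powRr1 (ltW y0)).
  by rewrite -powRD// (gt_eqF y0) implybT.
rewrite (momentZ vd m2 (ltW p0) p2).
have [|-> /andP[_ h]] := @np_moment_le2 (1 - alpha); first by apply/andP; split; lra.
by rewrite -EFinM lee_fin mulrC ler_pM2r.
Qed.

Lemma np_riccati_upper (p : R) : 0 < p ->
  U p - p * Q p <= U p ^+ 2 + 2 * eps * p `^ (2 - alpha).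
Proof.
move=> p0; have := riccati_upper eps0 np p0.
have [-> _] := rmoment_gexp vd mass (ltW p0).
have [-> ->] := rmoment_ric vd mass (ltW p0).
move=> h; rewrite -lee_fin; apply: le_trans h _.
rewrite EFinD leeD2l// [2 * eps]mulrC -mulrA EFinM lee_wpmul2l ?lee_fin//.
apply: (@le_trans _ _ ((p `^ (1 - alpha))%:E * (2 * p)%:E)%E).
  apply: lee_pmul; [| |exact: np_powR_gexp_le|exact: np_powRN_gexp_le].
    by apply: (moment_ge0 vd) => y y0; apply: mulr_ge0;
      [exact: powR_ge0|exact: gexp_positive (ltW p0) _ y0].
  by apply: (moment_ge0 vd) => y y0; apply: mulr_ge0;
    [exact: powR_ge0|exact: gexp_positive (ltW p0) _ y0].
rewrite -EFinM lee_fin mulrCA ler_pM2l//.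
rewrite -[X in _ * X](powRr1 (ltW p0)) -powRD; last by rewrite (gt_eqF p0) implybT.
by rewrite (_ : 1 - alpha + 1 = 2 - alpha)//; lra.
Qed.

Lemma np_U_ge (p : R) : 0 < p ->
  p / (1 + p) - 2 * eps / (1 - alpha) * p `^ (2 - alpha) <= U p.
Proof.
have /andP[a0 a1] := alpha01.
apply: (@riccati_ge _ (fun p => U p) (fun p => Q p)) => //.
- by move=> q q0; exact: is_derive_rmoment_gexp.
- exact: np_U_bounds.
- exact: np_riccati_lower.
- exact: mulr_ge0.
- exact: np_riccati_upper.
- exact: rmoment_gexp_slope.
Qed.

End laplace_bounds.

(** * Inverting the transform with Bernstein polynomials *)

Section bernstein_operator.
Context {R : realType}.
Implicit Types (f g : nat -> R) (s c a : R).

(** The expectation of [f] under the binomial law of parameters [n] and [s], that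
is, the Bernstein polynomial of degree [n] with nodes [k] instead of [k / n].
Conditioning on the first trial gives a recursion suited to induction on [n]. *)
Fixpoint bernstein (n : nat) f s : R :=
  if n is m.+1 then s * bernstein m (fun k => f k.+1) s + (1 - s) * bernstein m f s
  else f 0%N.

Lemma le_bernstein n f g s : 0 <= s <= 1 -> (forall k, f k <= g k) ->
  bernstein n f s <= bernstein n g s.
Proof.
move=> /andP[s0 s1]; elim: n f g => [|n IH] f g fg /=; first exact: fg.
by apply: lerD; apply: ler_wpM2l; rewrite ?subr_ge0 ?IH.
Qed.

Lemma bernstein_cst n c s : bernstein n (fun=> c) s = c.
Proof. by elim: n => //= n ->; lra. Qed.

Lemma bernsteinD n f g s : bernstein n (fun k => f k + g k) s = bernstein n f s + bernstein n g s.
Proof. by elim: n f g => //= n IH f g; rewrite !IH; lra. Qed.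

Lemma bernsteinZ n c f s : bernstein n (fun k => c * f k) s = c * bernstein n f s.
Proof. by elim: n f => //= n IH f; rewrite !IH; lra. Qed.

(** Variance plus squared bias of the binomial law. *)
Lemma bernstein_sqr n a s :
  bernstein n (fun k => (k%:R - a) ^+ 2) s = n%:R * s * (1 - s) + (n%:R * s - a) ^+ 2.
Proof.
elim: n a => [|n IH] a /=; first by lra.
have -> : (fun k : nat => (k.+1%:R - a) ^+ 2) = (fun k => (k%:R - (a - 1)) ^+ 2).
  by apply/funext => k; rewrite -natr1; congr (_ ^+ 2); lra.
by rewrite !IH -natr1; lra.
Qed.

Lemma bernstein_chebyshev n (h s : R) : 0 < h -> 0 <= s <= 1 -> (0 < n)%N ->
  bernstein n (fun k => (n%:R * h) ^- 2 * (k%:R - n%:R * s) ^+ 2) s <= (n%:R * h ^+ 2)^-1.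
Proof.
move=> h0 /andP[s0 s1] n0; rewrite bernsteinZ bernstein_sqr subrr expr0n/= addr0.
have n0' : 0 < n%:R :> R by rewrite ltr0n.
rewrite ler_pdivrMl ?exprn_gt0 ?mulr_gt0//.
rewrite (_ : (n%:R * h) ^+ 2 / (n%:R * h ^+ 2) = n%:R); last first.
  rewrite (_ : (n%:R * h) ^+ 2 = n%:R * (n%:R * h ^+ 2)); last by lra.
  by rewrite mulfK// gt_eqF// mulr_gt0// exprn_gt0.
by rewrite -mulrA; apply: ler_piMr; [exact: ltW|nra].
Qed.

(** The probability that the frequency of successes is below [tau]: nearly 1 for
[s] below [tau], nearly 0 for [s] above. *)
Definition bernstein_step n (tau s : R) : R :=
  bernstein n (fun k => if k%:R < n%:R * tau then 1 else 0) s.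

Lemma bernstein_step_01 n tau s : 0 <= s <= 1 -> 0 <= bernstein_step n tau s <= 1.
Proof.
move=> s01; apply/andP; split.
  rewrite -(bernstein_cst n 0 s); apply: le_bernstein => // k; case: ifP => //.
rewrite -[leRHS](bernstein_cst n 1 s); apply: le_bernstein => // k; case: ifP => //.
Qed.

Lemma sqr_ratio_ge1 (d e : R) : 0 < d -> d <= `|e| -> 1 <= d ^- 2 * e ^+ 2.
Proof.
move=> d0 de; rewrite ler_pdivlMl ?exprn_gt0// mulr1 -[leRHS]real_normK ?num_real//.
by rewrite lerXn2r// nnegrE ltW.
Qed.

Lemma bernstein_step_ge n (h tau s : R) : 0 < h -> 0 <= s <= 1 -> (0 < n)%N -> s <= tau - h ->
  1 <= bernstein_step n tau s + (n%:R * h ^+ 2)^-1.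
Proof.
move=> h0 s01 n0 st; have n0' : 0 < n%:R :> R by rewrite ltr0n.
apply: le_trans (_ : _ <= bernstein_step n tau s + bernstein n (fun k => (n%:R * h) ^- 2 *
  (k%:R - n%:R * s) ^+ 2) s) _; last first.
  by rewrite lerD2l bernstein_chebyshev.
rewrite -bernsteinD -[leLHS](bernstein_cst n 1 s); apply: le_bernstein => // k; case: ltP => hk.
  by rewrite lerDl; apply: mulr_ge0; rewrite ?invr_ge0 sqr_ge0.
rewrite add0r; apply: sqr_ratio_ge1; first exact: mulr_gt0.
apply: le_trans (ler_norm _); nra.
Qed.

Lemma bernstein_step_le n (h tau s : R) : 0 < h -> 0 <= s <= 1 -> (0 < n)%N -> tau + h <= s ->
  bernstein_step n tau s <= (n%:R * h ^+ 2)^-1.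
Proof.
move=> h0 s01 n0 st; have n0' : 0 < n%:R :> R by rewrite ltr0n.
apply: le_trans (bernstein_chebyshev h0 s01 n0).
apply: le_bernstein => // k; case: ltP => hk; last first.
  by apply: mulr_ge0; rewrite ?invr_ge0 sqr_ge0.
apply: sqr_ratio_ge1; first exact: mulr_gt0.
rewrite distrC; apply: le_trans (ler_norm _); nra.
Qed.

End bernstein_operator.

Section gap.
Context {R : realType}.
Notation mu := (@lebesgue_measure R).

Section bounded.
Variable v : R -> R.
Hypothesis vd : nonneg_density v.
Hypothesis M0 : (moment v (fun=> 1%R) <= 1)%E.

Definition unit_valued (phi : R -> R) : Prop :=
  measurable_fun setT phi /\ forall x, 0 < x -> 0 <= phi x <= 1.

Lemma bounded_integrable phi : unit_valued phi ->
  mu.-integrable setT (EFin \o (fun x => phi x * v x)).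
Proof.
move=> [mphi phi1]; have [mv v0 vn] := vd.
apply/integrableP; split; first by apply/measurable_EFinP; meas.
apply: le_lt_trans (ltry 1); apply: le_trans M0.
apply: ge0_le_integral => //.
- by apply: measurableT_comp => //; apply/measurable_EFinP; meas.
- by meas.
move=> x _; rewrite lee_fin normrM (ger0_norm (v0 x)).
have [x0|x0] := leP x 0; first by rewrite vn// !mulr0.
by have /andP[p0 p1] := phi1 _ x0; rewrite ler_wpM2r// ger0_norm.
Qed.

Lemma rmomentDB phi psi chi : unit_valued phi -> unit_valued psi -> unit_valued chi ->
  rmoment v (fun x => phi x + psi x - chi x) = rmoment v phi + rmoment v psi - rmoment v chi.
Proof.
move=> /bounded_integrable b1 /bounded_integrable b2 /bounded_integrable b3.
rewrite /rmoment /moment.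
have -> : (\int[mu]_x ((phi x + psi x - chi x) * v x)%:E =
  \int[mu]_x (((EFin \o (fun x => phi x * v x)%R) x + (EFin \o (fun x => psi x *
    v x)%R) x) - (EFin \o (fun x => chi x * v x)%R) x))%E.
  by apply: eq_integral => x _; rewrite mulrBl mulrDl EFinB EFinD.
have b12 := integrableD measurableT b1 b2.
have f1 := integrable_fin_num measurableT b1.
have f2 := integrable_fin_num measurableT b2.
have f3 := integrable_fin_num measurableT b3.
rewrite (integralB measurableT b12 b3) (integralD measurableT b1 b2).
rewrite fineB; [|by rewrite fin_numD; apply/andP|exact: f3].
by rewrite fineD; [|exact: f1|exact: f2].
Qed.

Lemma rmoment_bounded phi : unit_valued phi ->
  moment v phi = (rmoment v phi)%:E /\ 0 <= rmoment v phi <= 1.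
Proof.
move=> [mphi phi1]; apply: (rmoment_le vd (psi := fun=> 1)) => //.
- by move=> x /phi1 /andP[].
- by move=> x /phi1 /andP[].
Qed.

Lemma le_rmoment phi psi : unit_valued phi -> unit_valued psi ->
  (forall x, 0 < x -> phi x <= psi x) -> rmoment v phi <= rmoment v psi.
Proof.
move=> b1 b2 h; rewrite -lee_fin.
have [<- _] := rmoment_bounded b1; have [<- _] := rmoment_bounded b2.
apply: (le_moment vd) => //; [exact: b1.1|exact: b2.1|].
by move=> x /b1.2 /andP[].
Qed.

Lemma le_rmomentD phi psi c : unit_valued phi -> unit_valued psi -> 0 <= c ->
  (forall x, 0 < x -> phi x <= psi x + c) -> rmoment v phi <= rmoment v psi + c.
Proof.
move=> b1 b2 c0 h; rewrite -lee_fin EFinD.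
have [<- _] := rmoment_bounded b1; have [<- _] := rmoment_bounded b2.
have [[m1 h1] [m2 h2]] := (b1, b2).
have mc : measurable_fun setT (fun _ : R => c) by exact: measurable_cst.
have p2 : nonneg_on psi by move=> x /h2 /andP[].
have pc : nonneg_on (fun _ : R => c) by [].
apply: (@le_trans _ _ (moment v (fun x => psi x + c))).
  apply: (le_moment vd) => //; first by meas.
  by move=> x /h1 /andP[].
rewrite (momentD vd m2 mc p2 pc) leeD2l//.
have m1' : measurable_fun setT (fun _ : R => 1 : R) by exact: measurable_cst.
have p1 : nonneg_on (fun _ : R => 1 : R) by move=> ? _; exact: ler01.
have := momentZ vd m1' c0 p1; rewrite (_ : (fun x : R => c * 1) = (fun=> c)).
  by move=> ->; rewrite -[leRHS]mule1 lee_wpmul2l.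
by apply/funext => x; rewrite mulr1.
Qed.

End bounded.

Lemma expRN01 (x : R) : 0 < x -> 0 <= expR (- x) <= 1.
Proof. by move=> x0; rewrite expR_ge0 expR_le1 oppr_le0 ltW. Qed.

Lemma measurable_bernstein n f : measurable_fun setT (fun x : R => bernstein n f (expR (- x))).
Proof. by elim: n f => [|n IH] f /=; meas; exact: IH. Qed.

Lemma unit_valued_bernstein n f (j : nat) : (forall k, 0 <= f k <= 1) ->
  unit_valued (fun x : R => expR (- (j%:R * x)) * bernstein n f (expR (- x))).
Proof.
move=> f01; split.
  by have := measurable_bernstein n f => h; meas.
move=> x x0; have s01 := expRN01 x0.
have : 0 <= bernstein n f (expR (- x)) <= 1.
  apply/andP; split.
    by rewrite -(bernstein_cst n 0 (expR (- x))); apply: le_bernstein => // k;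
      have /andP[] := f01 k.
  by rewrite -[leRHS](bernstein_cst n 1 (expR (- x))); apply: le_bernstein => // k;
    have /andP[] := f01 k.
move=> /andP[b0 b1]; have : 0 <= expR (- (j%:R * x)) <= 1.
  by rewrite expR_ge0 expR_le1 oppr_le0 mulr_ge0// ltW.
by move=> /andP[e0 e1]; rewrite mulr_ge0//= mulr_ile1.
Qed.

Lemma ler_norm_combination (a1 a2 a3 b1 b2 b3 r : R) :
  `|a1 - b1| <= r -> `|a2 - b2| <= r -> `|a3 - b3| <= r ->
  `|(a1 + a2 - a3) - (b1 + b2 - b3)| <= 3 * r.
Proof.
rewrite !ler_norml => /andP[? ?] /andP[? ?] /andP[? ?].
by apply/andP; split; lra.
Qed.

Section two.
Variables v w : R -> R.
Hypothesis vd : nonneg_density v.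
Hypothesis wd : nonneg_density w.
Hypothesis v1 : (moment v (fun=> 1%R) <= 1)%E.
Hypothesis w1 : (moment w (fun=> 1%R) <= 1)%E.
Variables (N : nat) (rho : R).
Hypothesis gap : forall j, (j <= N)%N ->
  `|rmoment v (fun x => expR (- (j%:R * x))) - rmoment w (fun x => expR (- (j%:R * x)))|
    <= rho.

(** Unfolding the recursion, a Bernstein polynomial of degree [n + 1] is a
combination of three polynomials of degree [n] times powers of [s = e^{-x}], each
of them with values in the unit interval; hence the factor 3 in each step. *)
Lemma bernstein_gap n (j : nat) f : (n + j <= N)%N -> (forall k, 0 <= f k <= 1) ->
  `|rmoment v (fun x => expR (- (j%:R * x)) * bernstein n f (expR (- x))) -
    rmoment w (fun x => expR (- (j%:R * x)) * bernstein n f (expR (- x)))| <= 3 ^+ n * rho.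
Proof.
have rho0 : 0 <= rho by apply: le_trans (gap (leq0n N)); exact: normr_ge0.
elim: n j f => [|n IH] j f nj f01.
  rewrite expr0 mul1r /=.
  have m1 : measurable_fun setT (fun x : R => expR (- (j%:R * x))) by meas.
  have p1 : nonneg_on (fun x : R => expR (- (j%:R * x))).
    by move=> x _; exact: expR_ge0.
  have /andP[f0 f1] := f01 0%N.
  have e (u : R -> R) : nonneg_density u ->
      (moment u (fun=> 1%R) <= 1)%E ->
      rmoment u (fun x => expR (- (j%:R * x)) * f 0%N) =
      f 0%N * rmoment u (fun x => expR (- (j%:R * x))).
    move=> ud u1.
    have bu : unit_valued (fun x : R => expR (- (j%:R * x))).
      split => // x x0; rewrite expR_ge0 expR_le1 oppr_le0.
      by rewrite mulr_ge0// ltW.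
    have [eu _] := rmoment_bounded ud u1 bu.
    have := momentZ ud m1 f0 p1; rewrite eu /rmoment => h.
    by under eq_fun do rewrite mulrC; rewrite h.
  rewrite e// e// -mulrBr normrM (ger0_norm f0).
  have jN : (j <= N)%N by rewrite add0n in nj.
  by apply: le_trans (gap jN); apply: ler_piMl; [exact: normr_ge0|exact: f1].
have f01' k : 0 <= f k.+1 <= 1 by [].
have nj1 : (n + j.+1 <= N)%N by rewrite addnS -addSn.
have nj0 : (n + j <= N)%N by apply: leq_trans nj; rewrite leq_add2r.
have h1 := IH j.+1 _ nj1 f01'.
have h2 := IH j _ nj0 f01.
have h3 := IH j.+1 _ nj1 f01.
have b1 := @unit_valued_bernstein n _ j.+1 f01'.
have b2 := @unit_valued_bernstein n _ j f01.
have b3 := @unit_valued_bernstein n _ j.+1 f01.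
have -> : (fun x : R => expR (- (j%:R * x)) * bernstein n.+1 f (expR (- x))) =
  (fun x => expR (- (j.+1%:R * x)) * bernstein n (fun k => f k.+1) (expR (- x)) +
     expR (- (j%:R * x)) * bernstein n f (expR (- x)) -
     expR (- (j.+1%:R * x)) * bernstein n f (expR (- x))).
  apply/funext => x /=.
  have -> : expR (- (j.+1%:R * x)) = expR (- (j%:R * x)) * expR (- x).
    by rewrite -expRD -natr1; congr expR; rewrite mulrDl mul1r opprD.
  move: (expR _) (expR _) (bernstein _ _ _) (bernstein _ _ _) => e s A B; lra.
rewrite (rmomentDB vd v1 b1 b2 b3) (rmomentDB wd w1 b1 b2 b3) exprS.
by rewrite -mulrA; exact: ler_norm_combination h1 h2 h3.
Qed.

Lemma unit_valued_tail (tau : R) :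
  unit_valued (fun x : R => if expR (- x) < tau then 1 else 0).
Proof.
split; last by move=> x _; case: ifP; rewrite lexx ler01.
by meas.
Qed.

(** The step function with jump at [tau] lies between two Bernstein polynomials, up
to Chebyshev errors and a shift of the jump; these polynomials are integrated
alike by [v] and [w]. *)
Lemma tail_gap (h tau : R) : 0 < h -> (0 < N)%N ->
  rmoment v (fun x => if expR (- x) < tau then 1 else 0) <=
  rmoment w (fun x => if expR (- x) < tau + 2 * h then 1 else 0) +
    2 / (N%:R * h ^+ 2) + 3 ^+ N * rho.
Proof.
move=> h0 N0; set c := (N%:R * h ^+ 2)^-1.
have c0 : 0 <= c by rewrite invr_ge0 mulr_ge0// sqr_ge0.
pose f (k : nat) : R := if k%:R < N%:R * (tau + h) then 1 else 0.
have f01 k : 0 <= f k <= 1 by rewrite /f; case: ifP; rewrite lexx ler01.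
have N0N : (N + 0 <= N)%N by rewrite addn0.
have gapN := bernstein_gap N0N f01.
have bq := @unit_valued_bernstein N f 0 f01.
pose q (x : R) := expR (- (0%:R * x)) * bernstein N f (expR (- x)).
have qE (x : R) : q x = bernstein_step N (tau + h) (expR (- x)).
  by rewrite /q mul0r oppr0 expR0 mul1r.
have h1 : rmoment v (fun x => if expR (- x) < tau then 1 else 0) <= rmoment v q + c.
  apply: (le_rmomentD vd v1 (unit_valued_tail tau) bq c0) => x x0.
  rewrite -/(q x) qE; have s01 := expRN01 x0.
  case: ifPn => [st|_].
    by apply: bernstein_step_ge => //; rewrite addrK ltW.
  by have /andP[+ _] := bernstein_step_01 N (tau + h) s01; rewrite -/c; lra.
have h2 : rmoment w q <= rmoment w (fun x => if expR (- x) < tau + 2 * h then 1 else 0) + c.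
  apply: (le_rmomentD wd w1 bq (unit_valued_tail _) c0) => x x0.
  rewrite -/(q x) qE; have s01 := expRN01 x0.
  case: ltP => [_|st].
    by have /andP[_ +] := bernstein_step_01 N (tau + h) s01; rewrite -/c; lra.
  by rewrite add0r; apply: bernstein_step_le => //; lra.
move: gapN; rewrite -/q ler_norml => /andP[_ h3].
move: h1 h2 h3; rewrite -/c.
move: (rmoment v _) (rmoment v _) (rmoment w _) (rmoment w _) => a b c1 d; lra.
Qed.

End two.
End gap.

(** * The exponential profile *)

Section exponential.
Context {R : realType}.
Notation mu := (@lebesgue_measure R).

Definition exp_density (x : R) : R := if 0 < x then expR (- x) else 0.

Lemma nonneg_exp_density : nonneg_density exp_density.
Proof.
split; first by rewrite /exp_density; meas.
  by move=> x; rewrite /exp_density; case: ifP => // _; exact: expR_ge0.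
by move=> x x0; rewrite /exp_density ltNge x0.
Qed.

Lemma integral_exp_tail (t : R) :
  (\int[mu]_(x in `[t, +oo[) (expR (- x))%:E = (expR (- t))%:E)%E.
Proof.
rewrite (@ge0_continuous_FTC2y _ (fun x => expR (- x)) (fun x => - expR (- x)) t 0).
- by rewrite sub0e EFinN oppeK.
- by move=> x _; exact: expR_ge0.
- apply: continuous_subspaceT => x.
  by apply: (@is_derive_continuous R _ x (- expR (- x))); apply: is_derive_eq;
    rewrite /GRing.scale/= mulrN1.
- by rewrite -oppr0; apply: cvgN; exact: cvgr_expR.
- by move=> x _; apply: ex_derive.
- apply: cvg_at_right_filter.
  by apply: (@is_derive_continuous R (fun x => - expR (- x)) t (expR (- t)));
    apply: is_derive_eq; rewrite /GRing.scale/= mulrN1 opprK.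
- move=> x _; rewrite derive1E.
  have d : is_derive x 1 (fun x : R => - expR (- x)) (expR (- x)).
    by apply: is_derive_eq; rewrite /GRing.scale/= mulrN1 opprK.
  by have [_ ->] := d.
Qed.

Lemma moment_exp_tail (t : R) : 0 <= t ->
  moment exp_density (fun x => if t < x then 1 else 0) = (expR (- t))%:E.
Proof.
move=> t0; rewrite -integral_exp_tail -integral_itv_obnd_cbnd; last first.
  by apply/measurable_EFinP; apply: measurable_funTS; meas.
rewrite integral_itv_if /moment; apply: eq_integral => x _.
rewrite in_itv/= andbT /exp_density; case: ltP => tx; last by rewrite mul0r.
by rewrite (le_lt_trans t0 tx) mul1r.
Qed.

(** The layer-cake formula: [x] is the integral of the indicator of [(0, x)], so the
mass is the integral of the tail [e^{-t}]. *)
Lemma exp_mass : (moment exp_density id = 1)%E.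
Proof.
rewrite /moment.
pose f (p : R * R) : \bar R := (if (0 < p.1) && (p.1 < p.2) then exp_density p.2 else 0)%:E.
have [me e0 en] := nonneg_exp_density.
have mf : measurable_fun setT f by rewrite /f; meas; rewrite /exp_density; meas.
have f0 p : (0 <= f p)%E by rewrite /f; case: ifP => _; rewrite lee_fin.
transitivity (\int[mu]_x \int[mu]_t f (t, x))%E.
  apply: eq_integral => x _; rewrite /f/=.
  have [x0|x0] := leP x 0.
    rewrite (en _ x0) mulr0 integral0_eq// => t _; by rewrite if_same.
  transitivity (\int[mu]_(t in `]0%R, x[) (exp_density x)%:E)%E.
    rewrite integral_cst//= lebesgue_measure_itv/= lte_fin x0 oppr0 adde0.
    by rewrite muleC.
  rewrite integral_itv_if; apply: eq_integral => t _.
  by rewrite in_itv/=; case: ifP.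
rewrite -fubini_tonelli//.
transitivity (\int[mu]_(t in `]0%R, +oo[) (expR (- t))%:E)%E.
  rewrite integral_itv_if; apply: eq_integral => t _; rewrite in_itv/= andbT /f/=.
  case: ltP => t0 /=; last by rewrite integral0.
  rewrite -(moment_exp_tail (ltW t0)); apply: eq_integral => x _.
  by case: ifP; rewrite ?mul0r ?mul1r.
rewrite integral_itv_obnd_cbnd ?integral_exp_tail ?oppr0 ?expR0//.
by apply/measurable_EFinP; apply: measurable_funTS; meas.
Qed.

(** The tail factor of the flux cancels the [y]-dependence of [e^{-y}] and leaves
the integral of [2 * y * e^{-x}] over [(0, x)]. *)
Lemma flux_exp (x : R) :
  flux (fun _ _ => 2) exp_density x = (x ^+ 2 * exp_density x)%:E.
Proof.
have [me e0 en] := nonneg_exp_density.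
rewrite /flux.
have [x0|x0] := leP x 0.
  rewrite (en _ x0) mulr0 integral0_eq// => y _; rewrite integral0_eq// => z _.
  case: ifP => // /andP[yx _]; rewrite (en y) ?mulr0 ?mul0r ?mulr0//.
  by rewrite ltW// (lt_le_trans yx).
transitivity (\int[mu]_(y in `]0%R, x[) (2 * y * expR (- x))%:E)%E.
  rewrite integral_itv_if; apply: eq_integral => y _; rewrite in_itv/=.
  have [y0|y0] /= := leP y 0.
    by rewrite integral0_eq// => z _; rewrite (en _ y0) mulr0 mul0r mulr0 if_same.
  case: ifP => yx; last first.
    by rewrite integral0_eq// => z _; rewrite yx.
  have xy0 : 0 <= x - y by rewrite subr_ge0 ltW.
  have c0 : 0 <= 2 * y * expR (- y) by rewrite !mulr_ge0 ?expR_ge0// ltW.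
  transitivity ((2 * y * expR (- y))%:E * moment exp_density (fun z => if x - y < z then 1 else
    0)%R)%E.
    rewrite /moment -ge0_integralZl//.
    - apply: eq_integral => z _; rewrite -EFinM; congr (_%:E).
      rewrite /= ltrBlDl; case: ifP => _; last by lra.
      by rewrite {1}/exp_density y0; lra.
    - by meas.
    - by move=> z _; rewrite lee_fin; apply: mulr_ge0 => //; case: ifP.
  have -> : expR (- x) = expR (- y) * expR (- (x - y)).
    by rewrite -expRD; congr expR; lra.
  by rewrite (moment_exp_tail xy0) -EFinM; congr (_%:E); lra.
have -> : x ^+ 2 * exp_density x = x ^+ 2 * expR (- x) - 0 ^+ 2 * expR (- x).
  by rewrite expr0n/= mul0r subr0 /exp_density x0.
apply: (@integral_itvoo_primitive R (fun y => 2 * y * expR (- x))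
  (fun y => y ^+ 2 * expR (- x))) => //.
- by move=> y _; apply: is_derive_eq; rewrite /GRing.scale/=; lra.
- by move=> y _; exact: is_derive_continuous.
Qed.

Lemma near_profile_exp (alpha : R) : near_profile alpha 0 exp_density.
Proof.
split.
- exact: nonneg_exp_density.
- exact: exp_mass.
- by apply: aeW => x; rewrite flux_exp.
- have -> : (fun y z : R => 2 + 0 * sing_kernel alpha y z) = (fun _ _ => 2).
    by apply/funext => y; apply/funext => z; rewrite mul0r addr0.
  by apply: aeW => x; rewrite flux_exp.
Qed.

Lemma exp_M0 : (moment exp_density (fun=> 1%R) = 1)%E.
Proof.
rewrite (_ : 1%E = (expR (- (0 : R)))%:E); last by rewrite oppr0 expR0.
rewrite -moment_exp_tail//; apply: (eq_moment nonneg_exp_density) => x x0.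
by rewrite x0.
Qed.

Lemma exp_tailE (tau : R) : 0 < tau <= 1 ->
  rmoment exp_density (fun x => if expR (- x) < tau then 1 else 0) = tau.
Proof.
move=> /andP[t0 t1].
have e : tau = expR (- (- ln tau)) by rewrite opprK lnK.
have l0 : 0 <= - ln tau by rewrite oppr_ge0 ln_le0.
rewrite /rmoment (_ : (fun x => _) = (fun x => if - ln tau < x then 1 else 0)).
  by rewrite (moment_exp_tail l0)/= -e.
by apply/funext => x; rewrite {1}e ltr_expR ltrN2.
Qed.

Lemma exp_tail_le (tau : R) : 0 <= tau ->
  rmoment exp_density (fun x => if expR (- x) < tau then 1 else 0) <= tau.
Proof.
rewrite le_eqVlt => /orP[/eqP <-|t0].
  have b0 : unit_valued (fun _ : R => 0 : R).
    by split => [|x _]; [exact: measurable_cst|rewrite lexx ler01].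
  rewrite (_ : (fun x => _) = (fun=> 0)).
    rewrite /rmoment /moment integral0_eq// => x _; by rewrite mul0r.
  by apply/funext => x; rewrite ltNge expR_ge0.
have [t1|t1] := leP tau 1; first by rewrite exp_tailE ?t0.
have [_ /andP[_ h]] := rmoment_bounded nonneg_exp_density
  (eq_ind_r (fun z => (z <= 1)%E) (lexx _) exp_M0) (unit_valued_tail tau).
exact: le_trans h (ltW t1).
Qed.

End exponential.

(** * Uniform closeness of the tails *)

Section kolmogorov.
Context {R : realType}.
Variable alpha : R.
Hypothesis alpha01 : 0 < alpha < 1.

Definition tail (v : R -> R) (t : R) : R := rmoment v (fun x => if t < x then 1 else 0).

Lemma unit_valued_gexp (p : R) : 0 <= p -> unit_valued (gexp p).
Proof.
move=> p0; split; first exact: measurable_gexp.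
move=> x x0; rewrite (gexp_ge0 p0 (ltW x0)) /gexp /=.
by have := expR_gt0 (- (p * x)); lra.
Qed.

Lemma unit_valued_cst (c : R) : 0 <= c <= 1 -> unit_valued (fun _ : R => c).
Proof. by move=> c01; split; [exact: measurable_cst|]. Qed.

(** The Laplace transform at [j] is the total number minus [U j]. The total number
is at most 1 and at least [U P], hence within [(1 + P)^-1] of 1, up to a term
proportional to [eps]. *)
Lemma np_laplace_gap (eps : R) (v : R -> R) (P j : nat) : 0 <= eps ->
  near_profile alpha eps v -> (j <= P)%N -> (0 < P)%N ->
  `|rmoment v (fun x => expR (- (j%:R * x))) - (1 + j%:R)^-1| <=
  (1 + P%:R)^-1 + 2 * eps / (1 - alpha) * (1 + P%:R) ^+ 2.
Proof.
move=> eps0 np jP P0; have /andP[a0 a1] := alpha01.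
have powb (k : nat) : (k <= P)%N -> k%:R `^ (2 - alpha) <= (1 + P%:R) ^+ 2 :> R.
  move=> kP; have kP' : k%:R <= P%:R :> R by rewrite ler_nat.
  apply: (@le_trans _ _ ((1 + P%:R) `^ (2 - alpha))).
    have P1 : 0 <= P%:R :> R by exact: ler0n.
    have k1 : 0 <= k%:R :> R by exact: ler0n.
    by apply: ge0_ler_powR; rewrite ?nnegrE; lra.
  rewrite -(@powR_mulrn _ (1 + P%:R)); last by rewrite addr_ge0.
  by apply: ler_powR; [rewrite lerDl|lra].
have fr (k : nat) : k%:R / (1 + k%:R) = 1 - (1 + k%:R)^-1 :> R.
  have k1 : 1 + k%:R != 0 :> R by rewrite gt_eqF// ltr_wpDr// ler0n.
  by apply: (mulIf k1); rewrite divfK// mulrBl mul1r mulVf//; lra.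
have vd := np_density np; have mass := np_mass np.
have M1 := np_M0_le1 np.
have c1 : 0 <= (1 : R) <= 1 by rewrite ler01 lexx.
have c0 : 0 <= (0 : R) <= 1 by rewrite ler01 lexx.
have b1 := unit_valued_cst c1; have b0 := unit_valued_cst c0.
have bj := unit_valued_gexp (ler0n R j); have bP := unit_valued_gexp (ler0n R P).
have [_ /andP[M00 M01]] := rmoment_bounded vd M1 b1.
have e : rmoment v (fun x => expR (- (j%:R * x))) =
    rmoment v (fun=> 1) - rmoment v (gexp j%:R).
  rewrite (_ : (fun x => _) = (fun x => 1 + 0 - gexp j%:R x)); last first.
    by apply/funext => x; rewrite /gexp; lra.
  rewrite (rmomentDB vd M1 b1 b0 bj).
  have -> : rmoment v (fun=> 0) = 0.
    by rewrite /rmoment /moment integral0_eq// => x _; rewrite mul0r.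
  by rewrite addr0.
have P0' : 0 < P%:R :> R by rewrite ltr0n.
have UP := np_U_ge alpha01 eps0 np P0'.
have UM : rmoment v (gexp P%:R) <= rmoment v (fun=> 1).
  by apply: (le_rmoment vd M1 bP b1) => x x0; have /andP[] := bP.2 _ x0.
have c00 : 0 <= 2 * eps / (1 - alpha) by rewrite divr_ge0 ?mulr_ge0// subr_ge0 ltW.
set c := 2 * eps / (1 - alpha) in UP c00 *.
have hj : j%:R / (1 + j%:R) - c * (1 + P%:R) ^+ 2 <= rmoment v (gexp j%:R) <= j%:R / (1 + j%:R).
  have [->|j0] := posnP j.
    have -> : rmoment v (gexp 0%:R) = 0.
      rewrite /rmoment /moment integral0_eq// => x _.
      by rewrite /gexp mul0r oppr0 expR0 subrr mul0r.
    by rewrite !mul0r sub0r oppr_le0 lexx mulr_ge0 ?sqr_ge0.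
  have j0' : 0 < j%:R :> R by rewrite ltr0n.
  rewrite (np_U_le np j0') andbT.
  apply: le_trans (np_U_ge alpha01 eps0 np j0').
  by rewrite lerD2l lerN2 ler_wpM2l// powb.
have hP : c * P%:R `^ (2 - alpha) <= c * (1 + P%:R) ^+ 2.
  by rewrite ler_wpM2l// powb.
move: hj UP; rewrite e !fr ler_norml.
move: (rmoment v (fun=> 1)) (rmoment v (gexp j%:R)) (rmoment v (gexp P%:R)) UM M00 M01.
move: (_ `^ _) hP ((1 + j%:R)^-1) => pw hP ij M Uj UP UM M00 M01 /andP[h1 h2] h3.
have iP0 : 0 <= (1 + P%:R)^-1 :> R by rewrite invr_ge0; lra.
have : 0 <= c * (1 + P%:R) ^+ 2 by rewrite mulr_ge0 ?sqr_ge0.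
move: ((1 + P%:R)^-1) iP0 (c * _) hP h1 h3 => iP iP0 cP hP h1 h3 cP0.
by apply/andP; split; lra.
Qed.

(** Weak convergence to a law with continuous distribution function is uniform on
the distribution functions; here it is made quantitative, because a single
threshold on [eps] must serve all profiles. *)
Lemma np_tail_close (eta : R) : 0 < eta ->
  exists2 es : R, 0 < es & forall eps v, 0 <= eps <= es ->
    near_profile alpha eps v -> forall t, 0 <= t ->
    `|tail v t - expR (- t)| <= eta.
Proof.
move=> eta0; have /andP[a0 a1] := alpha01.
have [h h0 hE] : exists2 h : R, 0 < h & h = eta / 6 by exists (eta / 6) => //; lra.
(* The degree N makes the Chebyshev errors small, P >= N makes the total number
   close to 1, and eps is chosen against the resulting factor 3 ^+ N. *)
have [N hN] : exists N : nat, 6 / (eta * h ^+ 2) < N%:R.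
  exists (Num.bound (6 / (eta * h ^+ 2))); apply: archi_boundP.
  by rewrite divr_ge0// mulr_ge0 ?sqr_ge0// ltW.
have eh0 : 0 < eta * h ^+ 2 by rewrite mulr_gt0// exprn_gt0.
have N0 : (0 < N)%N by rewrite -(ltr_nat R); apply: le_lt_trans hN; rewrite divr_ge0// ltW.
have N0' : 0 < N%:R :> R by rewrite ltr0n.
have t30 : 0 < 3 ^+ N :> R by rewrite exprn_gt0.
have [P NP hP] : exists2 P : nat, (N <= P)%N & 12 * 3 ^+ N / eta < 1 + P%:R.
  exists (N + Num.bound (12 * 3 ^+ N / eta))%N; first exact: leq_addr.
  have x0 : 0 <= 12 * 3 ^+ N / eta by rewrite divr_ge0 ?mulr_ge0// ltW.
  have := archi_boundP x0; rewrite natrD; lra.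
have P0 : (0 < P)%N by exact: leq_trans NP.
have P1 : 0 < 1 + P%:R :> R by rewrite ltr_wpDr.
have D0 : 0 < 3 ^+ N * (2 / (1 - alpha) * (1 + P%:R) ^+ 2).
  by rewrite !mulr_gt0// ?exprn_gt0// invr_gt0 subr_gt0.
exists (eta / 6 / (3 ^+ N * (2 / (1 - alpha) * (1 + P%:R) ^+ 2))).
  by rewrite divr_gt0// divr_gt0.
move=> eps v /andP[eps0 epss] np t t0.
have ne := near_profile_exp alpha.
have vd := np_density np; have M1 := np_M0_le1 np.
have ed := np_density ne; have M1' := np_M0_le1 ne.
pose rho := 2 * (1 + P%:R)^-1 + 2 * eps / (1 - alpha) * (1 + P%:R) ^+ 2.
have gap (j : nat) : (j <= N)%N ->
  `|rmoment v (fun x => expR (- (j%:R * x))) - rmoment exp_density (fun x => expR (- (j%:R *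
    x)))| <= rho.
  move=> jN; have jP : (j <= P)%N by exact: leq_trans jN NP.
  have := np_laplace_gap eps0 np jP P0.
  have := np_laplace_gap (lexx _) ne jP P0.
  rewrite !mulr0 !mul0r addr0 !ler_norml /rho.
  move: (rmoment v _) (rmoment exp_density _) => A B /andP[? ?] /andP[? ?].
  by apply/andP; split; lra.
have gap' (j : nat) : (j <= N)%N ->
  `|rmoment exp_density (fun x => expR (- (j%:R * x))) - rmoment v (fun x => expR (- (j%:R *
    x)))| <= rho.
  by move=> jN; rewrite distrC gap.
have e1 : 2 / (N%:R * h ^+ 2) <= eta / 3.
  rewrite ler_pdivrMr ?mulr_gt0 ?exprn_gt0//.
  by move: hN; rewrite ltr_pdivrMr// => hN; lra.
have e2 : 3 ^+ N * rho <= eta / 3.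
  rewrite /rho mulrDr.
  have : 3 ^+ N * (2 * (1 + P%:R)^-1) <= eta / 6.
    rewrite mulrA ler_pdivrMr//.
    by move: hP; rewrite ltr_pdivrMr// => hP; lra.
  have : 3 ^+ N * (2 * eps / (1 - alpha) * (1 + P%:R) ^+ 2) <= eta / 6.
    move: epss; rewrite ler_pdivlMr// => epss; apply: le_trans epss.
    by rewrite le_eqVlt; apply/orP; left; apply/eqP; lra.
  lra.
have tE (u : R -> R) : tail u t = rmoment u (fun x => if expR (- x) < expR (- t) then 1 else 0).
  by rewrite /tail; congr rmoment; apply/funext => x; rewrite ltr_expR ltrN2.
have up := tail_gap vd ed M1 M1' gap (expR (- t)) h0 N0.
have e20 : 0 <= expR (- t) + 2 * h by have := expR_gt0 (- t); lra.
have := exp_tail_le e20.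
rewrite ler_norml tE; move: up.
set A := rmoment v _; set B := rmoment _ _ => up hB.
apply/andP; split; last by move: (A) (B) up hB => a b; lra.
have [tt|tt] := leP (expR (- t)) (2 * h).
  have [_ /andP[A0 _]] := rmoment_bounded vd M1 (unit_valued_tail (expR (- t))).
  by rewrite -/A in A0; lra.
have tau01 : 0 < expR (- t) - 2 * h <= 1.
  have : expR (- t) <= 1 by rewrite expR_le1 oppr_le0.
  by rewrite subr_gt0 tt/=; lra.
have := tail_gap ed vd M1' M1 gap' (expR (- t) - 2 * h) h0 N0.
rewrite (exp_tailE tau01) subrK -/A.
by move: (A) => a; lra.
Qed.

End kolmogorov.

(** * Moments of negative order *)

Section small_moments.
Context {R : realType}.
Notation mu := (@lebesgue_measure R).

Lemma powR_nonincreasing (b x y : R) : b <= 0 -> 0 < x -> x <= y ->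
  y `^ b <= x `^ b.
Proof.
rewrite -oppr_ge0 -[b in _ `^ b <= _ `^ b]opprK; move: (- b) => c c0 x0 xy.
have y0 : 0 < y by exact: lt_le_trans xy.
rewrite !powRN lef_pV2 ?posrE ?powR_gt0//.
by apply: ge0_ler_powR; rewrite ?nnegrE ?(ltW x0) ?(ltW y0).
Qed.

Lemma is_derive_powR_shift (h b x : R) : 0 < x + h ->
  is_derive x 1 (fun x => (x + h) `^ b) (b * (x + h) `^ (b - 1)).
Proof.
move=> xh; have d := @is_derive1_powR R b _ xh.
have d2 : is_derive x 1 (fun x : R => x + h) 1.
  by apply: is_derive_eq; rewrite addr0.
have d3 := @is_derive1_comp R (@powR R ^~ b) (fun x => x + h) x _ _ d d2.
by rewrite mulr1 in d3.
Qed.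

Lemma integral_powR_shift (h c y z : R) : 0 <= h -> c != -1 -> 0 < y -> 0 < z ->
  (\int[mu]_(x in `]y, (y + z)%R[) ((x + h) `^ c)%:E =
   (((y + z + h) `^ (c + 1) - (y + h) `^ (c + 1)) / (c + 1))%:E)%E.
Proof.
move=> h0 c1 y0 z0.
have cn : c + 1 != 0 by rewrite addr_eq0.
rewrite mulrBl.
apply: (@integral_itvoo_primitive R (fun x => (x + h) `^ c)
  (fun x => (x + h) `^ (c + 1) / (c + 1))).
- by rewrite ltrDl.
- move=> x /andP[yx _].
  have xh : 0 < x + h by rewrite ltr_wpDr// (lt_le_trans y0).
  have d := @is_derive_powR_shift h (c + 1) _ xh.
  apply: is_derive_eq; rewrite /GRing.scale/= addrK !mulr0 add0r.
  by rewrite mulrA mulVf// mul1r.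
- move=> x /andP[yx _].
  have xh : 0 < x + h by rewrite ltr_wpDr// (lt_le_trans y0).
  have d := @is_derive_powR_shift h c _ xh.
  exact: is_derive_continuous.
Qed.

Variables (alpha eps : R) (v : R -> R).
Hypothesis eps0 : 0 <= eps.
Hypothesis np : near_profile alpha eps v.
Let vd := np_density np.
Let mass := np_mass np.
Variables (a kappa : R).
Hypothesis a1 : -1 < a <= 0.
Hypothesis kappa0 : 0 < kappa.
Hypothesis tail_kappa : (3 - a) / 4 <= tail v kappa.

Let M1 := np_M0_le1 np.

Lemma powR_shift_le (h x : R) : 0 < h -> 0 < x ->
  x ^+ 2 * (x + h) `^ (a - 2) <= x * (x + h) `^ (a - 1).
Proof.
move=> h0 x0; have xh : 0 < x + h by rewrite addr_gt0.
rewrite expr2 -mulrA ler_pM2l//.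
rewrite (_ : a - 1 = 1 + (a - 2)); last by lra.
rewrite [leRHS]powRD; last by rewrite (gt_eqF xh) implybT.
by rewrite (powRr1 (ltW xh)) ler_wpM2r ?powR_ge0// lerDl ltW.
Qed.

(** Integrate the lower inequality against [(x + h) `^ (a - 2)], the shift making all
terms finite. With [I] the moment to be bounded, [Y] the moment of
[x * (x + h) `^ (a - 1)] and [f] the tail at [kappa], keeping only the pairs with
[z > kappa] gives [I >= 2 * f / (1 - a) * (Y - kappa `^ (a - 1))]. Here [Y >= I]
and [f >= (3 - a) / 4], so that the coefficient of [Y] is at least
[1 + (1 + a) / (2 * (1 - a))]: it exceeds 1, and [I] can be absorbed. *)
Lemma shifted_moment_bound (h : R) : 0 < h ->
  (moment v (fun x => (x + h) `^ (a - 2) * x ^+ 2)%R <=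
    (2 * kappa `^ (a - 1) / ((1 + a) / 2))%:E)%E.
Proof.
move=> h0; have /andP[am1 a0] := a1.
have mpsi : measurable_fun setT (fun x : R => (x + h) `^ (a - 2)) by meas.
pose Psi (y z : R) := ((y + z + h) `^ (a - 1) - (y + h) `^ (a - 1)) / (a - 1).
have HPsi (y z : R) : 0 < y -> 0 < z ->
    (\int[mu]_(x in `]y, (y + z)%R[) ((x + h) `^ (a - 2))%:E = (Psi y z)%:E)%E.
  move=> y0 z0; have c1 : a - 2 != -1 by rewrite lt_eqF//; lra.
  rewrite (integral_powR_shift (ltW h0) c1 y0 z0).
  by rewrite (_ : a - 2 + 1 = a - 1)//; lra.
have low := np_test_lower np mpsi (fun x => powR_ge0 _ _) HPsi.
have [Ie /andP[I0 _]] : moment v (fun x => (x + h) `^ (a - 2) * x ^+ 2) =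
    (rmoment v (fun x => (x + h) `^ (a - 2) * x ^+ 2))%:E /\
    0 <= rmoment v (fun x => (x + h) `^ (a - 2) * x ^+ 2) <= h `^ (a - 1).
  apply: (rmoment_le_mass vd mass); first by meas.
  - by move=> x _; rewrite mulr_ge0 ?powR_ge0 ?sqr_ge0.
  - exact: powR_ge0.
  - move=> x x0; rewrite mulrC; apply: le_trans (powR_shift_le h0 x0) _.
    rewrite mulrC; apply: ler_wpM2r; first exact: ltW.
    by apply: powR_nonincreasing; lra.
have [Ye /andP[Y0 _]] : moment v (fun x => x * (x + h) `^ (a - 1)) =
    (rmoment v (fun x => x * (x + h) `^ (a - 1)))%:E /\
    0 <= rmoment v (fun x => x * (x + h) `^ (a - 1)) <= h `^ (a - 1).
  apply: (rmoment_le_mass vd mass); first by meas.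
  - by move=> x /ltW x0; rewrite mulr_ge0 ?powR_ge0.
  - exact: powR_ge0.
  - move=> x x0; rewrite mulrC; apply: ler_wpM2r; first exact: ltW.
    by apply: powR_nonincreasing; lra.
rewrite Ie in low *.
pose T (z : R) : R := if kappa < z then 1 else 0.
have bT : unit_valued T.
  by split; [rewrite /T; meas|move=> x _; rewrite /T; case: ifP; rewrite lexx ler01].
have pT : nonneg_on T by move=> x /bT.2 /andP[].
have [Te /andP[T0 T1]] := rmoment_bounded vd M1 bT.
rewrite -[rmoment v T]/(tail v kappa) in Te T0 T1.
have mid : measurable_fun setT (fun x : R => x) by exact: measurable_id.
have pid : nonneg_on (fun x : R => x) by move=> x /ltW.
pose c := 2 * kappa `^ (a - 1) / (1 - a).
have c0 : 0 <= c by rewrite divr_ge0 ?mulr_ge0 ?powR_ge0//; lra.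
pose d := 2 / (1 - a).
have d0 : 0 <= d by rewrite divr_ge0//; lra.
have mS : measurable_fun setT (fun x : R => x * (x + h) `^ (a - 1)) by meas.
have pS : nonneg_on (fun x : R => x * (x + h) `^ (a - 1)).
  by move=> x /ltW x0; rewrite mulr_ge0 ?powR_ge0.
have mF : measurable2 (fun y z => 2 * Psi y z * y).
  by rewrite /measurable2 /Psi; meas.
have pF : nonneg_on2 (fun y z => 2 * Psi y z * y).
  move=> y z y0 z0; apply: mulr_ge0 (ltW y0); apply: mulr_ge0 => //.
  rewrite -lee_fin -HPsi//; apply: integral_ge0 => x _.
  by rewrite lee_fin powR_ge0.
have mG : measurable2 (fun y z => c * y * T z).
  by rewrite /measurable2 /T; meas.
have pG : nonneg_on2 (fun y z => c * y * T z).
  by move=> y z y0 z0; rewrite mulr_ge0 ?pT// mulr_ge0// ltW.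
have mH : measurable2 (fun y z => d * (y * (y + h) `^ (a - 1)) * T z).
  by rewrite /measurable2 /T; meas.
have pH : nonneg_on2 (fun y z => d * (y * (y + h) `^ (a - 1)) * T z).
  by move=> y z y0 z0; rewrite mulr_ge0 ?pT// mulr_ge0// pS.
have ineq (y z : R) : 0 < y -> 0 < z ->
    d * (y * (y + h) `^ (a - 1)) * T z <= 2 * Psi y z * y + c * y * T z.
  move=> y0 z0; rewrite /T; case: ltP => kz; last first.
    by rewrite !mulr0 addr0 pF.
  have kp : (y + z + h) `^ (a - 1) <= kappa `^ (a - 1).
    apply: powR_nonincreasing; [lra|exact: kappa0|].
    have kzz : kappa < z by [].
    rewrite -addrA addrCA; apply: le_trans (ltW kzz) _.
    by rewrite lerDl addr_ge0// ltW.
  rewrite /Psi (_ : (a - 1)^-1 = - (1 - a)^-1); last by rewrite -invrN opprB.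
  rewrite /c /d.
  have i0 : 0 <= (1 - a)^-1 by rewrite invr_ge0; lra.
  have i1 : 0 <= (kappa `^ (a - 1) - (y + z + h) `^ (a - 1)) * ((1 - a)^-1 * y).
    by rewrite mulr_ge0 ?subr_ge0// mulr_ge0// ltW.
  move: i1; move: (kappa `^ _) ((_ + h) `^ _) ((y + h) `^ _) ((1 - a)^-1) => A B C D.
  by lra.
have mFG : measurable2 (fun y z => 2 * Psi y z * y + c * y * T z).
  exact: measurable_funD mF mG.
have := le_moment2 vd mH mFG pH ineq.
have mcT : measurable_fun setT (fun x : R => c * x) by meas.
have pcT : nonneg_on (fun x : R => c * x) by move=> x /ltW x0; rewrite mulr_ge0.
have mdS : measurable_fun setT (fun x : R => d * (x * (x + h) `^ (a - 1))) by meas.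
have pdS : nonneg_on (fun x : R => d * (x * (x + h) `^ (a - 1))).
  by move=> x x0; rewrite mulr_ge0// pS.
rewrite (moment2D vd mF mG pF pG) (moment2_prod vd mcT bT.1 pcT pT).
rewrite (moment2_prod vd mdS bT.1 pdS pT) (momentZ vd mid c0 pid) (momentZ vd mS d0 pS).
rewrite mass mule1 Ye Te => main.
have {main}main := le_trans main (leeD2r _ low).
rewrite -!EFinM -EFinD lee_fin in main.
have IY : rmoment v (fun x => (x + h) `^ (a - 2) * x ^+ 2) <=
  rmoment v (fun x => x * (x + h) `^ (a - 1)).
  suff : (moment v (fun x => (x + h) `^ (a - 2) * x ^+ 2)%R <=
    moment v (fun x => x * (x + h) `^ (a - 1))%R)%E.
    by rewrite Ie Ye lee_fin.
  apply: (le_moment vd) => //; first by meas.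
    by move=> x _; rewrite mulr_ge0 ?powR_ge0 ?sqr_ge0.
  by move=> x x0; rewrite mulrC powR_shift_le.
rewrite lee_fin.
move: main IY I0 T0 T1 tail_kappa; rewrite /c /d.
set Y := rmoment v (fun x => x * _); set I := rmoment v _.
move: Y I (tail v kappa) (kappa `^ _) (powR_ge0 kappa (a - 1)).
move=> Y I f k k0 main IY I0 f0 f1 ff.
rewrite ler_pdivlMr; last by lra.
have a10 : 0 < 1 - a by lra.
have : 2 * Y * f <= I * (1 - a) + 2 * k * f.
  have := ler_wpM2r (ltW a10) main.
  have ii : (1 - a)^-1 * (1 - a) = 1 by rewrite mulVf// gt_eqF.
  have : 2 * Y * f * ((1 - a)^-1 * (1 - a)) = 2 * Y * f by rewrite ii mulr1.
  have : 2 * k * f * ((1 - a)^-1 * (1 - a)) = 2 * k * f by rewrite ii mulr1.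
  by move: ((1 - a)^-1) => i; lra.
have : 0 <= I * (f - (3 - a) / 4) by rewrite mulr_ge0// subr_ge0.
have : 0 <= (Y - I) * f by rewrite mulr_ge0// subr_ge0.
have : 0 <= k * (1 - f) by rewrite mulr_ge0// subr_ge0.
by lra.
Qed.

(** Monotone convergence as the shift [h] of [shifted_moment_bound] tends to 0. *)
Lemma small_moment_bound :
  (moment v (fun x => x `^ a)%R <= (2 * kappa `^ (a - 1) / ((1 + a) / 2))%:E)%E.
Proof.
have [mv v0 vn] := vd.
(* The shifts h = e n decrease to 0. *)
pose e (n : nat) : R := n.+1%:R^-1.
have en0 n : 0 < e n by rewrite invr_gt0 ltr0n.
pose g (n : nat) (x : R) : \bar R := ((x + e n) `^ (a - 2) * x ^+ 2 * v x)%:E.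
have mg n : measurable_fun setT (g n) by rewrite /g; meas.
have g0 n x : setT x -> (0 <= g n x)%E.
  by move=> _; rewrite lee_fin mulr_ge0// mulr_ge0 ?powR_ge0 ?sqr_ge0.
have ndg (x : R) : setT x -> nondecreasing_seq (g ^~ x).
  move=> _ m n mn; rewrite lee_fin.
  have [x0|x0] := leP x 0; first by rewrite vn// !mulr0.
  rewrite ler_wpM2r// ler_wpM2r ?sqr_ge0//.
  have /andP[am1 a0] := a1.
  have mn' : e n <= e m by rewrite lef_pV2 ?posrE ?ltr0n// ler_nat.
  have := en0 n; have := en0 m.
  by move=> ? ?; apply: powR_nonincreasing; lra.
have glim (x : R) : limn (g ^~ x) = (x `^ a * v x)%:E.
  have [x0|x0] := leP x 0.
    by apply: cvg_lim => //; apply: cvg_near_cst; apply: nearW => n; rewrite /g vn// !mulr0.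
  apply: cvg_lim => //; apply: cvg_EFin; first by apply: nearW.
  apply: cvgMl.
  have -> : x `^ a = (x + 0) `^ (a - 2) * x ^+ 2.
    rewrite addr0 -powR_mulrn ?ltW// -powRD ?subrK//.
    by rewrite (gt_eqF x0) implybT.
  apply: cvgMl.
  have x00 : 0 < x + 0 by rewrite addr0.
  have d := @is_derive1_powR R (a - 2) _ x00.
  have cont := @is_derive_continuous R _ _ _ d.
  have ce : x + e n @[n --> \oo] --> x + 0.
    by apply: cvgD; [exact: cvg_cst|exact: cvg_harmonic].
  exact: (cvg_comp _ _ ce cont).
have := @cvg_monotone_convergence _ _ _ mu _ measurableT g mg g0 ndg.
under [X in _ --> X]eq_integral do rewrite glim.
rewrite -/(moment v (fun x => x `^ a)) => h.
rewrite -(cvg_lim _ h)//; apply: lime_le; first by apply/cvg_ex; eexists; exact: h.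
by apply: nearW => n; exact: shifted_moment_bound.
Qed.

End small_moments.

(** * Moments of high order *)

Section high_moments.
Context {R : realType}.
Notation mu := (@lebesgue_measure R).
Variable alpha : R.
Hypothesis alpha01 : 0 < alpha < 1.

Lemma powR_addn (x b c : R) : 0 < x -> x `^ (b + c) = x `^ b * x `^ c.
Proof. by move=> x0; rewrite powRD// (gt_eqF x0) implybT. Qed.

Section increment.
Variable g : R.
Hypothesis g1 : 1 < g.

(** The integral of [x `^ (g - 2)] over [(y, y + z)], the test function for the
moment of order [g]. *)
Definition increment (y z : R) := ((y + z) `^ (g - 1) - y `^ (g - 1)) / (g - 1).

Definition increment_cst : R := 2 `^ g + 2 `^ g / (g - 1).

Let g10 : 0 < g - 1. Proof. by rewrite subr_gt0. Qed.

Lemma increment_cst_ge0 : 0 <= increment_cst.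
Proof. by rewrite addr_ge0 ?powR_ge0// divr_ge0 ?powR_ge0// ltW. Qed.

(** The interval [(y, y + z)] has length [z] and [x <= 2 * y] on it; the primitive
is compared with a linear function. *)
Lemma increment_le_small (y z : R) : 0 < z -> z <= y ->
  increment y z * y <= increment_cst * (z * y `^ (g - 1)).
Proof.
have gg := g1; move=> z0 zy; have y0 : 0 < y by exact: lt_le_trans zy.
pose C := 2 `^ g * y `^ (g - 2).
have bd (x : R) : y <= x <= y + z -> x `^ (g - 2) <= C.
  move=> /andP[yx xyz]; have x0 : 0 < x by exact: lt_le_trans yx.
  have p1 : 1 <= 2 `^ g :> R.
    have g0 : 0 <= g by lra.
    by have := @ler_powR R 2 (ler1n R 2) _ _ g0; rewrite powRr0.
  have [g2|g2] := leP g 2.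
    apply: (@le_trans _ _ (y `^ (g - 2))).
      by apply: powR_nonincreasing => //; lra.
    by rewrite /C ler_peMl// powR_ge0.
  apply: (@le_trans _ _ ((2 * y) `^ (g - 2))).
    by apply: ge0_ler_powR; rewrite ?nnegrE; lra.
  rewrite powRM//; last exact: ltW.
  by rewrite ler_wpM2r ?powR_ge0//; apply: ler_powR; lra.
have : C * y - y `^ (g - 1) / (g - 1) <= C * (y + z) - (y + z) `^ (g - 1) / (g - 1).
  apply: (@derive_ge0_le R (fun x => C * x - x `^ (g - 1) / (g - 1))
    (fun x => C - x `^ (g - 2))).
  - by rewrite lerDl ltW.
  - move=> x /andP[yx xyz]; have x0 : 0 < x by exact: lt_le_trans yx.
    have d := @is_derive1_powR R (g - 1) _ x0.
    apply: is_derive_eq; rewrite /GRing.scale/= mulr0 add0r mulr1.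
    rewrite mulrA mulVf ?mul1r ?gt_eqF//.
    by rewrite (_ : g - 1 - 1 = g - 2)//; lra.
  - by move=> x /bd; rewrite subr_ge0.
move=> h; have {}h : increment y z <= C * z by rewrite /increment mulrBl; lra.
have -> : increment_cst * (z * y `^ (g - 1)) = C * z * y + 2 `^ g / (g - 1) * (z * y `^ (g - 1)).
  have e : y `^ (g - 1) = y `^ (g - 2) * y.
    rewrite -[X in _ = _ * X](powRr1 (ltW y0)) -powR_addn//; congr (_ `^ _); lra.
  by rewrite /C /increment_cst e; lra.
apply: (@le_trans _ _ (C * z * y)); first by rewrite ler_pM2r.
rewrite lerDl; apply: mulr_ge0; first by rewrite divr_ge0 ?powR_ge0// ltW.
by rewrite mulr_ge0 ?powR_ge0// ltW.
Qed.

Lemma increment_le_large (y z : R) : 0 < y -> y <= z ->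
  increment y z * y <= increment_cst * (y * z `^ (g - 1)).
Proof.
have gg := g1; move=> y0 yz; have z0 : 0 < z by exact: lt_le_trans yz.
have h1 : (y + z) `^ (g - 1) <= 2 `^ g * z `^ (g - 1).
  apply: (@le_trans _ _ ((2 * z) `^ (g - 1))).
    by apply: ge0_ler_powR; rewrite ?nnegrE; lra.
  rewrite powRM//; last exact: ltW.
  by rewrite ler_wpM2r ?powR_ge0//; apply: ler_powR; lra.
have h2 : increment y z <= increment_cst * z `^ (g - 1).
  apply: (@le_trans _ _ (2 `^ g * z `^ (g - 1) / (g - 1))).
    rewrite /increment ler_pM2r ?invr_gt0// lerBlDr; apply: le_trans h1 _.
    by rewrite lerDl powR_ge0.
  rewrite mulrAC ler_wpM2r ?powR_ge0// /increment_cst lerDr powR_ge0//.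
by rewrite [y * _]mulrC mulrA ler_wpM2r// ltW.
Qed.

(** The singular kernel costs a factor [(y / z) `^ alpha], which the smaller variable
can afford: its power drops from [1] to [1 - alpha], an order at which moments
are bounded by [np_moment_le2]. *)
Lemma kernel_increment_le (eps y z : R) : 0 <= eps <= 1 -> 0 < z -> z <= y ->
  (2 + eps * sing_kernel alpha y z) * (increment_cst * (z * y `^ (g - 1))) <=
  4 * increment_cst * (z `^ (1 - alpha) * y `^ (g - (1 - alpha))).
Proof.
have gg := g1; have /andP[a0 a1] := alpha01.
move=> /andP[eps0 eps1] z0 zy; have y0 : 0 < y by exact: lt_le_trans zy.
pose q := y / z.
have q1 : 1 <= q by rewrite /q ler_pdivlMr// mul1r.
have q0 : 0 < q by exact: lt_le_trans q1.
have qa : 1 <= q `^ alpha.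
  by rewrite -[leLHS](powRr0 q); apply: ler_powR => //; exact: ltW.
have qb : (z / y) `^ alpha <= 1.
  apply: (@le_trans _ _ (1 `^ alpha)); last by rewrite powR1.
  apply: ge0_ler_powR; rewrite ?nnegrE; [exact: ltW| |exact: ler01|].
    by rewrite divr_ge0// ltW.
  by rewrite ler_pdivrMr// mul1r.
have K4 : 2 + eps * sing_kernel alpha y z <= 4 * q `^ alpha.
  have V0 := sing_kernel_ge0 alpha y z.
  have : eps * sing_kernel alpha y z <= sing_kernel alpha y z by apply: ler_piMl.
  by rewrite {2}/sing_kernel -/q; lra.
have -> : z `^ (1 - alpha) * y `^ (g - (1 - alpha)) = q `^ alpha * (z * y `^ (g - 1)).
  have -> : y `^ (g - (1 - alpha)) = y `^ (g - 1) * y `^ alpha.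
    by rewrite -powR_addn//; congr (_ `^ _); lra.
  have -> : z `^ (1 - alpha) = z * z `^ (- alpha).
    by rewrite powR_addn// (powRr1 (ltW z0)).
  by rewrite /q powR_div//; lra.
have c0 := increment_cst_ge0.
have w0 : 0 <= z * y `^ (g - 1) by rewrite mulr_ge0 ?powR_ge0// ltW.
apply: (@le_trans _ _ (4 * q `^ alpha * (increment_cst * (z * y `^ (g - 1))))).
  by apply: ler_wpM2r K4; exact: mulr_ge0.
rewrite le_eqVlt; apply/orP; left; apply/eqP; lra.
Qed.

(** Tested with [x `^ (g - 2)], a pair contributes at most a multiple of the power
[1 - alpha] of its smaller element times the power [g - (1 - alpha)] of the
larger one, and the moment of order [1 - alpha] is at most 2. *)
Lemma moment_step (eps : R) (v : R -> R) : 0 <= eps <= 1 ->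
  near_profile alpha eps v ->
  (moment v (fun x => x `^ g)%R <=
    (16 * increment_cst)%:E * moment v (fun x => x `^ (g - (1 - alpha)))%R)%E.
Proof.
have gg := g1; have /andP[a0 a1] := alpha01.
move=> eps01 np; have /andP[eps0 _] := eps01; have vd := np_density np.
have mpsi : measurable_fun setT (fun x : R => x `^ (g - 2)) by meas.
have HPsi (y z : R) : 0 < y -> 0 < z ->
    (\int[mu]_(x in `]y, (y + z)%R[) (x `^ (g - 2))%:E = (increment y z)%:E)%E.
  move=> y0 z0; have c1 : g - 2 != -1 by rewrite gt_eqF//; lra.
  have := integral_powR_shift (lexx 0) c1 y0 z0.
  rewrite !addr0 (_ : g - 2 + 1 = g - 1); last by lra.
  by under [in X in X = _ -> _]eq_integral do rewrite addr0.
have inc0 (y z : R) : 0 < y -> 0 < z -> 0 <= increment y z.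
  move=> y0 z0; rewrite -lee_fin -HPsi//; apply: integral_ge0 => x _.
  by rewrite lee_fin powR_ge0.
have := np_test_upper eps0 np mpsi (fun x => powR_ge0 _ _) HPsi.
have -> : moment v (fun x => x `^ (g - 2) * x ^+ 2) = moment v (fun x => x `^ g).
  apply: (eq_moment vd) => x x0; rewrite -powR_mulrn; last exact: ltW.
  by rewrite -powR_addn// subrK.
move=> h; apply: le_trans h _.
set A := fun x : R => x `^ (1 - alpha); set B := fun x : R => x `^ (g - (1 - alpha)).
have c0 := increment_cst_ge0.
have mA : measurable_fun setT A by rewrite /A; meas.
have mB : measurable_fun setT B by rewrite /B; meas.
have pA : nonneg_on A by move=> x _; exact: powR_ge0.
have pB : nonneg_on B by move=> x _; exact: powR_ge0.
pose c := 4 * increment_cst.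
have cc0 : 0 <= c by rewrite mulr_ge0.
have mF : measurable2 (fun y z => (2 + eps * sing_kernel alpha y z) * increment y z * y).
  by rewrite /measurable2 /sing_kernel /increment; meas.
have pF : nonneg_on2 (fun y z => (2 + eps * sing_kernel alpha y z) * increment y z * y).
  move=> y z y0 z0; apply: mulr_ge0 (ltW y0); apply: mulr_ge0 (inc0 _ _ y0 z0).
  by rewrite addr_ge0// mulr_ge0// sing_kernel_ge0.
have mcA : measurable_fun setT (fun x => c * A x) by rewrite /A; meas.
have mcB : measurable_fun setT (fun x => c * B x) by rewrite /B; meas.
have pcA : nonneg_on (fun x => c * A x) by move=> x _; rewrite mulr_ge0 ?powR_ge0.
have pcB : nonneg_on (fun x => c * B x) by move=> x _; rewrite mulr_ge0 ?powR_ge0.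
have mG1 : measurable2 (fun y z => c * A y * B z).
  by rewrite /measurable2 /A /B; meas.
have mG2 : measurable2 (fun y z => c * B y * A z).
  by rewrite /measurable2 /A /B; meas.
have pG1 : nonneg_on2 (fun y z => c * A y * B z).
  by move=> y z y0 z0; exact: mulr_ge0 (pcA _ y0) (pB _ z0).
have pG2 : nonneg_on2 (fun y z => c * B y * A z).
  by move=> y z y0 z0; exact: mulr_ge0 (pcB _ y0) (pA _ z0).
have mG : measurable2 (fun y z => c * A y * B z + c * B y * A z).
  exact: measurable_funD mG1 mG2.
have ineq (y z : R) : 0 < y -> 0 < z ->
    (2 + eps * sing_kernel alpha y z) * increment y z * y <=
    c * A y * B z + c * B y * A z.
  move=> y0 z0; have K0 : 0 <= 2 + eps * sing_kernel alpha y z.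
    by rewrite addr_ge0// mulr_ge0// sing_kernel_ge0.
  rewrite -mulrA; have [zy|yz] := leP z y.
    apply: le_trans (ler_wpM2l K0 (increment_le_small z0 zy)) _.
    apply: le_trans (kernel_increment_le eps01 z0 zy) _.
    have := pG1 _ _ y0 z0; rewrite /c /A /B => ?; lra.
  apply: le_trans (ler_wpM2l K0 (increment_le_large y0 (ltW yz))) _.
  rewrite (_ : sing_kernel alpha y z = sing_kernel alpha z y); last first.
    by rewrite /sing_kernel addrC.
  apply: le_trans (kernel_increment_le eps01 y0 (ltW yz)) _.
  have := pG2 _ _ y0 z0; rewrite /c /A /B => ?; lra.
apply: le_trans (le_moment2 vd mF mG pF ineq) _.
rewrite (moment2D vd mG1 mG2 pG1 pG2) (moment2_prod vd mcA mB pcA pB) (moment2_prod vd mcB mA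
  pcB pA).
rewrite (momentZ vd mA cc0 pA) (momentZ vd mB cc0 pB).
have b01 : 0 <= 1 - alpha <= 1 by apply/andP; split; lra.
have [Ae /andP[A0 A2]] := np_moment_le2 np b01.
rewrite -/A in Ae A0 A2; rewrite Ae.
have B0 := moment_ge0 vd pB.
set b := moment v B in B0 *.
rewrite [(_ * b * _)%E]muleAC -EFinM -ge0_muleDl ?lee_fin ?mulr_ge0//.
rewrite -EFinD; apply: lee_wpmul2r => //; rewrite lee_fin.
have : 0 <= c * (2 - rmoment v A) by rewrite mulr_ge0// subr_ge0.
by rewrite /c; lra.
Qed.

End increment.

(** Starting from the mass, [moment_step] raises the order by [1 - alpha] at a
time. *)
Lemma moment_ladder (k : nat) : exists C : R, forall (eps : R) (v : R -> R),
  0 <= eps <= 1 -> near_profile alpha eps v ->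
  (moment v (fun x => x `^ (1 + k%:R * (1 - alpha)))%R <= C%:E)%E.
Proof.
have /andP[a0 a1] := alpha01.
elim: k => [|k [C IH]].
  exists 1 => eps v _ np; have vd := np_density np.
  rewrite -(np_mass np) le_eqVlt; apply/orP; left; apply/eqP.
  apply: (eq_moment vd) => x x0.
  by rewrite mul0r addr0 (powRr1 (ltW x0)).
pose g : R := 1 + k.+1%:R * (1 - alpha).
have g1 : 1 < g by rewrite /g ltrDl mulr_gt0 ?ltr0Sn// subr_gt0.
exists (16 * increment_cst g * C) => eps v eps01 np.
apply: le_trans (moment_step g1 eps01 np) _.
rewrite [leRHS]EFinM; apply: lee_wpmul2l.
  by rewrite lee_fin mulr_ge0// increment_cst_ge0.
have -> : g - (1 - alpha) = 1 + k%:R * (1 - alpha) by rewrite /g -natr1; lra.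
exact: IH eps01 np.
Qed.

Lemma high_moment (b : R) : 0 <= b -> exists C : R, forall (eps : R) (v : R -> R),
  0 <= eps <= 1 -> near_profile alpha eps v ->
  (moment v (fun x => x `^ b)%R <= C%:E)%E.
Proof.
have /andP[a0 a1] := alpha01.
move=> b0; have a10 : 0 < 1 - alpha by lra.
have q0 : 0 <= b / (1 - alpha) by rewrite divr_ge0// ltW.
pose k := Num.bound (b / (1 - alpha)).
have hk : b <= 1 + k%:R * (1 - alpha).
  by have := archi_boundP q0; rewrite -/k ltr_pdivrMr//; lra.
have [C HC] := moment_ladder k.
exists (1 + C) => eps v eps01 np; have vd := np_density np.
have m1 : measurable_fun setT (fun _ : R => 1 : R) by exact: measurable_cst.
have p1 : nonneg_on (fun _ : R => 1 : R) by move=> ? _; exact: ler01.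
have mg : measurable_fun setT (fun x : R => x `^ (1 + k%:R * (1 - alpha))) by meas.
have pg : nonneg_on (fun x : R => x `^ (1 + k%:R * (1 - alpha))).
  by move=> x _; exact: powR_ge0.
apply: (@le_trans _ _ (moment v (fun x => 1 + x `^ (1 + k%:R * (1 - alpha))))).
  apply: (le_moment vd); [by meas|exact: measurable_funD m1 mg| |].
    by move=> x _; exact: powR_ge0.
  move=> x x0; have [x1|x1] := leP x 1.
    have : x `^ b <= x `^ 0 by apply: ger_powR => //; rewrite x0.
    rewrite powRr0; have := pg _ x0; lra.
  have := ler_powR (ltW x1) hk; lra.
rewrite (momentD vd m1 mg p1 pg) EFinD; apply: leeD; first exact: np_M0_le1 np.
exact: HC eps01 np.
Qed.

End high_moments.

(** * The flux of the constant kernel in terms of tails *)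

Section flux_estimate.
Context {R : realType}.
Notation mu := (@lebesgue_measure R).

Section tails.
Variable v : R -> R.
Hypothesis vd : nonneg_density v.
Hypothesis M1 : (moment v (fun=> 1%R) <= 1)%E.

Lemma unit_valued_above (t : R) : unit_valued (fun x : R => if t < x then 1 else 0).
Proof. by split; [meas|move=> x _; case: ifP; rewrite lexx ler01]. Qed.

Lemma unit_valued_between (s t : R) :
  unit_valued (fun x : R => if (s < x) && (x < t) then 1 else 0).
Proof. by split; [meas|move=> x _; case: ifP; rewrite lexx ler01]. Qed.

Lemma tail_moment (t : R) : moment v (fun x => if t < x then 1 else 0) = (tail v t)%:E.
Proof. by have [] := rmoment_bounded vd M1 (unit_valued_above t). Qed.

Lemma tail_le (s t : R) : s <= t -> tail v t <= tail v s.
Proof.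
move=> st; rewrite /tail.
apply: (le_rmoment vd M1 (unit_valued_above t) (unit_valued_above s)) => x _.
by case: ltP => tx; case: ltP => sx //; move: (le_lt_trans st tx); rewrite ltNge sx.
Qed.

Lemma measurable_tail : measurable_fun setT (tail v).
Proof.
apply: nonincreasing_measurable; first exact: measurableT.
exact: tail_le.
Qed.

Lemma rmoment_between (s t : R) : s < t ->
  rmoment v (fun x => if (s < x) && (x < t) then 1 else 0) = tail v s - tail v t.
Proof.
move=> st; have [mv v0 vn] := vd.
have m1 : measurable_fun setT (fun x : R => if (s < x) && (x < t) then 1 else 0 : R).
  exact: (unit_valued_between s t).1.
have p1 : nonneg_on (fun x : R => if (s < x) && (x < t) then 1 else 0 : R).
  by move=> x _; case: ifP.
have m2 : measurable_fun setT (fun x : R => if t <= x then 1 else 0 : R) by meas.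
have p2 : nonneg_on (fun x : R => if t <= x then 1 else 0 : R).
  by move=> x _; case: ifP.
have e : moment v (fun x => if t <= x then 1 else 0) = (tail v t)%:E.
  rewrite -tail_moment /moment.
  have h (b : bool) : (\int[mu]_(x in [set` Interval (BSide b t) +oo%O]) (v x)%:E =
    \int[mu]_x ((if x \in Interval (BSide b t) +oo%O then 1 else 0) * v x)%:E)%E.
    rewrite integral_itv_if; apply: eq_integral => x _.
    by case: ifP => _; rewrite ?mul1r ?mul0r.
  have h1 := h true; have h2 := h false.
  have e1 : (\int[mu]_(x in `[t, +oo[) (v x)%:E = \int[mu]_(x in `]t, +oo[) (v x)%:E)%E.
    rewrite integral_itv_obnd_cbnd//; apply/measurable_EFinP.
    exact: measurable_funTS.
  rewrite e1 h2 in h1.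
  transitivity (\int[mu]_x ((if x \in `[t, +oo[ then 1 else 0) * v x)%:E)%E.
    by apply: eq_integral => x _; rewrite in_itv/= andbT.
  rewrite -h1; apply: eq_integral => x _; by rewrite in_itv/= andbT.
have [e1 _] := rmoment_bounded vd M1 (unit_valued_between s t).
have : moment v (fun x => if s < x then 1 else 0) =
  moment v (fun x => (if (s < x) && (x < t) then 1 else 0) + (if t <= x then 1 else 0)).
  apply: (eq_moment vd) => x _.
  case: ltP => sx /=; case: ltP => tx; rewrite ?addr0 ?add0r//.
  by move: (lt_le_trans st tx); rewrite ltNge sx.
rewrite (momentD vd m1 m2 p1 p2) e e1 tail_moment -EFinD => -[->].
by rewrite addrK.
Qed.

(** The flux of the constant kernel [1] once the tail of [v] at [x - y] is replaced
by [e^{-(x - y)}]. *)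
Definition expint (x : R) : \bar R :=
  moment v (fun y => if y < x then y * expR (y - x) else 0).

Lemma flux2E (x : R) :
  flux (fun _ _ => 2) v x = moment v (fun y => if y < x then 2 * y * tail v (x - y) else 0).
Proof.
have [mv v0 vn] := vd.
rewrite /flux /moment; apply: eq_integral => y _.
have [y0|y0] := leP y 0.
  rewrite integral0_eq => [|z _]; first by rewrite (vn _ y0) mulr0.
  by rewrite (vn _ y0) mulr0 mul0r mulr0 if_same.
case: ltP => yx /=; last by rewrite mul0r integral0.
have c0 : 0 <= 2 * y * v y by rewrite !mulr_ge0// ltW.
rewrite mulrAC EFinM -tail_moment /moment -ge0_integralZl//.
- apply: eq_integral => z _; rewrite -EFinM ltrBlDl; congr (_%:E).
  by case: ifP => _; lra.
- by apply: measurable_moment => //; exact: (unit_valued_above (x - y)).1.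
- by move=> z _; rewrite lee_fin; apply: mulr_ge0 => //; case: ifP.
Qed.

Hypothesis mass : (moment v id = 1)%E.
Variable eta : R.
Hypothesis eta0 : 0 <= eta.
Hypothesis gap : forall t, 0 <= t -> `|tail v t - expR (- t)| <= eta.

Let mflux (x : R) : measurable_fun setT
  (fun y : R => if y < x then 2 * y * tail v (x - y) else 0).
Proof. by have mt := measurable_tail; meas. Qed.

Let pflux (x : R) : nonneg_on
  (fun y : R => if y < x then 2 * y * tail v (x - y) else 0).
Proof.
move=> y y0; case: ifP => // _; rewrite mulr_ge0//; first by rewrite mulr_ge0// ltW.
by have [_ /andP[]] := rmoment_bounded vd M1 (unit_valued_above (x - y)).
Qed.

Let mexp (x : R) : measurable_fun setT
  (fun y : R => if y < x then y * expR (y - x) else 0).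
Proof. by meas. Qed.

Let pexp (x : R) : nonneg_on
  (fun y : R => if y < x then y * expR (y - x) else 0).
Proof. by move=> y y0; case: ifP => // _; rewrite mulr_ge0 ?expR_ge0// ltW. Qed.

Let mid : measurable_fun setT (fun x : R => x). Proof. exact: measurable_id. Qed.
Let pid : nonneg_on (fun x : R => x). Proof. by move=> x /ltW. Qed.

Lemma flux2_le_expint (x : R) :
  (flux (fun _ _ => 2%R) v x <= 2%:E * expint x + (2 * eta)%:E)%E.
Proof.
have e20 : 0 <= 2 * eta by rewrite mulr_ge0.
have h2 : (0 : R) <= 2 by [].
have m1 : measurable_fun setT (fun y : R => 2 * eta * y) by meas.
have p1 : nonneg_on (fun y : R => 2 * eta * y) by move=> y /ltW y0; rewrite mulr_ge0.
have m2 : measurable_fun setT (fun y : R => 2 * (if y < x then y * expR (y - x) else 0)) by meas.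
have p2 : nonneg_on (fun y : R => 2 * (if y < x then y * expR (y - x) else 0)).
  by move=> y y0; rewrite mulr_ge0// pexp.
rewrite flux2E /expint -(momentZ vd (@mexp x) h2 (@pexp x)).
rewrite -[X in (_ + X)%E]mule1 -mass -(momentZ vd mid e20 pid) -(momentD vd m2 m1 p2 p1).
apply: (le_moment vd (@mflux x) _ (@pflux x)); first exact: measurable_funD m2 m1.
move=> y y0; case: ltP => yx; last by rewrite mulr0 add0r p1.
have t0 : 0 <= x - y by rewrite subr_ge0 ltW.
have := gap t0; rewrite ler_norml opprB => /andP[_ h].
have : 0 <= 2 * y * (expR (y - x) + eta - tail v (x - y)).
  by rewrite mulr_ge0//; [rewrite mulr_ge0// ltW|lra].
lra.
Qed.

Lemma expint_le_flux2 (x : R) :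
  (2%:E * expint x <= flux (fun _ _ => 2%R) v x + (2 * eta)%:E)%E.
Proof.
have e20 : 0 <= 2 * eta by rewrite mulr_ge0.
have h2 : (0 : R) <= 2 by [].
have m1 : measurable_fun setT (fun y : R => 2 * eta * y) by meas.
have p1 : nonneg_on (fun y : R => 2 * eta * y) by move=> y /ltW y0; rewrite mulr_ge0.
have m2 : measurable_fun setT (fun y : R => 2 * (if y < x then y * expR (y - x) else 0)) by meas.
have p2 : nonneg_on (fun y : R => 2 * (if y < x then y * expR (y - x) else 0)).
  by move=> y y0; rewrite mulr_ge0// pexp.
rewrite flux2E /expint -(momentZ vd (@mexp x) h2 (@pexp x)).
rewrite -[X in (_ + X)%E]mule1 -mass -(momentZ vd mid e20 pid) -(momentD vd (@mflux x) m1
  (@pflux x) p1).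
apply: (le_moment vd m2 _ p2); first exact: measurable_funD (@mflux x) m1.
move=> y y0; case: ltP => yx; last by rewrite mulr0 add0r p1.
have t0 : 0 <= x - y by rewrite subr_ge0 ltW.
have := gap t0; rewrite ler_norml opprB => /andP[h _].
have : 0 <= 2 * y * (tail v (x - y) + eta - expR (y - x)).
  by rewrite mulr_ge0//; [rewrite mulr_ge0// ltW|lra].
lra.
Qed.

End tails.

(** The derivative of [s * e^{s - x}] with respect to [s]. *)
Definition expw (x s : R) : R := (1 + s) * expR (s - x).

Lemma integral_expw (x y : R) : 0 < y ->
  (\int[mu]_(s in `]0%R, y[) (expw x s)%:E = (y * expR (y - x))%:E)%E.
Proof.
move=> y0; have -> : y * expR (y - x) = y * expR (y - x) - 0 * expR (0 - x).
  by rewrite mul0r subr0.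
apply: (@integral_itvoo_primitive R (expw x) (fun y => y * expR (y - x))) => //.
- by move=> s _; apply: is_derive_eq; rewrite /GRing.scale/= /expw; lra.
- by move=> s _; rewrite /expw; exact: is_derive_continuous.
Qed.

(** Integration by parts in the form of an exchange of integrals: [expint] depends on
[v] through its tails only, and therefore passes to the limit when these
converge uniformly. *)
Lemma expintE (v : R -> R) (x : R) : nonneg_density v ->
  (moment v (fun=> 1%R) <= 1)%E ->
  expint v x = (\int[mu]_(s in `]0%R, x[) (expw x s * (tail v s - tail v x))%:E)%E.
Proof.
move=> vd M1; have [mv v0 vn] := vd.
pose H (p : R * R) : R := if (0 < p.1) && ((p.1 < p.2) && (p.2 < x)) then expw x p.1 * v p.2 else 0.
have w0 (s : R) : 0 < s -> 0 <= expw x s by move=> s0; rewrite mulr_ge0 ?expR_ge0// addr_ge0// ltW.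
have H0 p : 0 <= H p.
  by rewrite /H; case: ifP => // /andP[s0 _]; rewrite mulr_ge0// w0.
have mH : measurable_fun setT (EFin \o H).
  by apply/measurable_EFinP; rewrite /H /expw; meas.
transitivity (\int[mu]_y \int[mu]_s (EFin \o H) (s, y))%E.
  apply: eq_integral => y _; rewrite /H/=.
  have [y0|y0] := leP y 0.
    rewrite [RHS]integral0_eq => [|s _]; first by rewrite (vn _ y0) mulr0.
    by rewrite (vn _ y0) mulr0 if_same.
  case: ltP => yx; last first.
    by rewrite mul0r [RHS]integral0_eq// => s _; rewrite !andbF.
  rewrite EFinM -(integral_expw x y0) integral_itv_if.
  under eq_integral do rewrite in_itv/=.
  rewrite -ge0_integralZr//.
  - apply: eq_integral => s _; rewrite andbT.
    by case: ifP => _; rewrite ?mul0e// -EFinM.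
  - apply: measurable_fun_ifT; [by meas| |exact: measurable_cst].
    by rewrite /expw; meas.
  - by move=> s _; case: ifP => // /andP[s0 _]; rewrite lee_fin w0.
  - by rewrite lee_fin.
have H0e p : (0 <= (EFin \o H) p)%E by rewrite lee_fin.
transitivity (\int[mu]_s \int[mu]_y (EFin \o H) (s, y))%E.
  exact: esym (@fubini_tonelli _ _ _ _ _ mu mu _ mH H0e).
rewrite integral_itv_if; apply: eq_integral => s _; rewrite in_itv/= /H/=.
have [s0|s0] /= := leP s 0; first by rewrite integral0.
case: ltP => sx; last first.
  rewrite integral0_eq// => y _; case: ifP => // /andP[sy yx].
  by move: (lt_trans sy yx); rewrite ltNge sx.
have [e _] := rmoment_bounded vd M1 (unit_valued_between s x).
rewrite -(rmoment_between vd M1 sx) EFinM -e /moment -ge0_integralZl//.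
- by apply: eq_integral => y _; rewrite -EFinM; congr (_%:E); case: ifP => _; lra.
- by apply: measurable_moment => //; exact: (unit_valued_between s x).1.
- by move=> y _; rewrite lee_fin; apply: mulr_ge0 => //; case: ifP.
- by rewrite lee_fin w0.
Qed.

End flux_estimate.

(** * Closeness in L1 away from zero and infinity *)

Section interior.
Context {R : realType}.
Notation mu := (@lebesgue_measure R).

Lemma expint_le (v w : R -> R) (eta x : R) :
  nonneg_density v -> (moment v (fun=> 1%R) <= 1)%E ->
  nonneg_density w -> (moment w (fun=> 1%R) <= 1)%E ->
  0 <= eta -> (forall t, 0 <= t -> `|tail v t - tail w t| <= eta) -> 0 < x ->
  (expint v x <= expint w x + (2 * eta * x)%:E)%E.
Proof.
move=> vd v1 wd w1 eta0 gap x0.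
have mv := measurable_tail vd v1; have mw := measurable_tail wd w1.
have e : (2 * eta * x)%:E = (\int[mu]_(s in `]0%R, x[) (2 * eta * expw x s)%:E)%E.
  transitivity ((2 * eta)%:E * \int[mu]_(s in `]0%R, x[) (expw x s)%:E)%E.
    by rewrite integral_expw// subrr expR0 mulr1 EFinM.
  rewrite -ge0_integralZl//.
  - by apply/measurable_EFinP; apply: measurable_funTS; rewrite /expw; meas.
  - move=> s; rewrite /= in_itv/= => /andP[s0 _].
    by rewrite lee_fin mulr_ge0 ?expR_ge0// addr_ge0// ltW.
  - by rewrite lee_fin mulr_ge0.
rewrite !expintE// e -ge0_integralD//.
- apply: ge0_le_integral => //.
  + move=> s; rewrite /= in_itv/= => /andP[s0 sx].
    rewrite lee_fin; apply: mulr_ge0; first by rewrite mulr_ge0 ?expR_ge0// addr_ge0// ltW.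
    by rewrite subr_ge0; apply: tail_le => //; exact: ltW.
  + by apply/measurable_EFinP; apply: measurable_funTS; rewrite /expw; meas.
  + apply: emeasurable_funD; apply/measurable_EFinP; apply: measurable_funTS; rewrite /expw; meas.
  + move=> s; rewrite /= in_itv/= => /andP[s0 sx].
    rewrite -EFinD lee_fin.
    have W0 : 0 <= expw x s by rewrite mulr_ge0 ?expR_ge0// addr_ge0// ltW.
    have := gap _ (ltW s0); have := gap _ (ltW x0).
    rewrite !ler_norml => /andP[h1 _] /andP[_ h2].
    have : 0 <= expw x s * (tail w s - tail w x + 2 * eta - (tail v s - tail v x)).
      by rewrite mulr_ge0//; lra.
    lra.
- move=> s; rewrite /= in_itv/= => /andP[s0 sx].
  rewrite lee_fin; apply: mulr_ge0; first by rewrite mulr_ge0 ?expR_ge0// addr_ge0// ltW.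
  by rewrite subr_ge0; apply: tail_le => //; exact: ltW.
- by apply/measurable_EFinP; apply: measurable_funTS; rewrite /expw; meas.
- move=> s; rewrite /= in_itv/= => /andP[s0 sx].
  rewrite lee_fin; apply: mulr_ge0; first exact: mulr_ge0.
  by rewrite mulr_ge0 ?expR_ge0// addr_ge0// ltW.
- by apply/measurable_EFinP; apply: measurable_funTS; rewrite /expw; meas.
Qed.

Lemma tail_exp (t : R) : 0 <= t -> tail exp_density t = expR (- t).
Proof. by move=> t0; rewrite /tail /rmoment moment_exp_tail. Qed.

(** The tails of [e^{-x}] are exact, so the comparison of the flux with [expint]
holds without error. *)
Lemma flux2_exp_expint (x : R) :
  (2%:E * expint exp_density x = (x ^+ 2 * exp_density x)%:E)%E.
Proof.
have ed := @nonneg_exp_density R.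
have e1 : (moment (@exp_density R) (fun=> 1%R) <= 1)%E by rewrite exp_M0.
have gap (t : R) : 0 <= t -> `|tail exp_density t - expR (- t)| <= 0.
  by move=> t0; rewrite tail_exp// subrr normr0.
rewrite -flux_exp; apply/eqP; rewrite eq_le; apply/andP; split.
  have := expint_le_flux2 ed e1 exp_mass (lexx 0) gap x.
  by rewrite mulr0 adde0.
have := flux2_le_expint ed e1 exp_mass (lexx 0) gap x.
by rewrite mulr0 adde0.
Qed.

Section profile.
Variables (alpha eps : R) (v : R -> R).
Hypothesis alpha01 : 0 < alpha < 1.
Hypothesis eps0 : 0 <= eps.
Hypothesis np : near_profile alpha eps v.
Let vd := np_density np.
Let mass := np_mass np.
Let M1 := np_M0_le1 np.
Variable eta : R.
Hypothesis eta0 : 0 <= eta.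
Hypothesis gap : forall t, 0 <= t -> `|tail v t - expR (- t)| <= eta.

Let gap' (t : R) : 0 <= t -> `|tail v t - tail exp_density t| <= eta.
Proof. by move=> t0; rewrite tail_exp// gap. Qed.

Lemma flux2_upper (x : R) : 0 < x ->
  (flux (fun _ _ => 2%R) v x <=
    (x ^+ 2 * exp_density x + (2 * eta + 4 * eta * x))%:E)%E.
Proof.
move=> x0; apply: le_trans (flux2_le_expint vd M1 mass eta0 gap x) _.
have ed := @nonneg_exp_density R.
have e1 : (moment (@exp_density R) (fun=> 1%R) <= 1)%E by rewrite exp_M0.
have h := expint_le vd M1 ed e1 eta0 gap' x0.
apply: (@le_trans _ _ (2%:E * (expint exp_density x + (2 * eta * x)%:E) + (2 * eta)%:E)%E).
  by rewrite leeD2r// lee_wpmul2l// lee_fin.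
rewrite ge0_muleDr ?lee_fin ?mulr_ge0//; last 2 first.
- apply: moment_ge0 => // y y0; case: ifP => // _.
  by rewrite mulr_ge0 ?expR_ge0// ltW.
- exact: ltW.
rewrite flux2_exp_expint -EFinM -!EFinD lee_fin; lra.
Qed.

Lemma flux2_lower (x : R) : 0 < x ->
  ((x ^+ 2 * exp_density x)%:E <=
    flux (fun _ _ => 2%R) v x + (2 * eta + 4 * eta * x)%:E)%E.
Proof.
move=> x0.
have ed := @nonneg_exp_density R.
have e1 : (moment (@exp_density R) (fun=> 1%R) <= 1)%E by rewrite exp_M0.
have gap2 (t : R) : 0 <= t -> `|tail exp_density t - tail v t| <= eta.
  by move=> t0; rewrite distrC gap'.
have h := expint_le ed e1 vd M1 eta0 gap2 x0.
rewrite -flux2_exp_expint.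
apply: (@le_trans _ _ (2%:E * (expint v x + (2 * eta * x)%:E))%E).
  by rewrite lee_wpmul2l// lee_fin.
rewrite ge0_muleDr ?lee_fin ?mulr_ge0//; last 2 first.
- apply: moment_ge0 => // y y0; case: ifP => // _.
  by rewrite mulr_ge0 ?expR_ge0// ltW.
- exact: ltW.
apply: le_trans (leeD2r _ (expint_le_flux2 vd M1 mass eta0 gap x)) _.
rewrite -EFinM -addeA -EFinD leeD2l// lee_fin; lra.
Qed.

Lemma flux_kernelD (x : R) :
  flux (fun y z => 2 + eps * sing_kernel alpha y z) v x =
  (flux (fun _ _ => 2%R) v x + eps%:E * flux (sing_kernel alpha) v x)%E.
Proof.
have [mv v0 vn] := vd.
have k20 : nonneg_on2 (fun _ _ : R => 2 : R) by [].
have kV0 : nonneg_on2 (sing_kernel alpha) by move=> y z _ _; exact: sing_kernel_ge0.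
pose G k (y z : R) : R := if (y < x) && (x < y + z) then k y z * (y * v y * v z) else 0.
have G0 k y z : nonneg_on2 k -> 0 <= G k y z.
  by move=> k0; exact: flux_integrand_ge0.
have mG k : measurable2 k -> measurable2 (G k).
  move=> mk; rewrite /measurable2 /G; apply: measurable_fun_ifT; first by meas.
    by apply: measurable_funM => //; meas.
  exact: measurable_cst.
have mk2 : measurable2 (fun _ _ : R => 2 : R) by exact: measurable_cst.
have mkV := @measurable_sing_kernel R alpha.
have sec k y : measurable2 k -> measurable_fun setT (fun z => (G k y z)%:E).
  move=> /mG h; apply/measurable_EFinP.
  exact: (measurableT_comp h (pair1_measurable y)).
have inn k : measurable2 k -> nonneg_on2 k ->
    measurable_fun setT (fun y => \int[mu]_z (G k y z)%:E)%E.
  by move=> /mG h k0; apply: (measurable_fun_integral h) => y z; exact: G0.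
rewrite /flux -ge0_integralZl ?lee_fin//; last 2 first.
- exact: (inn _ mkV kV0).
- by move=> y _; apply: integral_ge0 => z _; rewrite lee_fin; exact: (G0 _ y z kV0).
rewrite -ge0_integralD//; last 4 first.
- by move=> y _; apply: integral_ge0 => z _; rewrite lee_fin; exact: (G0 _ y z k20).
- exact: (inn _ mk2 k20).
- move=> y _; apply: mule_ge0; first by rewrite lee_fin.
  by apply: integral_ge0 => z _; rewrite lee_fin; exact: (G0 _ y z kV0).
- by apply: emeasurable_funM; [exact: measurable_cst|exact: (inn _ mkV kV0)].
apply: eq_integral => y _.
rewrite -ge0_integralZl ?lee_fin//; last 2 first.
- exact: (sec _ y mkV).
- by move=> z _; rewrite lee_fin; exact: (G0 _ y z kV0).
rewrite -ge0_integralD//; last 4 first.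
- by move=> z _; rewrite lee_fin; exact: (G0 _ y z k20).
- exact: (sec _ y mk2).
- by move=> z _; apply: mule_ge0; rewrite lee_fin//; exact: (G0 _ y z kV0).
- by apply: emeasurable_funM; [exact: measurable_cst|exact: (sec _ y mkV)].
apply: eq_integral => z _; rewrite -EFinM -EFinD; congr (_%:E).
by case: ifP => _; lra.
Qed.

(** Integrated over [x], the flux of the singular kernel is the moment of
[y * z * sing_kernel alpha y z] over pairs, whose two terms are products of
moments of orders [1 + alpha] and [1 - alpha]. *)
Lemma integral_flux_sing (C : R) : (moment v (fun x => x `^ (1 + alpha))%R <= C%:E)%E ->
  (\int[mu]_x flux (sing_kernel alpha) v x <= (4 * C)%:E)%E.
Proof.
have /andP[a0 a1] := alpha01.
move=> hC.
have kV0 : nonneg_on2 (sing_kernel alpha) by move=> y z _ _; exact: sing_kernel_ge0.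
have mkV := @measurable_sing_kernel R alpha.
have m1 : measurable_fun setT (fun _ : R => 1 : R) by exact: measurable_cst.
have HPsi (y z : R) : 0 < y -> 0 < z ->
    (\int[mu]_(x in `]y, (y + z)%R[) 1%:E = z%:E)%E.
  move=> y0 z0; rewrite integral_cst//= lebesgue_measure_itv/= lte_fin ltrDl z0.
  by rewrite mul1e EFinD [(y%:E + _)%E]addeC addeK.
have := integral_flux vd mkV kV0 m1 (fun=> ler01) HPsi.
under eq_integral do rewrite mul1e.
move=> ->; set A := fun x : R => x `^ (1 + alpha); set B := fun x : R => x `^ (1 - alpha).
have mA : measurable_fun setT A by rewrite /A; meas.
have mB : measurable_fun setT B by rewrite /B; meas.
have pA : nonneg_on A by move=> x _; exact: powR_ge0.
have pB : nonneg_on B by move=> x _; exact: powR_ge0.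
have mAB : measurable2 (fun y z => A y * B z) by rewrite /measurable2 /A /B; meas.
have mBA : measurable2 (fun y z => B y * A z) by rewrite /measurable2 /A /B; meas.
have pAB : nonneg_on2 (fun y z => A y * B z) by move=> y z _ _; rewrite mulr_ge0 ?powR_ge0.
have pBA : nonneg_on2 (fun y z => B y * A z) by move=> y z _ _; rewrite mulr_ge0 ?powR_ge0.
rewrite -/(moment2 v (fun y z => sing_kernel alpha y z * z * y)).
have -> : moment2 v (fun y z => sing_kernel alpha y z * z * y) =
    moment2 v (fun y z => A y * B z + B y * A z).
  apply: (eq_moment2 vd) => y z y0 z0.
  rewrite /sing_kernel !powR_div// /A /B !powR_addn// !(powRr1 (ltW _))//; lra.
rewrite (moment2D vd mAB mBA pAB pBA) (moment2_prod vd mA mB pA pB) (moment2_prod vd mB mA pB pA).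
have b01 : 0 <= 1 - alpha <= 1 by apply/andP; split; lra.
have [Be /andP[B0 B2]] := np_moment_le2 np b01.
rewrite -/B in Be B0 B2; rewrite Be.
have A0 := moment_ge0 vd pA.
rewrite -/A in hC.
have [Ae /andP[A0' AC]] := rmoment_le vd mA mA pA (fun x _ => lexx _) hC.
rewrite Ae -!EFinM -EFinD lee_fin.
have : 0 <= rmoment v A * (2 - rmoment v B) by rewrite mulr_ge0// subr_ge0.
by move: (rmoment v A) (rmoment v B) AC => p q pC pq; lra.
Qed.

(** On [(kappa, L)] the factor [x ^+ 2] is bounded below and can be divided out of
the equation. The flux of the constant kernel is uniformly close to that of
[e^{-x}], whereas the singular part is small in [L^1] only. *)
Lemma interior_bound (C kappa L : R) : (moment v (fun x => x `^ (1 + alpha))%R <= C%:E)%E ->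
  0 < kappa -> kappa < L ->
  (\int[mu]_x (if (kappa < x) && (x < L) then `|v x - exp_density x| else 0)%:E <=
   (kappa ^- 2 * ((2 * eta + 4 * eta * L) * L + eps * (4 * C)))%:E)%E.
Proof.
move=> hC k0 kL; have [mv v0 vn] := vd; have [me e0 en] := @nonneg_exp_density R.
have L0 : 0 < L by exact: lt_trans kL.
have i0 : 0 <= kappa ^- 2 by rewrite invr_ge0 sqr_ge0.
pose r : R := 2 * eta + 4 * eta * L.
have r0 : 0 <= r by rewrite addr_ge0 ?mulr_ge0// ltW.
have kV0 : nonneg_on2 (sing_kernel alpha) by move=> y z _ _; exact: sing_kernel_ge0.
have mkV := @measurable_sing_kernel R alpha.
pose E (x : R) := flux (sing_kernel alpha) v x.
have mE : measurable_fun setT E := measurable_flux vd mkV kV0.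
have E0 x : (0 <= E x)%E.
  apply: integral_ge0 => y _; apply: integral_ge0 => z _; rewrite lee_fin.
  exact: (flux_integrand_ge0 _ _ _ vd kV0).
have Ee0 x : (0 <= eps%:E * E x)%E by apply: mule_ge0; rewrite ?lee_fin.
pose D (x : R) : R := if (0 < x) && (x < L) then r else 0.
have D0 x : (0 <= (D x)%:E)%E by rewrite lee_fin /D; case: ifP.
have mD : measurable_fun setT (fun x => (D x)%:E) by rewrite /D; meas.
have bound : {ae mu, forall x,
    ((if (kappa < x) && (x < L) then `|v x - exp_density x| else 0)%:E <=
     (kappa ^- 2)%:E * ((D x)%:E + eps%:E * E x))%E}.
  have := np_upper np => hu; have := np_lower np => hl.
  have hul : {ae mu, forall x, (flux (fun _ _ => 2%R) v x <= (x ^+ 2 * v x)%:E)%E /\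
      ((x ^+ 2 * v x)%:E <= flux (fun y z => 2 + eps * sing_kernel alpha y z)%R v x)%E}.
    by apply: filterS2 hl hu => //; exact: (ae_filter_ringOfSetsType mu).
  apply: (ae_imply hul) => x [lo up].
  case: ifP => [/andP[kx xL]|_]; last first.
    by apply: mule_ge0; [rewrite lee_fin|apply: adde_ge0 => //; exact: Ee0].
  have x0 : 0 < x by exact: lt_trans kx.
  have rx : 2 * eta + 4 * eta * x <= r.
    by rewrite lerD2l ler_wpM2l ?mulr_ge0// ltW.
  have -> : D x = r by rewrite /D x0 xL.
  have fU := flux2_upper x0; have fL := flux2_lower x0.
  rewrite flux_kernelD -/(E x) in up.
  have h1 : ((x ^+ 2 * `|v x - exp_density x|)%:E <= r%:E + eps%:E * E x)%E.
    have [ve|ev] := leP (exp_density x) (v x).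
      rewrite ger0_norm ?subr_ge0//.
      have h : ((x ^+ 2 * v x)%:E <= (x ^+ 2 * exp_density x + r)%:E + eps%:E * E x)%E.
        apply: le_trans up _; rewrite leeD2r//; apply: le_trans fU _.
        by rewrite lee_fin lerD2l.
      have -> : (x ^+ 2 * (v x - exp_density x))%:E =
        ((x ^+ 2 * v x)%:E - (x ^+ 2 * exp_density x)%:E)%E.
        by rewrite -EFinB mulrBr.
      by rewrite leeBlDl// addeA -EFinD.
    rewrite ltr0_norm ?subr_lt0//.
    apply: (@le_trans _ _ r%:E); last first.
      by rewrite leeDl// mule_ge0// lee_fin.
    rewrite lee_fin.
    have := le_trans fL (leeD2r _ lo); rewrite -EFinD lee_fin; lra.
  have x20 : 0 < x ^+ 2 by rewrite exprn_gt0.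
  apply: (@le_trans _ _ ((kappa ^- 2)%:E * (x ^+ 2 * `|v x - exp_density x|)%:E)%E).
    rewrite -EFinM lee_fin mulrA ler_peMl// ler_pdivlMl ?exprn_gt0// mulr1.
    by rewrite lerXn2r// ?nnegrE ltW.
  by apply: lee_wpmul2l => //; rewrite lee_fin.
have mEe : measurable_fun setT (fun x => eps%:E * E x)%E.
  by apply: emeasurable_funM => //; exact: measurable_cst.
apply: (@le_trans _ _ (\int[mu]_x ((kappa ^- 2)%:E * ((D x)%:E + eps%:E * E x)))%E).
  apply: ae_ge0_le_integral => //.
  - by move=> x _; rewrite lee_fin; case: ifP.
  - by meas.
  - by move=> x _; rewrite mule_ge0 ?lee_fin// adde_ge0.
  - by apply: emeasurable_funM; [exact: measurable_cst|exact: emeasurable_funD].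
  - by apply: (ae_imply bound) => x h _.
have mS := emeasurable_funD mD mEe.
have S0 x : setT x -> (0 <= (D x)%:E + eps%:E * E x)%E by move=> _; exact: adde_ge0.
have i0' : (0 <= (kappa ^- 2)%:E)%E by rewrite lee_fin.
rewrite (ge0_integralZl mu measurableT mS S0 i0').
rewrite EFinM; apply: lee_wpmul2l; first by rewrite lee_fin.
rewrite ge0_integralD// EFinD; apply: leeD.
  rewrite (_ : (\int[mu]_x _)%E = (\int[mu]_(x in `]0%R, L[) r%:E)%E).
    by rewrite integral_cst//= lebesgue_measure_itv/= lte_fin L0 oppr0 adde0 EFinM.
  rewrite integral_itv_if; apply: eq_integral => x _.
  by rewrite in_itv/= /D; case: ifP.
rewrite ge0_integralZl// ?lee_fin// EFinM; apply: lee_wpmul2l; first by rewrite lee_fin.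
exact: integral_flux_sing.
Qed.

End profile.
End interior.

(** * Profiles as densities on the line *)

Section version.
Context {R : realType}.
Notation mu := (@lebesgue_measure R).

(** The factor may be negative: [u] is nonnegative only almost everywhere, so that
the inner integral of the equation has to be rescaled at every [y]. *)
Lemma integralZl_real (D : set R) (c : R) (f : R -> \bar R) : measurable D ->
  measurable_fun D f -> (forall x, D x -> (0 <= f x)%E) ->
  (\int[mu]_(x in D) (c%:E * f x) = c%:E * \int[mu]_(x in D) f x)%E.
Proof.
move=> mD mf f0; have [c0|c0] := leP 0 c.
  by rewrite ge0_integralZl// lee_fin.
have nc0 : (0 <= (- c)%:E)%E by rewrite lee_fin oppr_ge0 ltW.
rewrite -[c]opprK EFinN mulNe -(ge0_integralZl mu mD mf f0 nc0).
rewrite -integral_ge0N; last by move=> x Dx; rewrite mule_ge0// f0.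
by apply: eq_integral => x _; rewrite mulNe.
Qed.

Lemma le_flux (k k' : R -> R -> R) (v : R -> R) (x : R) : nonneg_density v ->
  measurable2 k -> measurable2 k' -> nonneg_on2 k ->
  (forall y z, 0 < y -> 0 < z -> k y z <= k' y z) ->
  (flux k v x <= flux k' v x)%E.
Proof.
move=> vd mk mk' k0 kk; have [mv v0 vn] := vd.
have k'0 : nonneg_on2 k'.
  by move=> y z y0 z0; exact: le_trans (k0 _ _ y0 z0) (kk _ _ y0 z0).
pose G k (y z : R) : R := if (y < x) && (x < y + z) then k y z * (y * v y * v z) else 0.
have G0 h y z : nonneg_on2 h -> 0 <= G h y z.
  by move=> h0; exact: flux_integrand_ge0.
have mG h : measurable2 h -> measurable2 (G h).
  move=> mh; rewrite /measurable2 /G; apply: measurable_fun_ifT; first by meas.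
    by apply: measurable_funM => //; meas.
  exact: measurable_cst.
have sec h y : measurable2 h -> measurable_fun setT (fun z => (G h y z)%:E).
  move=> /mG mh; apply/measurable_EFinP.
  exact: (measurableT_comp mh (pair1_measurable y)).
have inn h : measurable2 h -> nonneg_on2 h ->
    measurable_fun setT (fun y => \int[mu]_z (G h y z)%:E)%E.
  by move=> /mG mh h0; apply: (measurable_fun_integral mh) => y z; exact: G0.
apply: ge0_le_integral => //.
- by move=> y _; apply: integral_ge0 => z _; rewrite lee_fin; exact: (G0 _ y z k0).
- exact: (inn _ mk k0).
- exact: (inn _ mk' k'0).
move=> y _; apply: ge0_le_integral => //.
- by move=> z _; rewrite lee_fin; exact: (G0 _ y z k0).
- exact: (sec _ y mk).
- exact: (sec _ y mk').
move=> z _; rewrite lee_fin; case: ifP => // _; rewrite -subr_ge0 -mulrBl.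
have [y0|y0] := leP y 0; first by rewrite (vn _ y0) mulr0 mul0r mulr0.
have [z0|z0] := leP z 0; first by rewrite (vn _ z0) !mulr0.
by rewrite !mulr_ge0// ?subr_ge0 ?kk// ltW.
Qed.

Variables (alpha : R) (W : R -> R -> R).
Hypothesis hW : admissible_perturbation alpha W.

(** By homogeneity [W] is a function of [y / z] alone; the joint measurability of the
kernel is inherited from this continuous function of one variable. *)
Definition ratio_kernel (t : R) : R := if 0 < t then W t 1 else 0.

Lemma measurable_ratio_kernel : measurable_fun setT ratio_kernel.
Proof.
pose D : set R := `]0, +oo[%classic.
have -> : ratio_kernel = (fun t => W t 1) \_ D.
  by apply/funext => t; rewrite patchE mem_setE in_itv/= andbT /ratio_kernel.
have mD : measurable D by exact: measurable_itv.
have [mrestrict _] := measurable_restrictT (fun t : R => W t 1) mD; apply: mrestrict.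
have oD : open D by exact: interval_open.
apply: open_continuous_measurable_fun => // t; rewrite inE => Dt.
have t0 : 0 < t by move: Dt; rewrite /D /= in_itv/= andbT.
pose A : set (R * R) := [set p : R * R | 0 < p.1 /\ 0 < p.2].
have oA : open A.
  rewrite (_ : A = (fst @^-1` D) `&` (snd @^-1` D)).
    apply: openI; apply: open_comp => // p _.
      exact: cvg_fst.
    exact: cvg_snd.
  by apply/seteqP; split => p /=; rewrite /D/= !in_itv/= !andbT.
have := perturbation_continuous hW; rewrite -/A (continuous_open_subspace _ oA).
move=> /(_ (t, 1)); rewrite inE => /(_ (conj t0 ltr01)) c.
have c1 : (fun s : R => s) @ t --> t by exact: cvg_id.
have c2 : (fun _ : R => 1 : R) @ t --> (1 : R) by exact: cvg_cst.
exact: (cvg_comp _ _ (cvg_pair c1 c2) c).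
Qed.

Lemma ratio_kernelE (y z : R) : 0 < y -> 0 < z -> W y z = ratio_kernel (y / z).
Proof.
move=> y0 z0; rewrite /ratio_kernel divr_gt0//.
rewrite -(perturbation_homogeneous hW z0 (divr_gt0 y0 z0) ltr01) mulr1.
by rewrite mulrC divfK// gt_eqF.
Qed.

Variables (eps : R) (u : R -> R).
Hypothesis eps0 : 0 <= eps.
Hypothesis hu : self_similar_profile (perturbed_kernel W eps) u.
Hypothesis hu1 : total_mass_one u.

Definition nonneg_version (x : R) : R := if 0 < x then Num.max (u x) 0 else 0.

Let D : set R := `]0, +oo[%classic.

Let mD : measurable D. Proof. exact: measurable_itv. Qed.

Let mu_D : measurable_fun D u.
Proof. by have [] := profile_locally_integrable hu. Qed.

Lemma nonneg_version_density : nonneg_density nonneg_version.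
Proof.
split.
- have -> : nonneg_version = (fun x => Num.max ((u \_ D) x) 0).
    apply/funext => x; rewrite patchE mem_setE in_itv/= andbT /nonneg_version.
    by case: ifP => //; rewrite maxxx.
  have [mrestrict _] := measurable_restrictT u mD.
  have mr := mrestrict mu_D.
  by meas.
- by move=> x; rewrite /nonneg_version; case: ifP => // _; rewrite le_max lexx orbT.
- by move=> x; rewrite leNgt /nonneg_version => /negbTE ->.
Qed.

Lemma nonneg_version_ae : {ae mu, forall x, 0 < x -> u x = nonneg_version x}.
Proof.
apply: (ae_imply (profile_ae_ge0 hu)) => x h x0.
by rewrite /nonneg_version x0 max_l// h.
Qed.

Let kt (y z : R) : R := 2 + eps * ratio_kernel (y / z).

Let mkt : measurable2 kt.
Proof. by have mr := measurable_ratio_kernel; rewrite /measurable2 /kt; meas. Qed.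

Let ktE (y z : R) : 0 < y -> 0 < z -> perturbed_kernel W eps y z = kt y z.
Proof. by move=> y0 z0; rewrite /perturbed_kernel /kt ratio_kernelE. Qed.

Let kt0 : nonneg_on2 kt.
Proof.
move=> y z y0 z0; rewrite -ktE// /perturbed_kernel addr_ge0// mulr_ge0//.
exact: (perturbation_ge0 hW).
Qed.

(** The two functions agree almost everywhere, which suffices in each of the two
nested integrals separately. *)
Lemma equation_flux (x : R) : 0 < x ->
  (\int[mu]_(y in `]0%R, x[) \int[mu]_(z in `](x - y)%R, +oo[)
     (y * perturbed_kernel W eps y z * u y * u z)%:E)%E =
  flux kt nonneg_version x.
Proof.
move=> x0; set v := nonneg_version.
have vd := nonneg_version_density; rewrite -/v in vd; have [mv v0 vn] := vd.
have mr := measurable_ratio_kernel.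
pose F (y z : R) : R := if (x - y < z) && ((0 < y) && (0 < z)) then y * kt y z * v z else 0.
have mF : measurable2 F.
  rewrite /measurable2 /F; apply: measurable_fun_ifT; first by meas.
    by rewrite /kt; meas.
  exact: measurable_cst.
have F0 y z : 0 <= F y z.
  rewrite /F; case: ifP => // /andP[_ /andP[y0 z0]].
  by rewrite mulr_ge0// mulr_ge0 ?kt0// ltW.
pose J (y : R) := (\int[mu]_z (F y z)%:E)%E.
have mJ : measurable_fun setT J by exact: (measurable_fun_integral mF F0).
have inner (y : R) : y \in `]0, x[%classic ->
    (\int[mu]_(z in `](x - y)%R, +oo[)
     (y * perturbed_kernel W eps y z * u y * u z)%:E = (u y)%:E * J y)%E.
  rewrite inE/= in_itv/= => /andP[y0 yx].
  have I0 (z : R) : z \in `]x - y, +oo[ -> 0 < z.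
    by rewrite in_itv/= andbT; apply: le_lt_trans; rewrite subr_ge0 ltW.
  have ID : `]x - y, +oo[%classic `<=` D.
    by move=> z /= /I0 z0; rewrite /D/= in_itv/= andbT.
  have mI : measurable_fun `]x - y, +oo[%classic u by exact: measurable_funS mD ID mu_D.
  have mk : measurable_fun setT (fun z => kt y z).
    exact: (measurableT_comp mkt (pair1_measurable y)).
  transitivity (\int[mu]_(z in `](x - y)%R, +oo[) ((u y)%:E * (y * kt y z * v z)%:E))%E.
    apply: ae_eq_integral => //.
    - apply: (@eq_measurable_fun _ _ _ _ _ (fun z => (y * kt y z * u y * u z)%:E)).
        by move=> z; rewrite inE/= => /I0 z0; rewrite ktE.
      apply/measurable_EFinP; apply: measurable_funM => //.
      by apply: measurable_funTS; rewrite /kt; meas.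
    - apply: measurable_funTS; apply: emeasurable_funM.
        exact: measurable_cst.
      by rewrite /kt; meas.
    - apply: (ae_imply nonneg_version_ae) => z h /= /I0 z0.
      by rewrite (h z0) ktE// -EFinM; congr (_%:E); rewrite -/v; lra.
  rewrite integralZl_real//; last 2 first.
  - by apply: measurable_funTS; rewrite /kt; meas.
  - by move=> z /= /I0 z0; rewrite lee_fin mulr_ge0// mulr_ge0 ?kt0// ltW.
  congr (_ * _)%E; rewrite integral_itv_if; apply: eq_integral => z _.
  rewrite in_itv/= andbT /F y0/=; case: ltP => //= xyz.
  by rewrite I0// in_itv/= xyz.
transitivity (\int[mu]_(y in `]0%R, x[) ((u y)%:E * J y))%E.
  by apply: eq_integral => y yx; exact: inner.
transitivity (\int[mu]_(y in `]0%R, x[) ((v y)%:E * J y))%E.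
  have xD : `]0, x[%classic `<=` D.
    by move=> y /=; rewrite /D/= !in_itv/= andbT => /andP[].
  apply: ae_eq_integral => //.
  - apply: emeasurable_funM; last exact: measurable_funTS.
    by apply/measurable_EFinP; exact: measurable_funS mD xD mu_D.
  - apply: emeasurable_funM; last exact: measurable_funTS.
    by apply/measurable_EFinP; exact: measurable_funTS.
  - apply: (ae_imply nonneg_version_ae) => y h /=; rewrite in_itv/= => /andP[y0 _].
    by rewrite h.
rewrite integral_itv_if; apply: eq_integral => y _; rewrite in_itv/=.
have [y0|y0] /= := leP y 0.
  by rewrite integral0_eq// => z _; rewrite (vn _ y0) mulr0 mul0r mulr0 if_same.
case: ltP => yx /=; last by rewrite integral0.
rewrite -ge0_integralZl//.
- apply: eq_integral => z _; rewrite -EFinM /F ltrBlDl y0/=; congr (_%:E).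
  have [z0|z0] := leP z 0.
    by rewrite (vn _ z0) !(andbF, mulr0) if_same.
  by rewrite andbT; case: ifP => _; lra.
- apply/measurable_EFinP; exact: (measurableT_comp mF (pair1_measurable y)).
- by move=> z _; rewrite lee_fin.
- by rewrite lee_fin.
Qed.

Lemma near_profile_version : near_profile alpha eps nonneg_version.
Proof.
have vd := nonneg_version_density; have [mv v0 vn] := vd.
have eqv : {ae mu, forall x, 0 < x ->
    (x ^+ 2 * nonneg_version x)%:E = flux kt nonneg_version x}.
  have h : {ae mu, forall x, (0 < x -> u x = nonneg_version x) /\
     (0 < x -> (x ^+ 2 * u x)%:E = (\int[mu]_(y in `]0%R, x[)
        \int[mu]_(z in `](x - y)%R, +oo[)
          (y * perturbed_kernel W eps y z * u y * u z)%:E)%E)}.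
    apply: filterS2 nonneg_version_ae (profile_equation hu) => //.
    exact: (ae_filter_ringOfSetsType mu).
  by apply: (ae_imply h) => x [h1 h2] x0; rewrite -equation_flux// -h2// -h1.
have flux0 (k : R -> R -> R) (x : R) : x <= 0 -> flux k nonneg_version x = 0%E.
  move=> x0; rewrite /flux integral0_eq// => y _; rewrite integral0_eq// => z _.
  case: ifP => // /andP[yx _]; have y0 : y <= 0 by exact: ltW (lt_le_trans yx x0).
  by rewrite (vn _ y0) mulr0 mul0r mulr0.
split => //.
- rewrite -hu1 /moment.
  transitivity (\int[mu]_(x in `]0%R, +oo[) (x * nonneg_version x)%:E)%E.
    rewrite integral_itv_if; apply: eq_integral => x _; rewrite in_itv/= andbT.
    by case: ltP => // x0; rewrite vn// mulr0.
  apply: ae_eq_integral => //.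
  - by apply: measurable_funTS; meas.
  - apply/measurable_EFinP; apply: measurable_funM => //.
  - apply: (ae_imply nonneg_version_ae) => x h /=; rewrite in_itv/= andbT => x0.
    by rewrite h.
- apply: (ae_imply eqv) => x h; have [x0|x0] := leP x 0.
    by rewrite flux0// vn// mulr0.
  have m2 : measurable2 (fun _ _ : R => 2 : R) by exact: measurable_cst.
  have p2 : nonneg_on2 (fun _ _ : R => 2 : R) by [].
  rewrite (h x0); apply: (le_flux x vd m2 mkt p2).
  move=> y z y0 z0; rewrite -ktE// /perturbed_kernel lerDl mulr_ge0//.
  exact: (perturbation_ge0 hW).
- apply: (ae_imply eqv) => x h; have [x0|x0] := leP x 0.
    by rewrite flux0// vn// mulr0.
  have mV : measurable2 (fun y z : R => 2 + eps * sing_kernel alpha y z).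
    by rewrite /measurable2 /sing_kernel; meas.
  rewrite (h x0); apply: (le_flux x vd mkt mV kt0).
  move=> y z y0 z0; rewrite -ktE// /perturbed_kernel lerD2l ler_wpM2l//.
  exact: (perturbation_bound hW).
Qed.

End version.

(** * The weighted distance *)

Section weighted.
Context {R : realType}.
Notation mu := (@lebesgue_measure R).
Variables (alpha a b : R).
Hypothesis alpha01 : 0 < alpha < 1.
Hypothesis ha : -1 < a.
Hypothesis hb : 0 < b.

Lemma measurable_weight : measurable_fun setT (weight a b).
Proof. by rewrite /weight; meas. Qed.

Lemma weight_ge0 (x : R) : 0 <= weight a b x.
Proof. by rewrite /weight; case: ifP => _; exact: powR_ge0. Qed.

(** Near 0 a factor [x `^ d] of the weight is small, at infinity [x `^ (-1)] is small,
and in between the weight is bounded. *)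
Lemma weight_split (v w x a1 d kappa L : R) : a1 <= a -> a1 <= 0 -> 0 <= d ->
  0 < kappa -> kappa <= 1 -> 1 <= L -> 0 <= v -> 0 <= w -> 0 < x ->
  `|v - w| * weight a b x <=
    kappa `^ d * (x `^ (a1 - d) * v + x `^ (a1 - d) * w) +
    (kappa `^ a1 + L `^ b) * (if (kappa < x) && (x < L) then `|v - w| else 0) +
    L^-1 * (x `^ (b + 1) * v + x `^ (b + 1) * w).
Proof.
move=> a1a a10 d0 k0 k1 L1 v0 w0 x0; have hb' := hb.
have L0 : 0 < L by exact: lt_le_trans L1.
have vw : `|v - w| <= v + w.
  by rewrite ler_norml; apply/andP; split; lra.
have Pa : 0 <= kappa `^ d * (x `^ (a1 - d) * v + x `^ (a1 - d) * w).
  by rewrite mulr_ge0 ?powR_ge0// addr_ge0// mulr_ge0 ?powR_ge0.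
have Pc : 0 <= L^-1 * (x `^ (b + 1) * v + x `^ (b + 1) * w).
  by rewrite mulr_ge0 ?invr_ge0 ?(ltW L0)// addr_ge0// mulr_ge0 ?powR_ge0.
have Pb : 0 <= (kappa `^ a1 + L `^ b) * (if (kappa < x) && (x < L) then `|v - w| else 0).
  by rewrite mulr_ge0 ?addr_ge0 ?powR_ge0//; case: ifP.
have wx1 : x <= 1 -> x `^ a <= x `^ a1 by move=> x1; apply: ger_powR => //; rewrite x0.
have [xk|kx] := leP x kappa.
  have x1 : x <= 1 by exact: le_trans xk k1.
  have : `|v - w| * weight a b x <= (v + w) * (kappa `^ d * x `^ (a1 - d)).
    apply: ler_pM => //; first exact: weight_ge0.
    rewrite /weight x1; apply: le_trans (wx1 x1) _.
    rewrite {1}(_ : a1 = d + (a1 - d)); last by lra.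
    rewrite powR_addn// ler_wpM2r ?powR_ge0//.
    by apply: ge0_ler_powR; rewrite ?nnegrE// ltW.
  by move: Pb Pc => /=; lra.
have [xL|Lx] := ltP x L.
  have : `|v - w| * weight a b x <= (kappa `^ a1 + L `^ b) * `|v - w|.
    rewrite mulrC ler_wpM2r// /weight; case: (leP x 1) => x1.
      apply: le_trans (wx1 x1) _.
      apply: le_trans (powR_nonincreasing a10 k0 (ltW kx)) _.
      by rewrite lerDl powR_ge0.
    apply: (@le_trans _ _ (L `^ b)); last by rewrite lerDr powR_ge0.
    by apply: ge0_ler_powR; rewrite ?nnegrE; lra.
  by move: Pa Pc => /=; lra.
have : `|v - w| * weight a b x <= (v + w) * (L^-1 * x `^ (b + 1)).
  apply: ler_pM => //; first exact: weight_ge0.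
  have xb : x `^ b <= L^-1 * x `^ (b + 1).
    rewrite powR_addn// (powRr1 (ltW x0)) mulrCA ler_peMr ?powR_ge0//.
    by rewrite ler_pdivlMl// mulr1.
  rewrite /weight; case: (leP x 1) => x1 //.
  have -> : x = 1 by apply/eqP; rewrite eq_le x1 (le_trans L1).
  have -> : L = 1 by apply/eqP; rewrite eq_le L1 andbT (le_trans Lx).
  by rewrite !powR1 invr1 mulr1.
by move: Pa Pb => /=; lra.
Qed.

(** The order of the choices matters: first [kappa] and [L] from the uniform moment
bounds, then the accuracy [eta] of the tails, which also has to satisfy the
hypothesis of [small_moment_bound], and [eps] last. *)
Lemma weighted_distance_small (delta : R) : 0 < delta ->
  exists2 es : R, 0 < es & forall eps v, 0 <= eps <= es ->
    near_profile alpha eps v ->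
    (\int[mu]_x (`|v x - exp_density x| * weight a b x)%:E <= delta%:E)%E.
Proof.
move=> delta0; have /andP[al0 al1] := alpha01; have ha' := ha; have hb' := hb.
(* On (0, 1] the weight is at most x `^ a1, and a1 - d is still above -1. *)
pose a1 := Num.min a 0.
have a1a : a1 <= a by rewrite ge_min lexx.
have a10 : a1 <= 0 by rewrite ge_min lexx orbT.
have a1m : -1 < a1 by rewrite lt_min ha' ltrN10.
pose d := (a1 + 1) / 2.
have d0 : 0 < d by rewrite /d; lra.
have a'1 : -1 < a1 - d <= 0 by apply/andP; split; rewrite /d; lra.
(* The tail at k0 is at least 1 - k0 - eta >= 1 - 2 * k0, which is the threshold
   (3 - (a1 - d)) / 4 of the bound on moments of negative order. *)
pose k0 := (1 + (a1 - d)) / 8.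
have k00 : 0 < k0 by rewrite /k0 /d; lra.
pose K := 2 * k0 `^ (a1 - d - 1) / ((1 + (a1 - d)) / 2).
have K0 : 0 < K.
  by rewrite /K divr_gt0 ?mulr_gt0 ?powR_gt0//; move: a'1 => /andP[]; lra.
have b10 : 0 <= b + 1 by lra.
have [C HC] := high_moment alpha01 b10.
have al10 : 0 <= 1 + alpha by lra.
have [C2 HC2] := high_moment alpha01 al10.
have ne := near_profile_exp alpha; have ed := np_density ne.
have z01 : 0 <= (0 : R) <= 1 by rewrite lexx ler01.
have C0 : 0 <= C.
  rewrite -lee_fin; apply: le_trans (HC _ _ z01 ne).
  by apply: (moment_ge0 ed) => x _; exact: powR_ge0.
have C20 : 0 <= C2.
  rewrite -lee_fin; apply: le_trans (HC2 _ _ z01 ne).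
  by apply: (moment_ge0 ed) => x _; exact: powR_ge0.
pose q := delta / (6 * K).
have q0 : 0 < q by rewrite divr_gt0// mulr_gt0.
pose kappa := Num.min 1 (q `^ d^-1).
have kap0 : 0 < kappa by rewrite lt_min ltr01 powR_gt0.
have kap1 : kappa <= 1 by rewrite ge_min lexx.
have kapd : kappa `^ d * (K + K) <= delta / 3.
  have : kappa `^ d <= q.
    apply: (@le_trans _ _ ((q `^ d^-1) `^ d)).
      apply: ge0_ler_powR; rewrite ?nnegrE ?powR_ge0 ?(ltW d0) ?(ltW kap0)//.
      by rewrite ge_min lexx orbT.
    by rewrite -powRrM mulVf ?(gt_eqF d0)// (powRr1 (ltW q0)).
  have K60 : 0 < 6 * K by apply: mulr_gt0 K0.
  rewrite /q (ler_pdivlMr _ _ K60).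
  by move: (kappa `^ d) (K) => t k; lra.
clearbody kappa.
pose L := Num.max 2 (6 * C / delta).
have L2 : 2 <= L by rewrite le_max lexx.
have L1 : 1 <= L by apply: le_trans L2; lra.
have L0 : 0 < L by apply: lt_le_trans L2; lra.
have kL : kappa < L by apply: le_lt_trans kap1 _; apply: lt_le_trans L2; lra.
have LC : L^-1 * (C + C) <= delta / 3.
  rewrite ler_pdivrMl//.
  have : 6 * C / delta <= L by rewrite le_max lexx orbT.
  by rewrite ler_pdivrMr//; lra.
clearbody L.
pose Wm := kappa `^ a1 + L `^ b.
have Wm0 : 0 < Wm by rewrite /Wm ltr_pwDl ?powR_gt0 ?powR_ge0.
pose G := Wm * kappa ^- 2.
have G0 : 0 < G by rewrite mulr_gt0// invr_gt0 exprn_gt0.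
pose E1 := G * ((2 + 4 * L) * L).
have E10 : 0 < E1 by rewrite mulr_gt0// mulr_gt0//; lra.
pose eta := Num.min k0 (delta / 6 / E1).
have eta0 : 0 < eta by rewrite lt_min k00 divr_gt0// divr_gt0.
have etak : eta <= k0 by rewrite ge_min lexx.
have etaE : E1 * eta <= delta / 6.
  by rewrite mulrC -ler_pdivlMr// ge_min lexx orbT.
have [es1 es10 Hes1] := np_tail_close alpha01 eta0.
pose E2 := G * (4 * C2 + 1).
have E20 : 0 < E2 by rewrite mulr_gt0//; lra.
pose es : R := Num.min 1 (Num.min es1 (delta / 6 / E2)).
exists es.
  by rewrite /es !lt_min ltr01 es10/= divr_gt0// divr_gt0.
move=> eps v /andP[eps0]; rewrite /es !le_min => /and3P[eps1 epses1 epsE2] np.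
have vd := np_density np.
have eps01 : 0 <= eps <= 1 by rewrite eps0.
have gap : forall t, 0 <= t -> `|tail v t - expR (- t)| <= eta.
  by move=> t t0; apply: (Hes1 eps) => //; rewrite eps0.
have gape (t : R) : 0 <= t -> `|tail exp_density t - expR (- t)| <= eta.
  by move=> t0; rewrite tail_exp// subrr normr0 ltW.
have tailk (w : R -> R) : (forall t, 0 <= t -> `|tail w t - expR (- t)| <= eta) ->
    (3 - (a1 - d)) / 4 <= tail w k0.
  move=> /(_ k0 (ltW k00)); rewrite ler_norml => /andP[h _].
  have := expR_ge1Dx (- k0); move: etak h; rewrite /k0.
  by move: (tail _ _) (expR _) => T e; lra.
have Sv := small_moment_bound np a'1 k00 (tailk v gap).
have Se := small_moment_bound ne a'1 k00 (tailk exp_density gape).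
rewrite -/K in Sv Se.
have Hv := HC _ _ eps01 np; have He := HC _ _ z01 ne.
have Iv := interior_bound alpha01 eps0 np (ltW eta0) gap (HC2 _ _ eps01 np) kap0 kL.
have [mv v0 vn] := vd; have [me e0 en] := ed.
have mw := measurable_weight.
pose S1 (x : R) := (x `^ (a1 - d) * v x)%:E; pose S2 (x : R) := (x `^ (a1 - d) * exp_density x)%:E.
pose T1 (x : R) := (x `^ (b + 1) * v x)%:E; pose T2 (x : R) := (x `^ (b + 1) * exp_density x)%:E.
pose I0 (x : R) := (if (kappa < x) && (x < L) then `|v x - exp_density x| else 0)%:E.
have mS1 : measurable_fun setT S1 by rewrite /S1; meas.
have mS2 : measurable_fun setT S2 by rewrite /S2; meas.
have mT1 : measurable_fun setT T1 by rewrite /T1; meas.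
have mT2 : measurable_fun setT T2 by rewrite /T2; meas.
have mI0 : measurable_fun setT I0 by rewrite /I0; meas.
have S10 x : setT x -> (0 <= S1 x)%E by move=> _; rewrite lee_fin mulr_ge0 ?powR_ge0.
have S20 x : setT x -> (0 <= S2 x)%E by move=> _; rewrite lee_fin mulr_ge0 ?powR_ge0.
have T10 x : setT x -> (0 <= T1 x)%E by move=> _; rewrite lee_fin mulr_ge0 ?powR_ge0.
have T20 x : setT x -> (0 <= T2 x)%E by move=> _; rewrite lee_fin mulr_ge0 ?powR_ge0.
have I00 x : setT x -> (0 <= I0 x)%E by move=> _; rewrite lee_fin; case: ifP.
have mS := emeasurable_funD mS1 mS2; have mT := emeasurable_funD mT1 mT2.
have S0 x : setT x -> (0 <= (S1 \+ S2)%E x)%E by move=> _; exact: adde_ge0 (S10 x I) (S20 x I).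
have T0 x : setT x -> (0 <= (T1 \+ T2)%E x)%E by move=> _; exact: adde_ge0 (T10 x I) (T20 x I).
have c1 : (0 <= (kappa `^ d)%:E)%E by rewrite lee_fin powR_ge0.
have c2 : (0 <= Wm%:E)%E by rewrite lee_fin ltW.
have c3 : (0 <= (L^-1)%:E)%E by rewrite lee_fin invr_ge0 ltW.
have mcS : measurable_fun setT (fun x => (kappa `^ d)%:E * (S1 \+ S2) x)%E.
  by apply: emeasurable_funM => //; exact: measurable_cst.
have mcI : measurable_fun setT (fun x => Wm%:E * I0 x)%E.
  by apply: emeasurable_funM => //; exact: measurable_cst.
have mcT : measurable_fun setT (fun x => (L^-1)%:E * (T1 \+ T2) x)%E.
  by apply: emeasurable_funM => //; exact: measurable_cst.
have pcS x : setT x -> (0 <= (kappa `^ d)%:E * (S1 \+ S2)%E x)%E.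
  by move=> _; exact: mule_ge0 c1 (S0 x I).
have pcI x : setT x -> (0 <= Wm%:E * I0 x)%E by move=> _; exact: mule_ge0 c2 (I00 x I).
have pcT x : setT x -> (0 <= (L^-1)%:E * (T1 \+ T2)%E x)%E.
  by move=> _; exact: mule_ge0 c3 (T0 x I).
have mSI := emeasurable_funD mcS mcI.
have pSI x : setT x -> (0 <= (kappa `^ d)%:E * (S1 \+ S2)%E x + Wm%:E * I0 x)%E.
  by move=> _; exact: adde_ge0 (pcS x I) (pcI x I).
apply: (@le_trans _ _ (\int[mu]_x ((kappa `^ d)%:E * (S1 \+ S2)%E x + Wm%:E * I0 x +
  (L^-1)%:E * (T1 \+ T2)%E x))%E).
  apply: ge0_le_integral => //.
  - by move=> x _; rewrite lee_fin mulr_ge0// weight_ge0.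
  - by meas.
  - exact: emeasurable_funD mSI mcT.
  move=> x _; have [x0|x0] := leP x 0.
    rewrite (vn _ x0) (en _ x0) subrr normr0 mul0r.
    exact: adde_ge0 (pSI x I) (pcT x I).
  have := weight_split a1a a10 (ltW d0) kap0 kap1 L1 (v0 x) (e0 x) x0.
  by rewrite -lee_fin !(EFinM, EFinD).
rewrite (ge0_integralD mu measurableT pSI mSI pcT mcT).
rewrite (ge0_integralD mu measurableT pcS mcS pcI mcI).
rewrite (ge0_integralZl mu measurableT mS S0 c1) (ge0_integralZl mu measurableT mI0 I00 c2).
rewrite (ge0_integralZl mu measurableT mT T0 c3).
rewrite (ge0_integralD mu measurableT S10 mS1 S20 mS2) (ge0_integralD mu measurableT T10 mT1
  T20 mT2).
apply: (@le_trans _ _ ((kappa `^ d)%:E * (K%:E + K%:E) + Wm%:E * (kappa ^- 2 * ((2 * eta + 4 *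
  eta * L) * L + eps * (4 * C2)))%:E
   + (L^-1)%:E * (C%:E + C%:E))%E).
  by apply: leeD; [apply: leeD|]; apply: lee_wpmul2l => //; exact: leeD.
rewrite -(EFinD K K) -(EFinD C C) -!EFinM -!EFinD lee_fin.
have e3 : Wm * (kappa ^- 2 * ((2 * eta + 4 * eta * L) * L + eps * (4 * C2))) <= delta / 3.
  have h1 : G * (eps * (4 * C2)) <= delta / 6.
    apply: (@le_trans _ _ (eps * E2)); last by rewrite -ler_pdivlMr.
    have := mulr_ge0 eps0 (ltW G0); rewrite /E2.
    by move: (G) => g ?; lra.
  move: etaE h1; rewrite /E1 /G; move: (kappa ^- 2) => ik; lra.
lra.
Qed.

End weighted.

(** * Comparison of profiles *)

Section transfer.
Context {R : realType}.
Notation mu := (@lebesgue_measure R).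
Variables (alpha : R) (W : R -> R -> R) (a b eps : R) (u : R -> R).
Hypothesis hW : admissible_perturbation alpha W.
Hypothesis eps0 : 0 <= eps.
Hypothesis hu : self_similar_profile (perturbed_kernel W eps) u.
Hypothesis hu1 : total_mass_one u.

Let D : set R := `]0, +oo[%classic.
Let v := nonneg_version u.

Lemma measurable_diff_exp : measurable_fun D (fun x => u x - expR (- x)).
Proof.
have [mu_D _ _] := profile_locally_integrable hu.
by apply: measurable_funB => //; apply: measurable_funTS; meas.
Qed.

Lemma integral_diff_exp (g : R -> R) : measurable_fun setT g ->
  (\int[mu]_(x in D) (`|u x - expR (- x)| * g x)%:E =
   \int[mu]_x (`|v x - exp_density x| * g x)%:E)%E.
Proof.
move=> mg; have [mv v0 vn] := nonneg_version_density hu.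
have [me e0 en] := @nonneg_exp_density R.
transitivity (\int[mu]_(x in D) (`|v x - exp_density x| * g x)%:E)%E.
  apply: ae_eq_integral.
  - exact: measurable_itv.
  - apply/measurable_EFinP; apply: measurable_funM; last exact: measurable_funTS.
    by apply: measurableT_comp => //; exact: measurable_diff_exp.
  - by apply: measurable_funTS; rewrite /v; meas.
  - apply: (ae_imply (nonneg_version_ae hu)) => x h; rewrite /D/= in_itv/= andbT => x0.
    by rewrite (h x0) /exp_density x0.
rewrite integral_itv_if; apply: eq_integral => x _.
rewrite in_itv/= andbT; case: ltP => // x0.
by rewrite /v (vn _ x0) (en _ x0) subrr normr0 mul0r.
Qed.

Lemma Xnorm_version :
  Xnorm a b (fun x => u x - expR (- x)) =
  (\int[mu]_x (`|v x - exp_density x| * weight a b x)%:E)%E.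
Proof. exact: integral_diff_exp (measurable_weight a b). Qed.

Lemma integrable_diff_exp : mu.-integrable D (EFin \o (fun x => u x - expR (- x))).
Proof.
apply/integrableP; split.
  by apply/measurable_EFinP; exact: measurable_diff_exp.
have np := near_profile_version hW eps0 hu hu1.
have vd := np_density np; have [mv v0 vn] := vd.
have ed := @nonneg_exp_density R; have [me e0 en] := ed.
have m1 : measurable_fun setT (fun _ : R => 1 : R) by exact: measurable_cst.
have -> : (\int[mu]_(x in D) `|(EFin \o (fun x => u x - expR (- x))%R) x| =
    \int[mu]_(x in D) (`|u x - expR (- x)| * 1)%:E)%E.
  by apply: eq_integral => x _; rewrite mulr1.
rewrite (integral_diff_exp m1).
have p1 : nonneg_on (fun _ : R => 1 : R) by move=> ? _; exact: ler01.
apply: (@le_lt_trans _ _ (moment v (fun=> 1%R) + moment exp_density (fun=> 1%R))%E); last first.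
  rewrite exp_M0; apply: lte_add_pinfty; last exact: ltry.
  exact: le_lt_trans (np_M0_le1 np) (ltry _).
rewrite /moment -ge0_integralD//.
- apply: ge0_le_integral => //.
  + by apply/measurable_EFinP; apply: measurable_funM; [meas|exact: measurable_cst].
  + by apply: emeasurable_funD; apply: measurable_moment.
  + move=> x _; rewrite -EFinD lee_fin !mul1r mulr1.
    have := v0 x; have := e0 x; rewrite -/v => ? ?.
    by rewrite ler_norml; apply/andP; split; lra.
- by move=> x _; rewrite lee_fin mul1r.
- by rewrite /v; meas.
- by move=> x _; rewrite lee_fin mul1r.
- by meas.
Qed.

End transfer.

Lemma Xspace_triangle (R : realType) (a b d1 d2 : R) (u1 u2 w : R -> R) :
  Xspace a b (fun x => u1 x - w x) -> Xspace a b (fun x => u2 x - w x) ->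
  (Xnorm a b (fun x => u1 x - w x)%R <= d1%:E)%E ->
  (Xnorm a b (fun x => u2 x - w x)%R <= d2%:E)%E ->
  Xspace a b (fun x => u1 x - u2 x) /\
  (Xnorm a b (fun x => u1 x - u2 x)%R <= (d1 + d2)%:E)%E.
Proof.
move=> [i1 _] [i2 _] n1 n2.
pose D : set R := `]0, +oo[%classic.
have mD : @measurable _ (measurableTypeR R) D by exact: measurable_itv.
have mw : measurable_fun D (weight a b).
  by apply: measurable_funTS; exact: measurable_weight.
have i12 : (@lebesgue_measure R).-integrable D (EFin \o (fun x => u1 x - u2 x)).
  have := integrableB mD i1 i2; apply: eq_integrable => // x _ /=.
  by rewrite -EFinB; congr (_%:E); lra.
have mn f : (@lebesgue_measure R).-integrable D (EFin \o f) ->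
    measurable_fun D (fun x => (`|f x| * weight a b x)%:E).
  move=> /measurable_int /measurable_EFinP mf.
  apply/measurable_EFinP; apply: measurable_funM => //.
  exact: measurableT_comp.
have n12 : (Xnorm a b (fun x => u1 x - u2 x)%R <= (d1 + d2)%:E)%E.
  rewrite EFinD; apply: le_trans (leeD n1 n2).
  rewrite /Xnorm -ge0_integralD//.
  - apply: ge0_le_integral => //.
    + by move=> x _; rewrite lee_fin mulr_ge0// weight_ge0.
    + exact: (mn _ i12).
    + by apply: emeasurable_funD; [exact: (mn _ i1)|exact: (mn _ i2)].
    + move=> x _; rewrite -EFinD lee_fin -mulrDl ler_wpM2r ?weight_ge0//.
      rewrite (_ : u1 x - u2 x = (u1 x - w x) - (u2 x - w x)); last by lra.
      exact: ler_normB.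
  - by move=> x _; rewrite lee_fin mulr_ge0// weight_ge0.
  - exact: (mn _ i1).
  - by move=> x _; rewrite lee_fin mulr_ge0// weight_ge0.
  - exact: (mn _ i2).
split=> //; split => //; exact: le_lt_trans n12 (ltry _).
Qed.

Theorem theorem2p4 (R : realType) (alpha : R) (W : R -> R -> R)
    (halpha : 0 < alpha < 1) (hW : admissible_perturbation alpha W)
    (a b : R) (ha : -1 < a) (hb : 0 < b) :
  forall delta : R, 0 < delta ->
  exists2 eps_star : R, 0 < eps_star &
  forall eps : R, 0 < eps <= eps_star ->
    (forall u : R -> R,
       self_similar_profile (perturbed_kernel W eps) u -> total_mass_one u ->
       Xspace a b (fun x => u x - expR (- x)) /\
       (Xnorm a b (fun x => u x - expR (- x))%R <= delta%:E)%E) /\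
    (forall u1 u2 : R -> R,
       self_similar_profile (perturbed_kernel W eps) u1 -> total_mass_one u1 ->
       self_similar_profile (perturbed_kernel W eps) u2 -> total_mass_one u2 ->
       Xspace a b (fun x => u1 x - u2 x) /\
       (Xnorm a b (fun x => u1 x - u2 x)%R <= (2 * delta)%:E)%E).
Proof.
move=> delta delta0.
have [es es0 close] := weighted_distance_small halpha ha hb delta0.
exists es => // eps /andP[eps0 epses].
have eps0' := ltW eps0.
have near u : self_similar_profile (perturbed_kernel W eps) u ->
    total_mass_one u ->
    Xspace a b (fun x => u x - expR (- x)) /\
    (Xnorm a b (fun x => u x - expR (- x))%R <= delta%:E)%E.
  move=> hu hu1.
  have np := near_profile_version hW eps0' hu hu1.
  have le : (Xnorm a b (fun x => u x - expR (- x))%R <= delta%:E)%E.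
    by rewrite (Xnorm_version a b hu); apply: (close eps) np; rewrite eps0'.
  split => //; split; first exact: integrable_diff_exp hW eps0' hu hu1.
  exact: le_lt_trans le (ltry _).
split => // u1 u2 hu1 m1 hu2 m2.
have [s1 n1] := near _ hu1 m1; have [s2 n2] := near _ hu2 m2.
rewrite (_ : 2 * delta = delta + delta); last by lra.
exact: Xspace_triangle s1 s2 n1 n2.
Qed.
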